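(* Let $Y$ be a Lévy process in $\mathbb{R}^d$ with generating triplet $(A,N,b)$ and $h(0^+)=\infty$. Assume that $A\ne0$ and that there are $T_3\in(0,\infty]$, $c_3\in(0,1]$, $\alpha_3\in(0,2]$ such that $c_3\Psi^*(|x|)\le \mathrm{Re}[\Psi(x)]$ for all $|x|>1/T_3$, and $\Psi^*(\lambda r)\ge c_3\lambda^{\alpha_3}\Psi^*(r)$ for all $\lambda\ge1$, $r>1/T_3$. Then for all $T,\theta>0$ there is a constant $\tilde c=\tilde c(d,A,N,T,\theta)>0$ such that for all $0<t<T$ and all $|x|\le\theta\sqrt t$, $$p\big(t,\,x+t\,b_{\sqrt t}\big)\ge\tilde c\,t^{-d/2}.$$ If additionally $\int_{\mathbb{R}^d}|x|^2N(dx)<\infty$, then one can take $T=\infty$ with $\tilde c>0$.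
   Context: $Y=(Y_t)_{t\ge0}$ is a Lévy process in $\mathbb{R}^d$, $d\in\mathbb{N}$, with generating triplet $(A,N,b)$: $A$ is a symmetric non-negative definite $d\times d$ matrix, $b\in\mathbb{R}^d$, and $N$ is a Lévy measure (Borel measure with $N(\{0\})=0$, $\int(1\wedge|z|^2)N(dz)<\infty$). The characteristic exponent $\Psi$ is given by $\mathbb{E}e^{i\langle x,Y_t\rangle}=e^{-t\Psi(x)}$, $$\Psi(x)=\langle x,Ax\rangle-i\langle x,b\rangle-\int_{\mathbb{R}^d}\big(e^{i\langle x,z\rangle}-1-i\langle x,z\rangle\mathbf{1}_{|z|<1}\big)N(dz).$$ For $r>0$, $h(r)=r^{-2}\|A\|+\int_{\mathbb{R}^d}\big(1\wedge\frac{|x|^2}{r^2}\big)N(dx)$, $\Psi^*(r)=\sup_{|z|\le r}\mathrm{Re}[\Psi(z)]$, and $$b_r=b+\int_{\mathbb{R}^d}z\big(\mathbf{1}_{|z|<r}-\mathbf{1}_{|z|<1}\big)N(dz).$$ Standing assumption: $h(0^+)=\infty$. Convention: $1/\infty=0$. $p(t,\cdot)$ is the continuous density of the law of $Y_t$ with respect to Lebesgue measure, $p(t,x)=(2\pi)^{-d}\int e^{-i\langle x,z\rangle}e^{-t\Psi(z)}dz$, which exists under the assumptions of the statement. *)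

(* Defs.v *)
From HB Require Import structures.
From mathcomp Require Import all_boot all_order all_algebra.
From mathcomp Require Import all_classical all_reals all_analysis measurable_realfun.
From mathcomp.real_closed Require Import complex.

Set Implicit Arguments.
Unset Strict Implicit.
Unset Printing Implicit Defensive.

Import Order.TTheory GRing.Theory Num.Theory.
Import numFieldNormedType.Exports.

Local Open Scope classical_set_scope.
Local Open Scope ring_scope.
Local Open Scope complex_scope.

(* Matrices, hence the row vectors 'rV[R]_d standing for R^d, carry the Borel
   sigma-algebra of their (entrywise) topology. *)
HB.instance Definition _ (R : realType) (m n : nat) :=
  @isMeasurable.Build (sigma_display (@open 'M[R]_(m, n))) 'M[R]_(m, n)
    <<s @open 'M[R]_(m, n) >> (@sigma_algebra0 _ setT _)
    (@sigma_algebraC _ _) (@sigma_algebra_bigcup _ setT _).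

Section borel_rV.
Context {R : realType}.

Lemma open_measurable_mx m n (U : set 'M[R]_(m, n)) : open U -> measurable U.
Proof. exact: sub_sigma_algebra. Qed.

Lemma measurable_coord n (i : 'I_n) :
  measurable_fun [set: 'rV[R]_n] (fun v => v ord0 i).
Proof.
apply: (measurability _ (RGenOpens.measurableE R)) => _ [_ [a [b ->]] <-].
rewrite setTI; apply: open_measurable_mx.
by apply: open_comp; [move=> + _; exact: coord_continuous | exact: interval_open].
Qed.

Lemma measurable_rV d (T : measurableType d) n (f : T -> 'rV[R]_n) :
  (forall i, measurable_fun setT (fun t => f t ord0 i)) ->
  measurable_fun setT f.
Proof.
move=> mf; apply: (@measurability _ _ _ _ _ _ (@open 'rV[R]_n) erefl).
move=> _ [U oU <-]; rewrite setTI.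
pose box (q : 'rV[rat]_n * nat) : set 'rV[R]_n :=
  [set v | forall i, `|v ord0 i - ratr (q.1 ord0 i)| < q.2.+1%:R^-1].
pose F q := if `[< box q `<=` U >] then f @^-1` box q else set0.
suff -> : f @^-1` U = \bigcup_q F q.
  apply: countable_bigcupT_measurable => // q; rewrite /F.
  case: ifP => // _.
  rewrite (_ : _ @^-1` _ = \bigcap_(i in [set: 'I_n]) [set t |
    `|f t ord0 i - ratr (q.1 ord0 i)| < q.2.+1%:R^-1]); last first.
    by apply/seteqP; split => [t /= tq i _|t /= tq i]; exact: tq.
  apply: fin_bigcap_measurable => // i _.
  rewrite -[X in measurable X]setTI.
  rewrite (_ : [set t | _] = (fun t => f t ord0 i) @^-1`
    `](ratr (q.1 ord0 i) - q.2.+1%:R^-1),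
      (ratr (q.1 ord0 i) + q.2.+1%:R^-1)[); last first.
    by apply/seteqP; split => t /=; rewrite in_itv/= ltr_distl.
  by apply: mf => //; exact: measurable_itv.
apply/seteqP; split => [t /= Ut|t [q _]]; last first.
  by rewrite /F; case: ifPn => // /asboolP; exact.
have /nbhs_ballP[e /= e0 eU] := open_nbhs_nbhs (conj oU Ut).
have [k ke] : exists k, k.+1%:R^-1 < e / 2 :> R.
  have /ltr_add_invr[k] : 0 < e / 2 :> R by rewrite divr_gt0.
  by rewrite add0r => ke; exists k.
have k0 : 0 < k.+1%:R^-1 :> R by rewrite invr_gt0.
have approx i : exists q, `|f t ord0 i - ratr q| < k.+1%:R^-1.
  have [] := @dense_rat R (ball (f t ord0 i) k.+1%:R^-1).
  - by exists (f t ord0 i); exact: ballxx.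
  - exact: ball_open.
  - by move=> y [/= by_ [q _ qy]]; exists q; rewrite qy.
have [g gP] := choice approx.
exists (\row_i g i, k) => //; rewrite /F ifT.
  by move=> i /=; rewrite mxE; exact: gP.
apply/asboolP => v /= vb; apply: eU; split => // i j.
rewrite (ord1 i) /ball/=.
rewrite (le_lt_trans (ler_distD (ratr (g j)) _ _))// [ltRHS]splitr ltrD//.
  exact: lt_trans (gP j) ke.
by rewrite distrC (lt_trans _ ke)//; have := vb j; rewrite mxE.
Qed.


Definition cons_rV n (va : 'rV[R]_n * measurableTypeR R) : 'rV[R]_n.+1 :=
  row_mx (const_mx va.2 : 'rV_1) va.1.

Lemma measurable_cons_rV n : measurable_fun setT (@cons_rV n).
Proof.
apply: measurable_rV => i; rewrite /cons_rV.
under eq_fun do rewrite mxE.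
case: splitP => j _ /=.
  by under eq_fun do rewrite mxE; exact: measurable_snd.
exact: measurableT_comp (measurable_coord j) measurable_fst.
Qed.

HB.instance Definition _ n :=
  isMeasurableFun.Build _ _ _ _ (@cons_rV n) (@measurable_cons_rV n).

(* Lebesgue measure on R^n is the n-fold product of the Lebesgue measure on R,
   transported to row vectors; see lebesgue_rV_box. *)
Definition lebesgue_step n (mu : {measure set 'rV[R]_n -> \bar R}) :
    set 'rV[R]_n.+1 -> \bar R :=
  pushforward (mu \x @lebesgue_measure R)%E (@cons_rV n).

Section lebesgue_step_measure.
Context n (mu : {measure set 'rV[R]_n -> \bar R}).

Let lebesgue_step0 : lebesgue_step mu set0 = 0%E.
Proof. exact: measure0. Qed.

Let lebesgue_step_ge0 B : (0 <= lebesgue_step mu B)%E.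
Proof. exact: measure_ge0. Qed.

Let lebesgue_step_sigma_additive : semi_sigma_additive (lebesgue_step mu).
Proof. exact: measure_semi_sigma_additive. Qed.

HB.instance Definition _ := isMeasure.Build _ _ _ (lebesgue_step mu)
  lebesgue_step0 lebesgue_step_ge0 lebesgue_step_sigma_additive.

End lebesgue_step_measure.

Fixpoint lebesgue_rV n : {measure set 'rV[R]_n -> \bar R} :=
  if n is n'.+1 then lebesgue_step (lebesgue_rV n') else \d_(0 : 'rV[R]_0).

Lemma lebesgue_rV_box n (B : 'I_n -> set R) : (forall i, measurable (B i)) ->
  lebesgue_rV n [set v : 'rV[R]_n | forall i, B i (v ord0 i)]
  = (\prod_(i < n) @lebesgue_measure R (B i))%E.
Proof.
elim: n B => [|n IHn] B mB.
  rewrite big_ord0 /= diracE mem_set//=; by case.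
pose C := [set v : 'rV[R]_n | forall i, B (lift ord0 i) (v ord0 i)].
have mC : measurable C.
  rewrite (_ : C = \bigcap_(i in [set: 'I_n])
      (fun v : 'rV[R]_n => v ord0 i) @^-1` B (lift ord0 i)); last first.
    by apply/seteqP; split => [v Cv i _|v Cv i]; exact: Cv.
  apply: fin_bigcap_measurable => // i _; rewrite -[X in measurable X]setTI.
  exact: measurable_coord.
rewrite big_ord_recl muleC -IHn// -product_measure1E//=; last exact: mB.
rewrite /lebesgue_step /pushforward; congr (_ _).
have cons0 va : @cons_rV n va ord0 ord0 = va.2.
  by rewrite /cons_rV mxE; case: splitP => //= j _; rewrite mxE.
have consS va i : @cons_rV n va ord0 (lift ord0 i) = va.1 ord0 i.
  rewrite /cons_rV mxE; case: splitP => [[[]]//|j /= [ij]].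
  by congr (_ _ _); exact/val_inj.
apply/seteqP; split => [va /= Bva|va /= [Cv Ba] i].
  split; last by rewrite -(cons0 va).
  by move=> i /=; rewrite -consS.
case: (unliftP ord0 i) => [j|] ->; last by rewrite cons0.
by rewrite consS; exact: Cv.
Qed.

End borel_rV.

Section euclidean.
Context {R : realType} {d : nat}.

Definition dotp (x y : 'rV[R]_d) : R := \sum_(i < d) x ord0 i * y ord0 i.

(* The library norm `|x| on matrices is the max norm. *)
Definition enorm (x : 'rV[R]_d) : R := Num.sqrt (dotp x x).

(* Vectors are rows, so x *m A is the transpose of A x when A is symmetric. *)
Definition opnorm (A : 'M[R]_d) : R :=
  sup [set enorm (x *m A) | x in [set x | enorm x <= 1]].

Definition psd (A : 'M[R]_d) : Prop := forall x, 0 <= dotp x (x *m A).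

End euclidean.

Section complex_integral.
Context {R : realType}.

(* complex.Re and complex.Im are the real-valued projections of R[i]; the
   unqualified names denote the R[i]-valued ones of numClosedFieldType. *)
Definition cexp (z : R[i]) : R[i] :=
  (expR (complex.Re z))%:C * (cos (complex.Im z) +i* sin (complex.Im z)).

Definition cintegral d (T : measurableType d) (mu : {measure set T -> \bar R})
    (f : T -> R[i]) : R[i] :=
  (\int[mu]_x complex.Re (f x)) +i* (\int[mu]_x complex.Im (f x)).

End complex_integral.

Section triplet.
Context {R : realType} {d : nat}.
Variables (A : 'M[R]_d) (N : {measure set 'rV[R]_d -> \bar R}) (b : 'rV[R]_d).

Definition levy_measure : Prop :=
  N [set 0] = 0%E /\ (\int[N]_z (Num.min 1 (enorm z ^+ 2))%:E < +oo)%E.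

Definition generating_triplet : Prop := [/\ A^T = A, psd A & levy_measure].

(* Psi; there is no factor 1/2 in the Gaussian part. *)
Definition char_exponent (x : 'rV[R]_d) : R[i] :=
  (dotp x (x *m A))%:C - 'i%C * (dotp x b)%:C
  - cintegral N (fun z => cexp ('i%C * (dotp x z)%:C) - 1
                          - 'i%C * (dotp x z * (enorm z < 1)%R%:R)%:C).

(* Psi^*; for r >= 0 the set is nonempty and bounded. *)
Definition char_exponent_sup (r : R) : R :=
  sup [set complex.Re (char_exponent z) | z in [set z | enorm z <= r]].

(* The function h; the limit h(0+) may be infinite. *)
Definition concentration (r : R) : \bar R :=
  ((r ^- 2 * opnorm A)%:E
   + \int[N]_x (Num.min 1 (enorm x ^+ 2 / r ^+ 2))%:E)%E.

(* b_r; the integrand is bounded with support in an annulus, so that the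
   coordinatewise integrals converge. *)
Definition drift (r : R) : 'rV[R]_d :=
  b + \row_i \int[N]_z (z ord0 i * ((enorm z < r)%R%:R - (enorm z < 1)%R%:R)).

(* T is in ]0, +oo], and T^-1 = 0 for T = +oo. *)
Definition scaling_condition (T : \bar R) (c alpha : R) : Prop :=
  (forall x : 'rV[R]_d, (T^-1 < (enorm x)%:E)%E ->
     c * char_exponent_sup (enorm x) <= complex.Re (char_exponent x)) /\
  (forall lambda r : R, 1 <= lambda -> (T^-1 < r%:E)%E ->
     c * lambda `^ alpha * char_exponent_sup r
       <= char_exponent_sup (lambda * r)).

End triplet.

Section levy_process.
Context {R : realType} {d : nat} {dO : measure_display}.
Context {Omega : measurableType dO}.
Variables (P : probability Omega R) (Y : R -> Omega -> 'rV[R]_d).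

(* Taking some of the B i to be setT yields the product rule for subfamilies. *)
Definition independent_family n (X : 'I_n -> Omega -> 'rV[R]_d) : Prop :=
  forall B : 'I_n -> set 'rV[R]_d, (forall i, measurable (B i)) ->
    P (\bigcap_(i in [set: 'I_n]) (X i @^-1` B i))
    = (\prod_(i < n) P (X i @^-1` B i))%E.

Definition increment (s t : R) (w : Omega) : 'rV[R]_d := Y t w - Y s w.

Record levy_process : Prop := LevyProcess {
  levy_measurable : forall t, 0 <= t -> measurable_fun setT (Y t);
  levy_start : {ae P, forall w, Y 0 w = 0};
  levy_independent : forall n (s : nat -> R), 0 <= s 0%N ->
    {homo s : i j / (i <= j)%N >-> i <= j} ->
    independent_family (fun i : 'I_n => increment (s i) (s i.+1));
  levy_stationary : forall s t, 0 <= s -> 0 <= t ->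
    forall B : set 'rV[R]_d, measurable B ->
    P (increment s (s + t) @^-1` B) = P (increment 0 t @^-1` B);
  levy_continuous : forall s e, 0 <= s -> 0 < e ->
    P [set w | e < enorm (increment s u w)]
      @[u --> within [set u | 0 <= u] (nbhs s)] --> 0%E;
  levy_cadlag : {ae P, forall w, forall t, 0 <= t ->
    Y u w @[u --> t^'+] --> Y t w /\
    (0 < t -> cvg (Y u w @[u --> t^'-]))}
}.

Definition has_triplet (A : 'M[R]_d) (N : {measure set 'rV[R]_d -> \bar R})
    (b : 'rV[R]_d) : Prop :=
  forall t x, 0 <= t ->
    cintegral P (fun w => cexp ('i%C * (dotp x (Y t w))%:C))
    = cexp (- (t%:C * char_exponent A N b x)).

Definition continuous_density (p : R -> 'rV[R]_d -> R) : Prop :=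
  forall t, 0 < t ->
    [/\ continuous (p t), forall x, 0 <= p t x &
        forall B, measurable B ->
          P (Y t @^-1` B) = (\int[lebesgue_rV d]_(x in B) (p t x)%:E)%E].

End levy_process.

(* Main.v *)
Require Import Defs.
From HB Require Import structures.
From mathcomp Require Import all_boot all_order all_algebra.
From mathcomp Require Import all_classical all_reals all_analysis.
From mathcomp Require Import ring lra measurable_realfun.
From mathcomp.real_closed Require Import complex.

Set Implicit Arguments.
Unset Strict Implicit.
Unset Printing Implicit Defensive.

Import Order.TTheory GRing.Theory Num.Theory.
Import numFieldNormedType.Exports.

Local Open Scope classical_set_scope.
Local Open Scope ring_scope.

(* Only the Gaussian part matters.  The scaling condition makes A positive
   definite, A >= l for some l > 0 which may be chosen from A alone; write
   A = l + A'.  Removing the factor exp(- t l |xi|^2) from the characteristic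
   function of Y_t leaves the symbol chi of a law mu, and p(t, .) is the
   convolution of mu with an isotropic Gaussian of variance proportional to
   t l.  By Jensen's inequality such a mixture is at least
   exp(- E|x - Z|^2 / (4 r)) times the peak of the Gaussian, so a bound of order
   t on the second moment of the small jumps and of A' suffices; the jumps with
   |z| >= sqrt t are simply discarded, which costs a factor exp(- C), their
   intensity over time t being bounded.

   The law mu is never constructed.  The bound
     f_F(x) >= C exp(- |x - a|^2 / (4 r)),
   where f_F(x) is the normalized integral of
   Re (exp(- i <x, xi>) F(xi)) exp(- r |xi|^2), is propagated from F = 1 to
   F = chi: it survives multiplication of F by 1 + (tau / n) (M^ - M(V)), which
   acts on f_F as a positive averaging operator, hence by
   exp(tau (M^ - M(V))) for every finite measure M, and it survives pointwise
   limits.  Every factor of chi is such a limit: A' is a sum of squares, each a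
   limit of pairs of Dirac masses, and N is the limit of its restrictions to
   |z| >= 1 / n.  Finally E[exp(- |x - Y_t|^2 / (4 s))] is an f_F at a point, and
   s -> 0 recovers the continuous density. *)

(** * Gaussian integrals on the line *)

(** A Gaussian minorant of fixed rate [1 / (4 r)] is a workable invariant because its exponent is
    quadratic: averaging over a jump [Z] involves only the first two moments of [Z], so a step moves
    the centre by the mean and multiplies the constant by the exponential of minus a second moment
    over [4 r]. The rate never degrades, and the costs of arbitrarily many small steps add up in the
    exponent. The positivity of f_F, which usually comes from f_F being a density, comes from the
    minorant itself. The radius [sqrt t] serves twice. Cutting the compensator there turns the drift
    into exactly the translation by [t b_r] with [r = sqrt t]; and one bound [K] on the integral of
    [min (t, |z|^2)] controls both the second moment of the jumps below it and [t] times the mass of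
    those above. Since the final weight lies between [t l] and [2 t l], all costs are then free of
    [t]. The time horizon is felt through [K] alone. The scaling condition is exploited along rays:
    [Re Psi (n u) / n^2] tends to [<u, A u>], so the values of this form on the unit sphere are
    mutually comparable. *)

Section real_integrals.
Context d (T : measurableType d) (R : realType) (mu : {measure set T -> \bar R}).

Lemma cvg_Rintegral_dominated (f_ : nat -> T -> R) (f g : T -> R) :
  (forall n, measurable_fun setT (f_ n)) ->
  (forall x, f_ n x @[n --> \oo] --> f x) ->
  mu.-integrable setT (EFin \o g) ->
  (forall n x, `|f_ n x| <= g x) ->
  \int[mu]_x f_ n x @[n --> \oo] --> \int[mu]_x f x.
Proof.
move=> mf_ f_f ig f_g.
have mf : measurable_fun setT f.
  by apply: (@measurable_fun_cvg _ _ _ setT f_) => // x _; exact: f_f.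
have [|||//||fint _ h] := @dominated_convergence _ T R mu setT measurableT
    (fun n x => (f_ n x)%:E) (EFin \o f) (EFin \o g).
- by move=> n; exact/measurable_EFinP.
- exact/measurable_EFinP.
- by apply: aeW => x _; apply: cvg_EFin; [exact: nearW|exact: f_f].
- by apply: aeW => x n _; rewrite /= lee_fin.
apply: fine_cvg; rewrite fineK//.
exact: integrable_fin_num.
Qed.

Lemma integrableZl_EFin k (f : T -> R) : mu.-integrable setT (EFin \o f) ->
  mu.-integrable setT (fun x => (k * f x)%:E).
Proof. by move=> fi; under eq_fun do rewrite EFinM; exact: integrableZl. Qed.

Lemma integrableD_EFin (f g : T -> R) : mu.-integrable setT (EFin \o f) ->
  mu.-integrable setT (EFin \o g) -> mu.-integrable setT (fun x => (f x + g x)%:E).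
Proof. by move=> fi gi; under eq_fun do rewrite EFinD; exact: integrableD. Qed.

Lemma integrableB_EFin (f g : T -> R) : mu.-integrable setT (EFin \o f) ->
  mu.-integrable setT (EFin \o g) -> mu.-integrable setT (fun x => (f x - g x)%:E).
Proof. by move=> fi gi; under eq_fun do rewrite EFinB; exact: integrableB. Qed.

Lemma integrable_sum_EFin (I : Type) (s : seq I) (f : I -> T -> R) :
  (forall i, mu.-integrable setT (EFin \o f i)) ->
  mu.-integrable setT (fun x => (\sum_(i <- s) f i x)%:E).
Proof.
move=> fi; elim: s => [|i s IH].
  under eq_fun do rewrite big_nil; exact: integrable0.
by under eq_fun do rewrite big_cons; exact: integrableD_EFin.
Qed.

Lemma Rintegral_sum (I : Type) (s : seq I) (f : I -> T -> R) :
  (forall i, mu.-integrable setT (EFin \o f i)) ->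
  \int[mu]_x (\sum_(i <- s) f i x) = \sum_(i <- s) \int[mu]_x f i x.
Proof.
move=> fi; elim: s => [|i s IH].
  rewrite big_nil; transitivity (\int[mu]_x (0 * 0 : R)); last first.
    by rewrite RintegralZl ?mul0r//; exact: integrable0.
  by apply: eq_Rintegral => x _; rewrite big_nil mul0r.
rewrite big_cons -IH -RintegralD//; last exact: integrable_sum_EFin.
by apply: eq_Rintegral => x _; rewrite big_cons.
Qed.

End real_integrals.

Lemma cvg_le_inv {R : realType} (u : nat -> R) (l K : R) :
  (forall n, `|u n - l| <= K / n.+1%:R) -> u n @[n --> \oo] --> l.
Proof.
move=> h; apply/cvgrPdist_le => e e0; near=> n.
rewrite distrC (le_trans (h n))// ler_pdivrMr// mulrC -ler_pdivrMr//.
near: n; exists (Num.truncn `|K / e|) => // n/= xn.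
rewrite (le_trans (ler_norm _))// (le_trans (ltW (truncnS_gt _)))// ler_nat.
by rewrite ltnS.
Unshelve. all: by end_near. Qed.

Section gaussian.
Context {R : realType}.
Notation mu := (@lebesgue_measure R).

Definition gauss_weight (r x : R) : R := expR (- (r * x ^+ 2)).

Lemma gauss_weight_normal (r m x : R) : 0 < r ->
  gauss_weight r (x - m) =
  Num.sqrt (pi / r) * normal_pdf m (Num.sqrt (r *+ 2)^-1) x.
Proof.
move=> r0; have r2 : 0 < (r *+ 2)^-1 by rewrite invr_gt0 mulrn_wgt0.
rewrite normal_pdfE ?gt_eqF ?sqrtr_gt0// /normal_peak /normal_fun.
rewrite sqr_sqrtr ?ltW//.
rewrite (_ : (r *+ 2)^-1 * pi *+ 2 = pi / r); last first.
  by field; rewrite gt_eqF.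
rewrite mulrA divff ?mul1r; last by rewrite gt_eqF// sqrtr_gt0 divr_gt0// pi_gt0.
by congr expR; field; rewrite gt_eqF.
Qed.

Lemma integral_gauss_weight (r m : R) : 0 < r ->
  (\int[mu]_x (gauss_weight r (x - m))%:E = (Num.sqrt (pi / r))%:E)%E.
Proof.
move=> r0; under eq_integral do rewrite gauss_weight_normal// EFinM.
rewrite integralZl//; last exact: integrable_normal_pdf.
by rewrite integral_normal_pdf mule1.
Qed.

Lemma measurable_gauss_weight (r : R) : measurable_fun setT (gauss_weight r).
Proof.
apply: measurableT_comp => //; apply: measurableT_comp => //.
by apply: measurable_funM => //; exact: measurable_funX.
Qed.

Lemma gauss_weight_ge0 (r x : R) : 0 <= gauss_weight r x.
Proof. exact: expR_ge0. Qed.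

Lemma gauss_weightN (r x : R) : gauss_weight r (- x) = gauss_weight r x.
Proof. by rewrite /gauss_weight sqrrN. Qed.

Lemma integrable_gauss_weight (r : R) : 0 < r ->
  mu.-integrable setT (EFin \o gauss_weight r).
Proof.
move=> r0; apply/integrableP; split.
  by apply/measurable_EFinP; exact: measurable_gauss_weight.
under eq_integral do rewrite /= ger0_norm ?gauss_weight_ge0// -[X in gauss_weight _ X]subr0.
by rewrite integral_gauss_weight// ltry.
Qed.

(** The fundamental theorem of calculus on [[- n - 1, n + 1]], with [n] sent to infinity by
    dominated convergence under [|f|]. Applied to a product, it is integration by parts without
    boundary terms. *)
Lemma Rintegral_derive0 (F f : R -> R) :
  continuous f -> (forall x, is_derive x (1 : R) F (f x)) ->
  mu.-integrable setT (EFin \o f) ->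
  F n%:R @[n --> \oo] --> 0 -> F (- n%:R) @[n --> \oo] --> 0 ->
  \int[mu]_x f x = 0.
Proof.
move=> cf dF intf Fy FNy.
pose I n : set R := `[- n.+1%:R, n.+1%:R]%classic.
pose f_ n := f \_ (I n).
have mf : measurable_fun setT f by exact: continuous_measurable_fun.
have h : \int[mu]_x f_ n x @[n --> \oo] --> \int[mu]_x f x.
  apply: (@cvg_Rintegral_dominated _ _ _ mu f_ f (fun x => `|f x|)).
  - move=> n; apply: (measurable_restrictT _ (measurable_itv _)).1.
    exact: measurable_funTS.
  - move=> x; apply/cvg_ballP => e e0; near=> n.
    rewrite /f_ patchE ifT; first exact: ballxx.
    rewrite /I inE/= in_itv/= -ler_norml.
    near: n; exists (Num.truncn `|x|) => // n/= xn.
    by rewrite (le_trans (ltW (truncnS_gt _)))// ler_nat.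
  - exact: integrable_norm.
  - by move=> n x; rewrite /f_ patchE; case: ifP => //; rewrite normr0.
have e : (fun n => \int[mu]_x f_ n x) = fun n => F n.+1%:R - F (- n.+1%:R).
  apply/funext => n; rewrite /f_ -Rintegral_mkcond /Rintegral.
  rewrite (@continuous_FTC2 _ f F)//.
  - by rewrite gtrN.
  - exact: continuous_subspaceT.
  - have cF x : {for x, continuous F}.
      by apply: differentiable_continuous; apply/derivable1_diffP; apply: ex_derive.
    split.
    + by move=> x _; exact: ex_derive.
    + by apply: cvg_at_right_filter; exact: cF.
    + by apply: cvg_at_left_filter; exact: cF.
  - by move=> x _; rewrite derive1E derive_val.
move: h; rewrite e => h.
have h0 : F n.+1%:R - F (- n.+1%:R) @[n --> \oo] --> (0 - 0 : R).
  by apply: cvgB; [rewrite (cvg_shiftS (fun n => F n%:R))|rewrite (cvg_shiftS (fun n => F (- n%:R)))].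
by rewrite subr0 in h0; exact: (cvg_unique _ h h0).
Unshelve. all: by end_near. Qed.

Lemma cvg_gauss_weight (r : R) : 0 < r -> gauss_weight r n%:R @[n --> \oo] --> 0.
Proof.
move=> r0; apply: (@squeeze_cvgr _ _ _ _ (fun=> 0) (fun n => expR (- r) ^+ n)).
- apply: nearW => n; rewrite gauss_weight_ge0/= -expRM_natr.
  rewrite ler_expR mulNr lerN2 ler_pM2l// -natrX ler_nat.
  by rewrite -mulnn; case: n => // n; rewrite leq_pmulr.
- exact: cvg_cst.
- apply: cvg_expr; rewrite ger0_norm ?expR_ge0//.
  by rewrite -[ltRHS]expR0 ltr_expR oppr_lt0.
Qed.

(** Half of the exponent pays for the factor: [|x| <= 1 + x^2 <= (1 + 2 / r) (1 + r x^2 / 2)], and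
    the last factor is at most [exp (r x^2 / 2)]. *)
Lemma integrable_gauss_weight_norm (r : R) : 0 < r ->
  mu.-integrable setT (fun x => (`|x| * gauss_weight r x)%:E).
Proof.
move=> r0; have r20 : 0 < r / 2 by rewrite divr_gt0.
have : mu.-integrable setT (fun x => ((1 + 2 / r) * gauss_weight (r / 2) x)%:E).
  by apply: integrableZl_EFin; exact: integrable_gauss_weight.
apply: le_integrable => //.
  apply/measurable_EFinP; apply: measurable_funM => //.
  exact: measurable_gauss_weight.
move=> x _ /=; rewrite lee_fin !normrM normr_id !(ger0_norm (gauss_weight_ge0 _ _)).
rewrite [`|1 + _|]ger0_norm; last by rewrite addr_ge0// divr_ge0// ltW.
rewrite -ler_pdivlMr ?expR_gt0// -mulrA -expRN -expRD opprK.
rewrite (_ : - _ + _ = r / 2 * x ^+ 2); last by field.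
have h : 1 + r / 2 * x ^+ 2 <= expR (r / 2 * x ^+ 2) by exact: expR_ge1Dx.
have r1 : 0 < 2 / r by rewrite divr_gt0.
apply: (@le_trans _ _ ((1 + 2 / r) * (1 + r / 2 * x ^+ 2))); last first.
  by rewrite ler_wpM2l// addr_ge0// ltW.
rewrite (_ : _ * _ = 1 + 2 / r + r / 2 * x ^+ 2 + x ^+ 2); last first.
  by field; rewrite gt_eqF.
have : `|x| <= 1 + x ^+ 2.
  by rewrite -real_normK ?num_real//; have := sqr_ge0 (`|x| - 1); nra.
have : 0 <= r / 2 * x ^+ 2 by rewrite mulr_ge0 ?sqr_ge0// ltW.
by lra.
Qed.

(** The phase [a] covers cosine and sine at once; in higher dimension it holds the contribution of
    the other coordinates. *)
Definition gauss_cos (r a y : R) : R := \int[mu]_x (cos (y * x + a) * gauss_weight r x).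

Lemma is_derive_trig_gauss (r a y x : R) :
  is_derive x (1 : R) (fun x => sin (y * x + a) * gauss_weight r x)
    (y * (cos (y * x + a) * gauss_weight r x)
     - (2 * r) * (x * (sin (y * x + a) * gauss_weight r x))).
Proof.
have h1 : is_derive x (1 : R) (fun x => y * x + a) y.
  by apply: is_derive_eq; rewrite /GRing.scale/=; ring.
have h2 : is_derive x (1 : R) (fun x => - (r * x ^+ 2)) (- (2 * r * x)).
  apply: is_derive_eq; rewrite /GRing.scale/=; ring.
have h3 := @is_derive1_comp _ sin (fun x => y * x + a) x _ _ (is_derive_sin (y * x + a)) h1.
have h4 := @is_derive1_comp _ expR (fun x => - (r * x ^+ 2)) x _ _ (is_derive_expR _) h2.
rewrite /comp in h3 h4.
apply: is_derive_eq; rewrite /GRing.scale/= /gauss_weight; ring.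
Qed.

Lemma measurable_trig_gauss (r a y : R) (h : R -> R) : measurable_fun setT h ->
  measurable_fun setT (fun x => h (y * x + a) * gauss_weight r x).
Proof.
move=> mh; apply: measurable_funM; last exact: measurable_gauss_weight.
apply: measurableT_comp => //.
by apply: measurable_funD => //; exact: measurable_funM.
Qed.

Lemma integrable_trig_gauss (r a y : R) (h : R -> R) : 0 < r ->
  measurable_fun setT h -> (forall x, `|h x| <= 1) ->
  mu.-integrable setT (fun x => (h (y * x + a) * gauss_weight r x)%:E).
Proof.
move=> r0 mh h1; apply: le_integrable (integrable_gauss_weight r0) => //.
  by apply/measurable_EFinP; exact: measurable_trig_gauss.
move=> x _ /=; rewrite lee_fin normrM (ger0_norm (gauss_weight_ge0 _ _)).
by rewrite ler_piMl ?gauss_weight_ge0.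
Qed.

Lemma integrable_xtrig_gauss (r a y : R) (h : R -> R) : 0 < r ->
  measurable_fun setT h -> (forall x, `|h x| <= 1) ->
  mu.-integrable setT (fun x => (x * (h (y * x + a) * gauss_weight r x))%:E).
Proof.
move=> r0 mh h1; apply: le_integrable (integrable_gauss_weight_norm r0) => //.
  by apply/measurable_EFinP; apply: measurable_funM => //; exact: measurable_trig_gauss.
move=> x _ /=; rewrite lee_fin !normrM normr_id (ger0_norm (gauss_weight_ge0 _ _)).
by rewrite ler_wpM2l// ler_piMl ?gauss_weight_ge0.
Qed.

Lemma measurable_sin : measurable_fun setT (@sin R).
Proof. exact: continuous_measurable_fun (@continuous_sin R). Qed.

Lemma measurable_cos : measurable_fun setT (@cos R).
Proof. exact: continuous_measurable_fun (@continuous_cos R). Qed.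

Lemma normr_sin_le1 (x : R) : `|sin x| <= 1.
Proof. by rewrite ler_norml sin_geN1 sin_le1. Qed.

Lemma normr_cos_le1 (x : R) : `|cos x| <= 1.
Proof. by rewrite ler_norml cos_geN1 cos_le1. Qed.

(** The derivative of [sin (y x + a) exp (- r x^2)] integrates to 0, and its two terms are the two
    sides. *)
Lemma gauss_cos_parts (r a y : R) : 0 < r ->
  (2 * r) * \int[mu]_x (x * (sin (y * x + a) * gauss_weight r x))
  = y * gauss_cos r a y.
Proof.
move=> r0.
have is_ := integrable_xtrig_gauss a y r0 measurable_sin normr_sin_le1.
have ic := integrable_trig_gauss a y r0 measurable_cos normr_cos_le1.
apply/esym/eqP; rewrite -subr_eq0 /gauss_cos; apply/eqP.
rewrite -!RintegralZl// -RintegralB//; last 2 first.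
- exact: integrableZl_EFin.
- exact: integrableZl_EFin.
apply: (Rintegral_derive0 (F := fun x => sin (y * x + a) * gauss_weight r x)).
- have cl : continuous (fun x : R => y * x + a).
    move=> x; apply: cvgD; last exact: cvg_cst.
    by apply: cvgM; [exact: cvg_cst|exact: cvg_id].
  have cg : continuous (gauss_weight r).
    move=> x; apply: (cvg_comp _ expR); last exact: continuous_expR.
    apply: cvgN; apply: cvgM; [exact: cvg_cst|].
    exact: exprn_continuous.
  move=> x; apply: cvgB; apply: cvgM; [exact: cvg_cst| |exact: cvg_cst|].
    apply: cvgM; last exact: cg.
    by apply: (cvg_comp _ cos); [exact: cl|exact: continuous_cos].
  apply: cvgM; first exact: cvg_id.
  apply: cvgM; last exact: cg.
  by apply: (cvg_comp _ sin); [exact: cl|exact: continuous_sin].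
- by move=> x; exact: is_derive_trig_gauss.
- by apply: integrableB_EFin; exact: integrableZl_EFin.
- apply: (@squeeze_cvgr _ _ _ _ (fun n => - gauss_weight r n%:R) (fun n => gauss_weight r n%:R)).
  + apply: nearW => n; rewrite -ler_norml normrM (ger0_norm (gauss_weight_ge0 _ _)).
    by rewrite ler_piMl ?gauss_weight_ge0// normr_sin_le1.
  + by rewrite -oppr0; apply: cvgN; exact: cvg_gauss_weight.
  + exact: cvg_gauss_weight.
- apply: (@squeeze_cvgr _ _ _ _ (fun n => - gauss_weight r n%:R) (fun n => gauss_weight r n%:R)).
  + apply: nearW => n; rewrite -ler_norml normrM (ger0_norm (gauss_weight_ge0 _ _)).
    by rewrite gauss_weightN ler_piMl ?gauss_weight_ge0// normr_sin_le1.
  + by rewrite -oppr0; apply: cvgN; exact: cvg_gauss_weight.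
  + exact: cvg_gauss_weight.
Qed.

(** Differentiation under the integral sign, dominated by [|x| exp (- r x^2)]; integration by parts
    turns the result back into a multiple of [gauss_cos], which gives a linear differential equation
    in [y]. *)
Lemma is_derive_gauss_cos (r a y : R) : 0 < r ->
  is_derive y (1 : R) (gauss_cos r a) (- (y / (2 * r) * gauss_cos r a y)).
Proof.
move=> r0.
pose f y x := cos (y * x + a) * gauss_weight r x.
have df z x : is_derive z (1 : R) (fun z => f z x) (- (x * (sin (z * x + a) * gauss_weight r x))).
  rewrite /f.
  have h1 : is_derive z (1 : R) (fun z => z * x + a) x.
    by apply: is_derive_eq; rewrite /GRing.scale/=; ring.
  have h3 := @is_derive1_comp _ cos (fun z => z * x + a) z _ _ (is_derive_cos (z * x + a)) h1.
  rewrite /comp in h3.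
  by apply: is_derive_eq; rewrite /GRing.scale/=; ring.
have yI : `]y - 1, y + 1[%classic y by rewrite /= in_itv/= ltrBlDr ltrDl ltr01.
have i1 z : mu.-integrable setT (EFin \o f z).
  exact: (integrable_trig_gauss a z r0 measurable_cos normr_cos_le1).
have hb z x : `|partial1of2 f z x| <= `|x| * gauss_weight r x.
  rewrite partial1of2E (@derive_val _ _ _ _ _ _ _ (df z x)) normrN !normrM.
  rewrite (ger0_norm (gauss_weight_ge0 _ _)).
  by rewrite ler_wpM2l// ler_piMl ?gauss_weight_ge0// normr_sin_le1.
have hG : forall x : R, 0 <= `|x| * gauss_weight r x.
  by move=> x; rewrite mulr_ge0// gauss_weight_ge0.
have dJ : derivable (gauss_cos r a) y 1.
  apply: (@derivable_under_integral _ _ _ mu f setT measurableT y (y - 1) (y + 1) yI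
    (fun z _ => i1 z) (fun z x _ _ => @ex_derive _ _ _ _ _ _ _ (df z x)) _ hG
    (integrable_gauss_weight_norm r0) (fun z x _ _ => hb z x)).
apply: DeriveDef => //.
rewrite -derive1E (@differentiation_under_integral _ _ _ mu f setT measurableT y (y - 1) (y + 1) yI
    (fun z _ => i1 z) (fun z x _ _ => @ex_derive _ _ _ _ _ _ _ (df z x)) _ hG
    (integrable_gauss_weight_norm r0) (fun z x _ _ => hb z x)).
transitivity (\int[mu]_x (-1 * (x * (sin (y * x + a) * gauss_weight r x)))).
  apply: eq_Rintegral => x _.
  by rewrite partial1of2E (@derive_val _ _ _ _ _ _ _ (df y x)) mulN1r.
rewrite RintegralZl//; last first.
  exact: (integrable_xtrig_gauss a y r0 measurable_sin normr_sin_le1).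
rewrite mulN1r; congr (- _).
have := gauss_cos_parts a y r0; rewrite -/(gauss_cos r a) => h.
by rewrite mulrAC -h mulrC mulrA mulVf ?mul1r// mulf_neq0// gt_eqF.
Qed.

Lemma gauss_cosE (r a y : R) : 0 < r ->
  gauss_cos r a y = cos a * Num.sqrt (pi / r) * expR (- (y ^+ 2 / (4 * r))).
Proof.
move=> r0.
(* The exponential is the integrating factor of the differential equation, so [K] is constant. *)
pose K z := gauss_cos r a z * expR (z ^+ 2 / (4 * r)).
have dK z : is_derive z (1 : R) K 0.
  have h1 := is_derive_gauss_cos a z r0.
  have h2 : is_derive z (1 : R) (fun z => z ^+ 2 / (4 * r)) (z / (2 * r)).
    apply: is_derive_eq; rewrite /GRing.scale/=.
    by field; rewrite gt_eqF.
  have h4 := @is_derive1_comp _ expR (fun z => z ^+ 2 / (4 * r)) z _ _ (is_derive_expR _) h2.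
  rewrite /comp in h4; rewrite /K.
  by apply: is_derive_eq; rewrite /GRing.scale/=; ring.
have K0 : K y = K 0 by exact: is_derive_0_is_cst.
have K0E : K 0 = cos a * Num.sqrt (pi / r).
  rewrite /K expr0n/= mul0r expR0 mulr1 /gauss_cos.
  under eq_Rintegral do rewrite mul0r add0r.
  rewrite RintegralZl//; last exact: integrable_gauss_weight.
  congr (_ * _); rewrite /Rintegral.
  under eq_integral do rewrite -[X in gauss_weight _ X]subr0.
  by rewrite integral_gauss_weight.
by rewrite -K0E -K0 /K -mulrA -expRD subrr expR0 mulr1.
Qed.

End gaussian.

(** * Lebesgue measure and Gaussian weights on R^n *)

Section vector_lebesgue.
Context {R : realType}.
Notation mu1 := (@lebesgue_measure R).

(* [lebesgue_rV] with a head constant that can carry canonical instances *)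
Definition vlebesgue n : set 'rV[R]_n -> \bar R := lebesgue_rV n.

HB.instance Definition _ n := isMeasure.Build _ _ _ (@vlebesgue n)
  (measure0 (lebesgue_rV n)) (measure_ge0 (lebesgue_rV n))
  (@measure_semi_sigma_additive _ _ _ (lebesgue_rV n)).

Lemma vlebesgue_sigma_finite n : sigma_finite setT (@vlebesgue n).
Proof.
pose B k : set 'rV[R]_n := [set v | forall i, `[- k%:R, k%:R]%classic (v ord0 i)].
exists B.
  apply/seteqP; split => // v _.
  have [k vk] : exists k : nat, forall i, `|v ord0 i| <= k%:R.
    exists (\sum_i (Num.truncn (`|v ord0 i| : R)%R).+1)%N => i.
    rewrite (le_trans (ltW (truncnS_gt _)))// ler_nat.
    by rewrite (bigD1 i)//= (leq_trans _ (leq_addr _ _)).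
  by exists k => // i; rewrite /= in_itv/= -ler_norml.
move=> k; split.
  rewrite (_ : B k = \bigcap_(i in [set: 'I_n])
      ((fun v : 'rV[R]_n => v ord0 i) @^-1` `[- k%:R, k%:R]%classic)); last first.
    by apply/seteqP; split => [v h i _|v h i]; exact: h.
  apply: fin_bigcap_measurable => // i _; rewrite -[X in measurable X]setTI.
  by apply: measurable_coord => //; exact: measurable_itv.
rewrite /vlebesgue /B (lebesgue_rV_box (B := fun=> `[- k%:R, k%:R]%classic)); last first.
  by move=> i; exact: measurable_itv.
rewrite (eq_bigr (fun=> (k%:R - - k%:R)%:E)); last first.
  move=> i _; rewrite lebesgue_measure_itv/= lte_fin.
  case: ifPn => // h; congr EFin.
  by move: h; rewrite -leNgt; have := ler0n R k; lra.
by rewrite -(big_morph EFin (@EFinM R) erefl) ltry.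
Qed.

HB.instance Definition _ n := Measure_isSigmaFinite.Build _ _ _ (@vlebesgue n)
  (vlebesgue_sigma_finite n).

Definition tail_rV n (y : 'rV[R]_n.+1) : 'rV[R]_n := \row_j y ord0 (lift ord0 j).

Lemma cons_rV0 n (va : 'rV[R]_n * measurableTypeR R) : cons_rV va ord0 ord0 = va.2.
Proof. by rewrite /cons_rV mxE; case: splitP => //= j _; rewrite mxE. Qed.

Lemma cons_rVS n (va : 'rV[R]_n * measurableTypeR R) i :
  cons_rV va ord0 (lift ord0 i) = va.1 ord0 i.
Proof.
rewrite /cons_rV mxE; case: splitP => [[[]]//|j /= [ij]].
by congr (_ _ _); exact/val_inj.
Qed.

Lemma dotp_cons n (y : 'rV[R]_n.+1) v a :
  dotp y (cons_rV (v, a)) = y ord0 ord0 * a + dotp (tail_rV y) v.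
Proof.
rewrite /dotp big_ord_recl cons_rV0; congr (_ + _).
by apply: eq_bigr => i _; rewrite cons_rVS mxE.
Qed.

Lemma tail_rV_cons n (v : 'rV[R]_n) (a : R) : tail_rV (cons_rV (v, a)) = v.
Proof. by apply/rowP => i; rewrite mxE cons_rVS. Qed.

Lemma tail_rVB n (x y : 'rV[R]_n.+1) : tail_rV (x - y) = tail_rV x - tail_rV y.
Proof. by apply/rowP => i; rewrite !mxE. Qed.

Lemma dotp_tail n (x y : 'rV[R]_n.+1) :
  dotp x y = x ord0 ord0 * y ord0 ord0 + dotp (tail_rV x) (tail_rV y).
Proof.
by rewrite /dotp big_ord_recl; congr (_ + _); apply: eq_bigr => i _; rewrite !mxE.
Qed.

Lemma ge0_integral_vlebesgueS n (f : 'rV[R]_n.+1 -> \bar R) :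
  measurable_fun setT f -> (forall x, 0 <= f x)%E ->
  (\int[@vlebesgue n.+1]_x f x =
   \int[@vlebesgue n]_v \int[mu1]_a f (cons_rV (v, a)))%E.
Proof.
move=> mf f0.
transitivity (\int[(@vlebesgue n \x mu1)%E]_z (f \o @cons_rV R n) z)%E.
  exact: ge0_integral_pushforward.
rewrite (fubini_tonelli1 (f \o @cons_rV R n))//; last by move=> x; exact: f0.
exact: measurableT_comp mf (@measurable_cons_rV R n).
Qed.

Lemma integral_vlebesgueS n (f : 'rV[R]_n.+1 -> \bar R) :
  (@vlebesgue n.+1).-integrable setT f ->
  (\int[@vlebesgue n.+1]_x f x =
   \int[@vlebesgue n]_v \int[mu1]_a f (cons_rV (v, a)))%E.
Proof.
move=> /[dup] fi /integrableP[mf fy].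
have fi2 : (@vlebesgue n \x mu1)%E.-integrable setT (f \o @cons_rV R n).
  apply/integrableP; split; first exact: measurableT_comp.
  move: fy; rewrite ge0_integral_vlebesgueS//; last exact: measurableT_comp.
  rewrite fubini_tonelli1//; do 2 apply: measurableT_comp => //.
transitivity (\int[(@vlebesgue n \x mu1)%E]_z (f \o @cons_rV R n) z)%E.
  exact: integral_pushforward.
by rewrite -integral12_prod_meas1.
Qed.

Definition vgauss n (r : R) (x : 'rV[R]_n) : R := expR (- (r * dotp x x)).

Lemma vgauss_ge0 n r (x : 'rV[R]_n) : 0 <= vgauss r x.
Proof. exact: expR_ge0. Qed.

Lemma vgaussS n r (x : 'rV[R]_n.+1) :
  vgauss r x = gauss_weight r (x ord0 ord0) * vgauss r (tail_rV x).
Proof.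
by rewrite /vgauss dotp_tail /gauss_weight -expRD; congr expR; rewrite expr2; ring.
Qed.

Lemma measurable_dotp n d (T : measurableType d) (f g : T -> 'rV[R]_n) :
  measurable_fun setT f -> measurable_fun setT g ->
  measurable_fun setT (fun t => dotp (f t) (g t)).
Proof.
move=> mf mg; apply: measurable_sum => i; apply: measurable_funM.
  exact: measurableT_comp (measurable_coord i) mf.
exact: measurableT_comp (measurable_coord i) mg.
Qed.

Lemma measurable_vgauss n r : measurable_fun setT (@vgauss n r).
Proof.
apply: measurableT_comp => //; apply: measurableT_comp => //.
by apply: measurable_funM => //; exact: measurable_dotp.
Qed.

Lemma measurable_vB n d (T : measurableType d) (f g : T -> 'rV[R]_n) :
  measurable_fun setT f -> measurable_fun setT g ->
  measurable_fun setT (fun t => f t - g t).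
Proof.
move=> mf mg; apply: measurable_rV => i; under eq_fun do rewrite mxE [X in _ + X]mxE.
apply: measurable_funB.
  exact: measurableT_comp (measurable_coord i) mf.
exact: measurableT_comp (measurable_coord i) mg.
Qed.

Lemma integral_vgauss n (r : R) (m : 'rV[R]_n) : 0 < r ->
  (\int[@vlebesgue n]_x (vgauss r (x - m))%:E = (Num.sqrt (pi / r) ^+ n)%:E)%E.
Proof.
move=> r0; elim: n m => [|n IH] m.
  rewrite /vlebesgue/= integral_dirac//; last first.
    apply/measurable_EFinP; apply: measurableT_comp; first exact: measurable_vgauss.
    exact: measurable_vB.
  by rewrite diracT mul1e /vgauss /dotp big_ord0 mulr0 oppr0 expR0 expr0.
rewrite ge0_integral_vlebesgueS//; last 2 first.
- apply/measurable_EFinP; apply: measurableT_comp; first exact: measurable_vgauss.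
  exact: measurable_vB.
- by move=> x; rewrite lee_fin vgauss_ge0.
under eq_integral => v _.
  under eq_integral => a _.
    rewrite vgaussS tail_rVB tail_rV_cons mxE [X in _ + X]mxE cons_rV0/= mulrC EFinM.
    over.
  rewrite ge0_integralZl//; last 3 first.
  - apply/measurable_EFinP; apply: measurableT_comp; first exact: measurable_gauss_weight.
    exact: measurable_funB.
  - by move=> a _; rewrite lee_fin gauss_weight_ge0.
  - by rewrite lee_fin vgauss_ge0.
  rewrite integral_gauss_weight//.
  over.
rewrite /= ge0_integralZr//; last 2 first.
- apply/measurable_EFinP; apply: measurableT_comp; first exact: measurable_vgauss.
  exact: measurable_vB.
- by move=> v _; rewrite lee_fin vgauss_ge0.
by rewrite IH -EFinM exprSr.
Qed.

Lemma integrable_vgauss n (r : R) : 0 < r ->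
  (@vlebesgue n).-integrable setT (EFin \o vgauss r).
Proof.
move=> r0; apply/integrableP; split.
  by apply/measurable_EFinP; exact: measurable_vgauss.
under eq_integral do rewrite /= ger0_norm ?vgauss_ge0// -[X in vgauss _ X]subr0.
by rewrite integral_vgauss// ltry.
Qed.

Lemma Rintegral_cos_vgauss n (r a : R) (y : 'rV[R]_n) : 0 < r ->
  \int[@vlebesgue n]_x (cos (dotp y x + a) * vgauss r x) =
  cos a * Num.sqrt (pi / r) ^+ n * expR (- (dotp y y / (4 * r))).
Proof.
move=> r0; rewrite /Rintegral.
have mc m (z : 'rV[R]_m) b : measurable_fun setT (fun x => cos (dotp z x + b) * vgauss r x).
  apply: measurable_funM; last exact: measurable_vgauss.
  apply: measurableT_comp; first exact: measurable_cos.
  by apply: measurable_funD => //; exact: measurable_dotp.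
have ic m (z : 'rV[R]_m) b :
    (@vlebesgue m).-integrable setT (fun x => (cos (dotp z x + b) * vgauss r x)%:E).
  apply: le_integrable (integrable_vgauss m r0) => //; first exact/measurable_EFinP.
  move=> x _ /=; rewrite lee_fin normrM (ger0_norm (vgauss_ge0 _ _)).
  by rewrite ler_piMl ?vgauss_ge0// normr_cos_le1.
(* The induction is on extended real integrals, to which the iterated form applies. The phase stays
   general, since one step replaces [a] by [dotp (tail_rV y) v + a]. *)
suff -> : (\int[@vlebesgue n]_x (cos (dotp y x + a) * vgauss r x)%:E =
  (cos a * Num.sqrt (pi / r) ^+ n * expR (- (dotp y y / (4 * r))))%:E)%E by [].
elim: n y a => [|n IH] y a.
  rewrite /vlebesgue/= integral_dirac//; last by apply/measurable_EFinP; exact: mc.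
  by rewrite diracT mul1e /vgauss /dotp !big_ord0 !(mulr0,mul0r,oppr0,expR0,mulr1,expr0,add0r).
have inner v : (\int[mu1]_b (cos (dotp y (cons_rV (v, b)) + a) * vgauss r (cons_rV (v, b)))%:E =
    (Num.sqrt (pi / r) * expR (- (y ord0 ord0 ^+ 2 / (4 * r))))%:E *
    (cos (dotp (tail_rV y) v + a) * vgauss r v)%:E)%E.
  have ig := integrable_trig_gauss (dotp (tail_rV y) v + a) (y ord0 ord0) r0
    measurable_cos normr_cos_le1.
  transitivity (\int[mu1]_b ((vgauss r v)%:E *
      (cos (y ord0 ord0 * b + (dotp (tail_rV y) v + a)) * gauss_weight r b)%:E))%E.
    apply: eq_integral => b _.
    by rewrite dotp_cons vgaussS tail_rV_cons cons_rV0 addrA -EFinM /=; congr EFin; ring.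
  rewrite integralZl// (_ : integral _ _ _ =
      (gauss_cos r (dotp (tail_rV y) v + a) (y ord0 ord0))%:E); last first.
    by rewrite /gauss_cos /Rintegral fineK//; exact: integrable_fin_num.
  by rewrite gauss_cosE// -!EFinM; congr EFin; ring.
rewrite integral_vlebesgueS//; under eq_integral do rewrite inner.
transitivity ((Num.sqrt (pi / r) * expR (- (y ord0 ord0 ^+ 2 / (4 * r))))%:E *
    \int[@vlebesgue n]_v (cos (dotp (tail_rV y) v + a) * vgauss r v)%:E)%E.
  exact: integralZl (ic _ _ _) _.
rewrite IH -EFinM; congr EFin.
have -> : dotp y y / (4 * r) = y ord0 ord0 ^+ 2 / (4 * r)
    + dotp (tail_rV y) (tail_rV y) / (4 * r) by rewrite dotp_tail; ring.
by rewrite (exprS _ n) opprD expRD; ring.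
Qed.

End vector_lebesgue.

(** * The complex exponential *)

Section elementary_inequalities.
Context {R : realType}.

Lemma MVT_origin (f df : R -> R) (x : R) :
  (forall x, is_derive x (1 : R) f (df x)) ->
  exists2 c, `|c| <= `|x| & f x - f 0 = df c * x.
Proof.
move=> dff.
have cf : continuous f.
  by move=> y; apply: differentiable_continuous; apply/derivable1_diffP; exact: ex_derive.
have [x0|x0] := leP 0 x.
  have [c] := MVT_segment x0 (fun y _ => dff y) (continuous_subspaceT cf).
  rewrite in_itv/= => /andP[c0 cx] ->; exists c; last by rewrite subr0.
  by rewrite !ger0_norm.
have [c] := MVT_segment (ltW x0) (fun y _ => dff y) (continuous_subspaceT cf).
rewrite in_itv/= => /andP[c0 cx] h; exists c.
  by rewrite !ler0_norm// ?lerN2// ltW.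
by rewrite -[LHS]opprB h sub0r mulrN opprK.
Qed.

Lemma normr_sin_le (x : R) : `|sin x| <= `|x|.
Proof.
have [c _] := @MVT_origin sin cos x (fun y => is_derive_sin y).
rewrite sin0 subr0 => ->; rewrite normrM ler_piMl//.
exact: normr_cos_le1.
Qed.

Lemma cos_double (x : R) : cos (x *+ 2) = 1 - sin x ^+ 2 *+ 2.
Proof.
have -> : cos (x *+ 2) = cos x ^+ 2 *+ 2 - 1 by exact: cos_mulr2n.
have -> : cos x ^+ 2 = 1 - sin x ^+ 2.
  by apply: (addIr (sin x ^+ 2)); rewrite subrK cos2Dsin2.
by ring.
Qed.

Lemma cos_ge1Bx2 (x : R) : 1 - cos x <= x ^+ 2 / 2.
Proof.
have -> : cos x = 1 - sin (x / 2) ^+ 2 *+ 2.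
  by rewrite -cos_double mulr2n -splitr.
have h := normr_sin_le (x / 2).
have : sin (x / 2) ^+ 2 <= (x / 2) ^+ 2.
  by rewrite -[leLHS]real_normK ?num_real// -[leRHS]real_normK ?num_real// ler_sqr ?nnegrE.
by rewrite !expr2; lra.
Qed.

(** By the mean value theorem the left side is [|cos c - 1| |x|] with [|c| <= |x|]; and [1 - cos c],
    being at most [c^2 / 2] and at most 2, is at most [|c|]. *)
Lemma normr_sinB_le (x : R) : `|sin x - x| <= x ^+ 2.
Proof.
have dd (y : R) : is_derive y (1 : R) (fun z => sin z - z) (cos y - 1).
  by apply: is_derive_eq.
have [c cx] := MVT_origin x dd.
rewrite sin0 !subr0 => ->; rewrite normrM -real_normK ?num_real// expr2 ler_wpM2r//.
apply: le_trans cx.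
rewrite distrC ger0_norm ?subr_ge0 ?cos_le1//.
have h1 := cos_ge1Bx2 c; have h2 := cos_geN1 c.
rewrite -real_normK ?num_real// in h1.
have := normr_ge0 c; set u := `|c| in h1 *.
have [u2|u2] := leP u 2; last by lra.
by move=> u0; nra.
Qed.

(** From [exp x (1 - x) <= 1] and [(1 + x + x^2) (1 - x) = 1 - x^3 >= 1]. *)
Lemma expR_le1DxDx2 (x : R) : x <= 0 -> expR x <= 1 + x + x ^+ 2.
Proof.
move=> x0.
have h := @expR_ge1Dx R (- x).
have h1 : expR x * expR (- x) = 1 by rewrite -expRD subrr expR0.
have h2 := expR_gt0 x.
have h3 : expR x * (1 - x) <= 1 by rewrite -[leRHS]h1 ler_pM2l.
have : 0 <= - x * x ^+ 2 by rewrite mulr_ge0 ?oppr_ge0// sqr_ge0.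
rewrite !expr2 => h4; have : expR x * (1 - x) <= (1 + x + x * x) * (1 - x) by nra.
by rewrite ler_pM2r//; lra.
Qed.

End elementary_inequalities.

Section complex_exponential.
Context {R : realType}.
Local Open Scope complex_scope.
Implicit Types z w : R[i].
Local Notation Re := complex.Re.
Local Notation Im := complex.Im.

(** The modulus as an element of [R]; the norm on [R[i]] takes its values in [R[i]]. *)
Definition cnorm z : R := Num.sqrt (Re z ^+ 2 + Im z ^+ 2).

Lemma cnormE z : (cnorm z)%:C = `|z|. Proof. by rewrite normc_def. Qed.

Lemma cnorm_ge0 z : 0 <= cnorm z. Proof. exact: sqrtr_ge0. Qed.

Lemma cnorm2 z : cnorm z ^+ 2 = Re z ^+ 2 + Im z ^+ 2.
Proof. by rewrite sqr_sqrtr// addr_ge0// sqr_ge0. Qed.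

Lemma cnormM z w : cnorm (z * w) = cnorm z * cnorm w.
Proof. by apply: complexI; rewrite rmorphM/= !cnormE normrM. Qed.

Lemma cnorm_ge_Re z : `|Re z| <= cnorm z.
Proof.
by rewrite -sqrtr_sqr /cnorm ler_wsqrtr// lerDl sqr_ge0.
Qed.

Lemma cnorm_ge_Im z : `|Im z| <= cnorm z.
Proof.
by rewrite -sqrtr_sqr /cnorm ler_wsqrtr// lerDr sqr_ge0.
Qed.

Lemma cnorm_le z : cnorm z <= `|Re z| + `|Im z|.
Proof.
rewrite -[leRHS]ger0_norm ?addr_ge0// -sqrtr_sqr /cnorm ler_wsqrtr//.
by rewrite sqrrD !real_normK ?num_real// -addrA lerD2l lerDr mulrn_wge0.
Qed.

Lemma cnormD z w : cnorm (z + w) <= cnorm z + cnorm w.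
Proof. by rewrite -lecR rmorphD/= !cnormE ler_normD. Qed.

Lemma cnorm_real (a : R) : cnorm a%:C = `|a|.
Proof. by rewrite /cnorm/= expr0n/= addr0 sqrtr_sqr. Qed.

(** Telescoping: each of the [n] summands is [z - w] times powers that lie in the unit disc. *)
Lemma cnorm_exp_sub z w n : cnorm z <= 1 -> cnorm w <= 1 ->
  cnorm (z ^+ n - w ^+ n) <= n%:R * cnorm (z - w).
Proof.
rewrite -!lecR rmorphM/= !cnormE rmorph_nat => z1 w1.
elim: n => [|n IH]; first by rewrite !expr0 subrr normr0 mul0r.
have -> : z ^+ n.+1 - w ^+ n.+1 = z * (z ^+ n - w ^+ n) + (z - w) * w ^+ n.
  by rewrite !exprS; ring.
rewrite (le_trans (ler_normD _ _))// !normrM -[n.+1]addn1 natrD mulrDl mul1r lerD//.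
  by rewrite (le_trans _ IH)// ler_piMl.
by rewrite ler_piMr// normrX exprn_ile1.
Qed.

Lemma Re_cexp z : Re (cexp z) = expR (Re z) * cos (Im z).
Proof. by rewrite /cexp; simpc. Qed.

Lemma Im_cexp z : Im (cexp z) = expR (Re z) * sin (Im z).
Proof. by rewrite /cexp; simpc. Qed.

Lemma complexP z w : Re z = Re w -> Im z = Im w -> z = w.
Proof. by case: z => a b; case: w => c d /= -> ->. Qed.

Lemma ReD z w : Re (z + w) = Re z + Re w. Proof. by case: z; case: w. Qed.
Lemma ImD z w : Im (z + w) = Im z + Im w. Proof. by case: z; case: w. Qed.
Lemma ReN z : Re (- z) = - Re z. Proof. by case: z. Qed.
Lemma ImN z : Im (- z) = - Im z. Proof. by case: z. Qed.
Lemma ReM z w : Re (z * w) = Re z * Re w - Im z * Im w. Proof. by case: z; case: w. Qed.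
Lemma ImM z w : Im (z * w) = Re z * Im w + Im z * Re w. Proof. by case: z; case: w. Qed.
Lemma ReZ (a : R) z : Re (a%:C * z) = a * Re z. Proof. by rewrite ReM /= mul0r subr0. Qed.
Lemma ImZ (a : R) z : Im (a%:C * z) = a * Im z. Proof. by rewrite ImM /= mul0r addr0. Qed.
Lemma Re_iZ (a : R) : Re ('i%C * a%:C) = 0.
Proof. by rewrite ReM /= mul0r mulr0 subr0. Qed.
Lemma Im_iZ (a : R) : Im ('i%C * a%:C) = a.
Proof. by rewrite ImM /= mul0r mul1r add0r. Qed.
Definition ReImE := (ReD, ImD, ReN, ImN, ReM, ImM).

Lemma cexpD z w : cexp (z + w) = cexp z * cexp w.
Proof.
by apply: complexP; rewrite ?(Re_cexp, Im_cexp, ReImE) expRD ?cosD ?sinD; ring.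
Qed.

Lemma cexp0 : cexp (0 : R[i]) = 1.
Proof. by apply: complexP; rewrite ?(Re_cexp, Im_cexp)/= expR0 ?cos0 ?sin0 mul1r. Qed.

Lemma cexpMn z n : cexp (z *+ n) = cexp z ^+ n.
Proof. by elim: n => [|n IH]; rewrite ?cexp0// mulrS exprS cexpD IH. Qed.

Lemma cnorm_cexp z : cnorm (cexp z) = expR (Re z).
Proof.
rewrite /cnorm Re_cexp Im_cexp !exprMn -mulrDr cos2Dsin2 mulr1 sqrtr_sqr.
by rewrite ger0_norm ?expR_ge0.
Qed.

(** On the half-plane [Re z <= 0] the exponential is bounded by 1, so the second-order remainder is
    quadratic with a global constant: the real part costs [|z|^2], the imaginary part [2 |z|^2]. *)
Lemma cnorm_cexpB1 z : Re z <= 0 -> cnorm (cexp z - 1 - z) <= 3 * cnorm z ^+ 2.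
Proof.
move=> z0; rewrite (le_trans (cnorm_le _))// cnorm2.
rewrite !ReD !ImD !ReN !ImN Re_cexp Im_cexp /=; move: (Re z) (Im z) z0 => a b a0 {z}.
have e1 : expR a <= 1 by rewrite -[leRHS]expR0 ler_expR.
have e0 := expR_gt0 a; have e2 := expR_le1DxDx2 a0; have e3 := @expR_ge1Dx R a.
have c1 := cos_ge1Bx2 b; have c2 := cos_le1 b; have s1 := normr_sinB_le b.
have ha : `|expR a * cos b - 1 - a| <= a ^+ 2 + b ^+ 2.
  have -> : expR a * cos b - 1 - a = (expR a - 1 - a) + expR a * (cos b - 1) by ring.
  rewrite (le_trans (ler_normD _ _))// lerD//.
    by rewrite ger0_norm; lra.
  rewrite normrM (ger0_norm (ltW e0)) distrC ger0_norm ?subr_ge0//.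
  rewrite (@le_trans _ _ (1 - cos b))// ?ler_piMl ?subr_ge0//.
  by have := sqr_ge0 b; lra.
have hb : `|expR a * sin b - 0 - b| <= 2 * (a ^+ 2 + b ^+ 2).
  have -> : expR a * sin b - 0 - b = expR a * (sin b - b) + (expR a - 1) * b by ring.
  rewrite (le_trans (ler_normD _ _))// !normrM (ger0_norm (ltW e0)).
  have h1 : expR a * `|sin b - b| <= b ^+ 2.
    by rewrite (le_trans _ s1)// ler_piMl.
  have h2 : `|expR a - 1| <= `|a|.
    by rewrite distrC ger0_norm ?subr_ge0// ler0_norm//; lra.
  have h3 : `|expR a - 1| * `|b| <= a ^+ 2 + b ^+ 2.
    rewrite (@le_trans _ _ (`|a| * `|b|))// ?ler_wpM2r//.
    rewrite -(real_normK (num_real a)) -(real_normK (num_real b)).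
    have := normr_ge0 a; have := normr_ge0 b; have := sqr_ge0 (`|a| - `|b|).
    by rewrite !expr2; nra.
  by have := sqr_ge0 a; lra.
by lra.
Qed.

(** Both [1 + z / n] and [exp (z / n)] lie in the unit disc, so their [n]-th powers differ by at
    most [n] times the one-step error [3 |z / n|^2]. *)
Lemma cexp_euler z n : (0 < n)%N -> Re z <= 0 ->
  cnorm (1 + (n%:R^-1)%:C * z) <= 1 ->
  cnorm ((1 + (n%:R^-1)%:C * z) ^+ n - cexp z) <= 3 * cnorm z ^+ 2 / n%:R.
Proof.
move=> n0 z0 h1; set u := (n%:R^-1)%:C * z in h1 *.
have n0' : 0 < n%:R :> R by rewrite ltr0n.
have uE : z = u *+ n.
  rewrite /u -mulr_natl mulrA -(rmorph_nat (real_complex R)) -rmorphM/= divff ?mul1r//.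
  by rewrite gt_eqF.
have u0 : Re u <= 0.
  by rewrite /u ReM /= mul0r subr0 mulr_ge0_le0// invr_ge0 ltW.
have cu : cnorm u = n%:R^-1 * cnorm z.
  rewrite /u cnormM; congr (_ * _); rewrite /cnorm/= expr0n/= addr0 sqrtr_sqr.
  by rewrite ger0_norm// invr_ge0 ltW.
rewrite {1}uE cexpMn (le_trans (cnorm_exp_sub _ h1 _))//.
  by rewrite cnorm_cexp -[leRHS]expR0 ler_expR.
have -> : 1 + u - cexp u = - (cexp u - 1 - u) by ring.
have -> : cnorm (- (cexp u - 1 - u)) = cnorm (cexp u - 1 - u).
  by rewrite /cnorm !ReN !ImN !sqrrN.
rewrite (le_trans (ler_wpM2l (ltW n0') (cnorm_cexpB1 u0)))//.
rewrite cu exprMn le_eqVlt; apply/orP; left; apply/eqP; field.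
by rewrite gt_eqF.
Qed.

End complex_exponential.

Arguments cexp : simpl never.
Arguments cintegral : simpl never.

(** * Symbols and Fourier inversion *)

Section real_fubini.
Context d1 d2 (T1 : measurableType d1) (T2 : measurableType d2) (R : realType).
Variables (m1 : {finite_measure set T1 -> \bar R})
  (m2 : {sigma_finite_measure set T2 -> \bar R}) (f : T1 * T2 -> R) (g : T2 -> R).
Hypotheses (mf : measurable_fun setT f) (ig : m2.-integrable setT (EFin \o g))
  (fg : forall x y, `|f (x, y)| <= g y).

Let integrable_prod : (m1 \x m2)%E.-integrable setT (EFin \o f).
Proof.
apply/integrable12ltyP; first exact/measurable_EFinP.
have g0 y : 0 <= g y by rewrite (le_trans _ (fg point y)).
have mg : measurable_fun setT (EFin \o g) by exact: measurable_int ig.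
apply: (@le_lt_trans _ _ (\int[m1]_x (\int[m2]_y (g y)%:E))%E).
  apply: ge0_le_integral => //.
  - by move=> x _; exact: integral_ge0.
  - apply: (@measurable_fun_fubini_tonelli_F _ _ _ _ _ _ (fun z => `|(f z)%:E|)%E) => //.
    by apply: measurableT_comp => //; exact/measurable_EFinP.
  - move=> x _; apply: ge0_le_integral => //.
    + apply: measurableT_comp => //; apply/measurable_EFinP.
      exact: measurableT_comp mf _.
    + by move=> y _; rewrite lee_fin.
have gfin : (\int[m2]_y (g y)%:E \is a fin_num)%E by exact: integrable_fin_num.
rewrite -(fineK gfin) integral_cst// lte_mul_pinfty//.
- by rewrite lee_fin fine_ge0// integral_ge0// => y _; rewrite lee_fin.
- by rewrite ltey_eq fin_num_measure.
Qed.

Let integrable1 x : m2.-integrable setT (fun y => (f (x, y))%:E).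
Proof.
apply: le_integrable ig => //.
  by apply/measurable_EFinP; exact: measurableT_comp mf _.
by move=> y _ /=; rewrite lee_fin (le_trans (fg x y))// ler_norm.
Qed.

Let integrable2 y : m1.-integrable setT (fun x => (f (x, y))%:E).
Proof.
apply: le_integrable (finite_measure_integrable_cst m1 (g y) measurableT) => //.
  by apply/measurable_EFinP; exact: measurableT_comp mf _.
by move=> x _ /=; rewrite lee_fin (le_trans (fg x y))// ler_norm.
Qed.

Let inner1 x : (\int[m2]_y (f (x, y))%:E)%E = (\int[m2]_y f (x, y))%:E.
Proof. by rewrite /Rintegral fineK//; exact: integrable_fin_num. Qed.

Let inner2 y : (\int[m1]_x (f (x, y))%:E)%E = (\int[m1]_x f (x, y))%:E.
Proof. by rewrite /Rintegral fineK//; exact: integrable_fin_num. Qed.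

Lemma integrable_Rintegral_dominated :
  m1.-integrable setT (fun x => (\int[m2]_y f (x, y))%:E).
Proof.
by under eq_fun do rewrite -inner1; exact: (integrable_fubini_F integrable_prod).
Qed.

Lemma measurable_Rintegral_dominated :
  measurable_fun setT (fun y => \int[m1]_x f (x, y)).
Proof.
apply/measurable_EFinP; rewrite /comp; under eq_fun do rewrite -inner2.
exact: (measurable_fubini_G integrable_prod).
Qed.

Lemma Rintegral_fubini_dominated :
  \int[m1]_x \int[m2]_y f (x, y) = \int[m2]_y \int[m1]_x f (x, y).
Proof.
have := Fubini integrable_prod; rewrite /comp.
under eq_integral do rewrite inner1.
under [in X in _ = X -> _]eq_integral do rewrite inner2.
by rewrite /Rintegral => ->.
Qed.

End real_fubini.

Section fourier_symbols.
Context {R : realType} {d : nat}.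
Local Open Scope complex_scope.
Local Notation Re := complex.Re.
Local Notation Im := complex.Im.
Local Notation V := 'rV[R]_d.
Implicit Types (F G : V -> R[i]) (x xi : V).

Definition bounded_symbol (c : R) F := [/\ measurable_fun setT (fun xi => Re (F xi)),
  measurable_fun setT (fun xi => Im (F xi)) & forall xi, cnorm (F xi) <= c].

(** The real part of [exp (- i <x, xi>) F xi]. *)
Definition fkernel F x xi : R :=
  cos (dotp x xi) * Re (F xi) + sin (dotp x xi) * Im (F xi).

(* the density at [x] of the measure with characteristic function
   [F xi * exp (- r |xi|^2)], given by Fourier inversion; the factor
   [(2 pi)^-d] is replaced by [(r / pi)^(d / 2)], so that the value at [0] is
   [1] when [F = 1] *)
Definition fourier_gauss (r : R) F x : R :=
  Num.sqrt (r / pi) ^+ d * \int[@vlebesgue R d]_xi (fkernel F x xi * vgauss r xi).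

Lemma bounded_symbolM c1 c2 F G : bounded_symbol c1 F -> bounded_symbol c2 G ->
  bounded_symbol (c1 * c2) (fun xi => F xi * G xi).
Proof.
move=> [rF iF cF] [rG iG cG]; split.
- by under eq_fun do rewrite ReM; apply: measurable_funB; apply: measurable_funM.
- by under eq_fun do rewrite ImM; apply: measurable_funD; apply: measurable_funM.
- by move=> xi; rewrite cnormM ler_pM// cnorm_ge0.
Qed.

Lemma bounded_symbol1 : bounded_symbol 1 (fun=> 1).
Proof.
split; [exact: measurable_cst|exact: measurable_cst|].
by move=> xi; rewrite /cnorm/= expr1n expr0n/= addr0 sqrtr1.
Qed.

Lemma bounded_symbolX F n : bounded_symbol 1 F -> bounded_symbol 1 (fun xi => F xi ^+ n).
Proof.
move=> F1; elim: n => [|n IH]; first exact: bounded_symbol1.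
rewrite -[X in bounded_symbol X](mulr1 1).
by under eq_fun do rewrite exprS; exact: bounded_symbolM.
Qed.

Lemma normr_fkernel_le F x xi : `|fkernel F x xi| <= cnorm (F xi).
Proof.
rewrite -sqrtr_sqr /cnorm ler_wsqrtr// /fkernel.
set c := cos _; set s := sin _; set u := Re _; set v := Im _.
have h : c ^+ 2 + s ^+ 2 = 1 by exact: cos2Dsin2.
rewrite -[leRHS]mul1r -h -subr_ge0.
rewrite (_ : _ - _ = (c * v - s * u) ^+ 2); last by ring.
exact: sqr_ge0.
Qed.

Lemma measurable_fkernel T (dT : measurableType T) c F (X Z : dT -> V) :
  bounded_symbol c F -> measurable_fun setT X -> measurable_fun setT Z ->
  measurable_fun setT (fun t => fkernel F (X t) (Z t)).
Proof.
move=> [rF iF _] mX mZ; apply: measurable_funD; apply: measurable_funM.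
- apply: measurableT_comp; first exact: measurable_cos.
  exact: measurable_dotp.
- exact: measurableT_comp rF mZ.
- apply: measurableT_comp; first exact: measurable_sin.
  exact: measurable_dotp.
- exact: measurableT_comp iF mZ.
Qed.

Lemma fkernel_gauss_le c F r x xi : bounded_symbol c F ->
  `|fkernel F x xi * vgauss r xi| <= c * vgauss r xi.
Proof.
move=> [_ _ cF]; rewrite normrM (ger0_norm (vgauss_ge0 _ _)) ler_wpM2r ?vgauss_ge0//.
exact: le_trans (normr_fkernel_le _ _ _) (cF _).
Qed.

Lemma measurable_fkernel_gauss c F r x : bounded_symbol c F ->
  measurable_fun setT (fun xi => fkernel F x xi * vgauss r xi).
Proof.
move=> bF; apply: measurable_funM; last exact: measurable_vgauss.
exact: measurable_fkernel bF _ _.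
Qed.

Lemma integrable_fkernel_gauss c F r x : 0 < r -> bounded_symbol c F ->
  (@vlebesgue R d).-integrable setT (fun xi => (fkernel F x xi * vgauss r xi)%:E).
Proof.
move=> r0 bF.
apply: le_integrable (integrableZl_EFin c (@integrable_vgauss R d r r0)) => //.
  by apply/measurable_EFinP; exact: measurable_fkernel_gauss bF.
move=> xi _ /=; rewrite lee_fin (le_trans (fkernel_gauss_le _ _ _ bF))//.
exact: ler_norm.
Qed.

(** A Gaussian of rate [r] in frequency has rate [1 / (4 r)] in space, which fixes the rate of all
    later minorants. *)
Lemma fourier_gauss_cst1 r x : 0 < r ->
  fourier_gauss r (fun=> 1) x = vgauss (4 * r)^-1 x.
Proof.
move=> r0; rewrite /fourier_gauss /fkernel.
rewrite (_ : \int[_]_xi _ =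
    \int[@vlebesgue R d]_xi (cos (dotp x xi + 0) * vgauss r xi)); last first.
  by apply: eq_Rintegral => xi _ /=; rewrite mulr1 mulr0 !addr0.
rewrite Rintegral_cos_vgauss// cos0 mul1r mulrA -exprMn -sqrtrM; last first.
  by rewrite divr_ge0// ?pi_ge0// ltW.
rewrite (_ : r / pi * (pi / r) = 1); last first.
  by rewrite mulrA divfK ?gt_eqF ?pi_gt0// divff// gt_eqF.
by rewrite sqrtr1 expr1n mul1r /vgauss mulrC.
Qed.

Lemma cvg_fourier_gauss r (F_ : nat -> V -> R[i]) F x : 0 < r ->
  (forall n, bounded_symbol 1 (F_ n)) ->
  (forall xi, Re (F_ n xi) @[n --> \oo] --> Re (F xi)) ->
  (forall xi, Im (F_ n xi) @[n --> \oo] --> Im (F xi)) ->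
  fourier_gauss r (F_ n) x @[n --> \oo] --> fourier_gauss r F x.
Proof.
move=> r0 bF rF iF; apply: cvgM; first exact: cvg_cst.
apply: (@cvg_Rintegral_dominated _ _ _ _ _ _ (vgauss r)).
- by move=> n; exact: measurable_fkernel_gauss (bF n).
- move=> xi; apply: cvgM; last exact: cvg_cst.
  by apply: cvgD; apply: cvgM; [exact: cvg_cst|exact: rF|exact: cvg_cst|exact: iF].
- exact: integrable_vgauss.
- by move=> n xi; rewrite -[leRHS]mul1r; exact: fkernel_gauss_le (bF n).
Qed.

Lemma bounded_symbol_cvg c (F_ : nat -> V -> R[i]) F :
  (forall n, bounded_symbol c (F_ n)) ->
  (forall xi, Re (F_ n xi) @[n --> \oo] --> Re (F xi)) ->
  (forall xi, Im (F_ n xi) @[n --> \oo] --> Im (F xi)) -> bounded_symbol c F.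
Proof.
move=> bF rF iF; split.
- have mF n : measurable_fun setT (fun xi => Re (F_ n xi)) by case: (bF n).
  exact: (@measurable_fun_cvg _ _ _ setT _ _ mF (fun xi _ => rF xi)).
- have mF n : measurable_fun setT (fun xi => Im (F_ n xi)) by case: (bF n).
  exact: (@measurable_fun_cvg _ _ _ setT _ _ mF (fun xi _ => iF xi)).
- move=> xi; have h : cnorm (F_ n xi) @[n --> \oo] --> cnorm (F xi).
    apply: (cvg_comp _ Num.sqrt); last exact: sqrt_continuous.
    by apply: cvgD; apply: cvgM.
  rewrite -(cvg_lim _ h)// limr_le//; first by apply/cvg_ex; eexists; exact: h.
  by apply: nearW => n; case: (bF n).
Qed.

End fourier_symbols.

(** * Averages of translates over a finite measure *)

Section averages.
Context {R : realType} {d : nat}.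
Local Open Scope complex_scope.
Local Notation Re := complex.Re.
Local Notation Im := complex.Im.
Local Notation V := 'rV[R]_d.
Context (dT : measure_display) (T : measurableType dT)
  (M : {finite_measure set T -> \bar R}) (Z : T -> V).
Hypothesis mZ : measurable_fun setT Z.
Implicit Types (F : V -> R[i]) (x xi : V).

(** [M] is an arbitrary finite measure, so that this covers the law of [Y t], restrictions of [N]
    and Dirac masses alike. *)
Definition char_fun xi : R[i] := cintegral M (fun w => cexp ('i%C * (dotp xi (Z w))%:C)).

Arguments char_fun : simpl never.

Lemma Re_cexp_i (y : R) : Re (cexp ('i%C * y%:C)) = cos y.
Proof. by rewrite (_ : _ * _ = 0 +i* y) ?Re_cexp/= ?expR0 ?mul1r//; simpc. Qed.

Lemma Im_cexp_i (y : R) : Im (cexp ('i%C * y%:C)) = sin y.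
Proof. by rewrite (_ : _ * _ = 0 +i* y) ?Im_cexp/= ?expR0 ?mul1r//; simpc. Qed.

Lemma Re_char_fun xi : Re (char_fun xi) = \int[M]_w cos (dotp xi (Z w)).
Proof. by apply: eq_Rintegral => w _; rewrite Re_cexp_i. Qed.

Lemma Im_char_fun xi : Im (char_fun xi) = \int[M]_w sin (dotp xi (Z w)).
Proof. by apply: eq_Rintegral => w _; rewrite Im_cexp_i. Qed.

Lemma integrable_bounded (f : T -> R) (c : R) : measurable_fun setT f ->
  (forall w, `|f w| <= c) -> M.-integrable setT (EFin \o f).
Proof.
move=> mf fc; apply: le_integrable (finite_measure_integrable_cst M c measurableT) => //.
  exact/measurable_EFinP.
by move=> w _ /=; rewrite lee_fin (le_trans (fc w))// ler_norm.
Qed.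

Lemma measurable_cos_dotp xi : measurable_fun setT (fun w => cos (dotp xi (Z w))).
Proof.
apply: measurableT_comp; first exact: measurable_cos.
exact: measurable_dotp.
Qed.

Lemma measurable_sin_dotp xi : measurable_fun setT (fun w => sin (dotp xi (Z w))).
Proof.
apply: measurableT_comp; first exact: measurable_sin.
exact: measurable_dotp.
Qed.

Lemma integrable_cos_dotp xi : M.-integrable setT (fun w => (cos (dotp xi (Z w)))%:E).
Proof. by apply: (integrable_bounded (measurable_cos_dotp xi)) => w; exact: normr_cos_le1. Qed.

Lemma integrable_sin_dotp xi : M.-integrable setT (fun w => (sin (dotp xi (Z w)))%:E).
Proof. by apply: (integrable_bounded (measurable_sin_dotp xi)) => w; exact: normr_sin_le1. Qed.

Lemma Rintegral_cst_setT (c : R) : \int[M]_w c = c * fine (M setT).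
Proof. exact: Rintegral_cst. Qed.

Lemma Rintegral_linear_cos_sin xi (a b : R) :
  \int[M]_w (a * cos (dotp xi (Z w)) + b * sin (dotp xi (Z w))) =
  a * Re (char_fun xi) + b * Im (char_fun xi).
Proof.
rewrite Re_char_fun Im_char_fun -!RintegralZl//; last 2 first.
- exact: integrable_sin_dotp.
- exact: integrable_cos_dotp.
rewrite -RintegralD//; apply: integrableZl_EFin.
- exact: integrable_cos_dotp.
- exact: integrable_sin_dotp.
Qed.

(** The integral is defined componentwise, so the modulus cannot be taken inside directly. With
    [a + i b] the value of the integral, [a^2 + b^2] is the integral of [a cos + b sin], which is
    pointwise at most [cnorm (char_fun xi)]; then one factor cancels. *)
Lemma cnorm_char_fun xi : cnorm (char_fun xi) <= fine (M setT).
Proof.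
set a := Re (char_fun xi); set b := Im (char_fun xi).
have [c0|c0] := leP (cnorm (char_fun xi)) 0.
  by rewrite (le_trans c0)// fine_ge0.
rewrite -(ler_pM2l c0) -expr2 cnorm2 -/a -/b -Rintegral_cst_setT expr2 [b ^+ 2]expr2.
rewrite -Rintegral_linear_cos_sin; apply: le_Rintegral => //.
- by apply: integrableD_EFin; apply: integrableZl_EFin;
    [exact: integrable_cos_dotp|exact: integrable_sin_dotp].
- exact: finite_measure_integrable_cst.
- move=> w _; rewrite (le_trans (ler_norm _))// -sqrtr_sqr /cnorm -/a -/b.
  rewrite ler_wsqrtr//; set c := cos _; set s := sin _.
  rewrite -[leRHS]mulr1 -(cos2Dsin2 (dotp xi (Z w))) -/c -/s -subr_ge0.
  rewrite (_ : _ - _ = (a * s - b * c) ^+ 2); last by ring.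
  exact: sqr_ge0.
Qed.

Let phase (wxi : T * V) : R := dotp wxi.2 (Z wxi.1).

Let measurable_phase : measurable_fun setT phase.
Proof. by apply: measurable_dotp => //; exact: measurableT_comp mZ _. Qed.

(** Measurability in the parameter comes from Fubini's theorem, which wants an integrable kernel on
    the product with Lebesgue measure: a Gaussian in [xi] is multiplied in and divided out again. *)
Lemma measurable_Re_char_fun : measurable_fun setT (fun xi => Re (char_fun xi)).
Proof.
pose f (wxi : T * V) := cos (phase wxi) * vgauss 1 wxi.2.
have mf : measurable_fun setT f.
  apply: measurable_funM; first exact: measurableT_comp measurable_cos _.
  exact: measurableT_comp (@measurable_vgauss R d 1) _.
have fg w xi : `|f (w, xi)| <= vgauss 1 xi.
  by rewrite /f normrM (ger0_norm (vgauss_ge0 _ _)) ler_piMl ?vgauss_ge0 ?normr_cos_le1.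
have h := measurable_Rintegral_dominated M mf (@integrable_vgauss R d 1 ltr01) fg.
have mi : measurable_fun setT (fun xi : V => expR (1 * dotp xi xi)).
  by apply: measurableT_comp => //; apply: measurable_funM => //; exact: measurable_dotp.
rewrite (_ : (fun xi => Re (char_fun xi)) =
    (fun xi => expR (1 * dotp xi xi) * \int[M]_w f (w, xi))); first exact: measurable_funM mi h.
apply/funext => xi; apply/esym.
rewrite Re_char_fun; transitivity (expR (1 * dotp xi xi) *
  \int[M]_w (vgauss 1 xi * cos (dotp xi (Z w)))).
  by congr (_ * _); apply: eq_Rintegral => w _; rewrite /f mulrC.
rewrite RintegralZl//; last exact: integrable_cos_dotp.
by rewrite mulrA /vgauss -expRD subrr expR0 mul1r.
Qed.

Lemma measurable_Im_char_fun : measurable_fun setT (fun xi => Im (char_fun xi)).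
Proof.
pose f (wxi : T * V) := sin (phase wxi) * vgauss 1 wxi.2.
have mf : measurable_fun setT f.
  apply: measurable_funM; first exact: measurableT_comp measurable_sin _.
  exact: measurableT_comp (@measurable_vgauss R d 1) _.
have fg w xi : `|f (w, xi)| <= vgauss 1 xi.
  by rewrite /f normrM (ger0_norm (vgauss_ge0 _ _)) ler_piMl ?vgauss_ge0 ?normr_sin_le1.
have h := measurable_Rintegral_dominated M mf (@integrable_vgauss R d 1 ltr01) fg.
have mi : measurable_fun setT (fun xi : V => expR (1 * dotp xi xi)).
  by apply: measurableT_comp => //; apply: measurable_funM => //; exact: measurable_dotp.
rewrite (_ : (fun xi => Im (char_fun xi)) =
    (fun xi => expR (1 * dotp xi xi) * \int[M]_w f (w, xi))); first exact: measurable_funM mi h.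
apply/funext => xi; apply/esym.
rewrite Im_char_fun; transitivity (expR (1 * dotp xi xi) *
  \int[M]_w (vgauss 1 xi * sin (dotp xi (Z w)))).
  by congr (_ * _); apply: eq_Rintegral => w _; rewrite /f mulrC.
rewrite RintegralZl//; last exact: integrable_sin_dotp.
by rewrite mulrA /vgauss -expRD subrr expR0 mul1r.
Qed.

Lemma bounded_symbol_char_fun : bounded_symbol (fine (M setT)) char_fun.
Proof.
split; [exact: measurable_Re_char_fun|exact: measurable_Im_char_fun|].
exact: cnorm_char_fun.
Qed.

Section average.
Variables (c r : R) (F : V -> R[i]) (x : V).
Hypotheses (r0 : 0 < r) (bF : bounded_symbol c F).

Let f (wxi : T * V) := fkernel F (x - Z wxi.1) wxi.2 * vgauss r wxi.2.

Let mf : measurable_fun setT f.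
Proof.
apply: measurable_funM; last exact: measurableT_comp (@measurable_vgauss R d r) _.
apply: (measurable_fkernel bF) => //.
by apply: measurable_vB => //; exact: measurableT_comp mZ _.
Qed.

Let ig := integrableZl_EFin c (@integrable_vgauss R d r r0).

Let fg w xi : `|f (w, xi)| <= c * vgauss r xi.
Proof. exact: fkernel_gauss_le. Qed.

Lemma integrable_fourier_gauss :
  M.-integrable setT (fun w => (fourier_gauss r F (x - Z w))%:E).
Proof. exact: (integrableZl_EFin _ (integrable_Rintegral_dominated M mf ig fg)). Qed.

(** The convolution theorem. It lets multiplication by a characteristic function act as a positive
    operator on densities. *)
Lemma Rintegral_fourier_gauss :
  \int[M]_w fourier_gauss r F (x - Z w) =
  fourier_gauss r (fun xi => F xi * char_fun xi) x.
Proof.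
rewrite /fourier_gauss RintegralZl//; last exact: (integrable_Rintegral_dominated M mf ig fg).
congr (_ * _); rewrite (Rintegral_fubini_dominated M mf ig fg).
apply: eq_Rintegral => xi _; rewrite /f /fkernel /=.
set u := Re (F xi); set v := Im (F xi); set g := vgauss r xi.
transitivity (\int[M]_w (
    (cos (dotp x xi) * u + sin (dotp x xi) * v) * g * cos (dotp xi (Z w)) +
    (sin (dotp x xi) * u - cos (dotp x xi) * v) * g * sin (dotp xi (Z w)))).
  apply: eq_Rintegral => w _.
  have -> : dotp (x - Z w) xi = dotp x xi - dotp xi (Z w).
    rewrite /dotp -sumrB; apply: eq_bigr => i _; rewrite !mxE; ring.
  by rewrite cosB sinB; ring.
by rewrite Rintegral_linear_cos_sin ReM ImM -/u -/v; ring.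
Qed.

End average.

End averages.

(** * Propagation of the Gaussian lower bound *)

Section lower_bounds.
Context {R : realType} {d : nat}.
Local Open Scope complex_scope.
Local Notation Re := complex.Re.
Local Notation Im := complex.Im.
Local Notation V := 'rV[R]_d.
Implicit Types (F G : V -> R[i]) (x a xi : V).

Lemma dotpBl (x y z : V) : dotp (x - y) z = dotp x z - dotp y z.
Proof. by rewrite /dotp -sumrB; apply: eq_bigr => i _; rewrite !mxE; ring. Qed.

Lemma dotpC (x y : V) : dotp x y = dotp y x.
Proof. by apply: eq_bigr => i _; rewrite mulrC. Qed.

Lemma dotpBr (x y z : V) : dotp z (x - y) = dotp z x - dotp z y.
Proof. by rewrite dotpC dotpBl !(dotpC z). Qed.

Lemma dotpZl (c : R) (x y : V) : dotp (c *: x) y = c * dotp x y.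
Proof. by rewrite /dotp mulr_sumr; apply: eq_bigr => i _; rewrite !mxE mulrA. Qed.

Lemma dotpZr (c : R) (x y : V) : dotp x (c *: y) = c * dotp x y.
Proof. by rewrite dotpC dotpZl dotpC. Qed.

Lemma dotpBB (x y : V) : dotp (x - y) (x - y) = dotp x x - 2 * dotp x y + dotp y y.
Proof. by rewrite dotpBl !dotpBr (dotpC y x); ring. Qed.

Lemma dotp_ge0 (x : V) : 0 <= dotp x x.
Proof. by apply: sumr_ge0 => i _; rewrite -expr2 sqr_ge0. Qed.

Lemma sqr_coord_le_dotp (z : V) i : z ord0 i ^+ 2 <= dotp z z.
Proof.
rewrite /dotp (bigD1 i)//= -expr2 lerDl; apply: sumr_ge0 => j _.
by rewrite -expr2 sqr_ge0.
Qed.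

Lemma fourier_gauss_shift r F a x :
  fourier_gauss r (fun xi => F xi * cexp ('i%C * (dotp xi a)%:C)) x =
  fourier_gauss r F (x - a).
Proof.
rewrite /fourier_gauss; congr (_ * _); apply: eq_Rintegral => xi _; congr (_ * _).
rewrite /fkernel (ReM (F xi)) (ImM (F xi)) Re_cexp_i Im_cexp_i dotpBl cosB sinB (dotpC a).
by ring.
Qed.

Lemma bounded_symbol_shift F a : bounded_symbol 1 F ->
  bounded_symbol 1 (fun xi => F xi * cexp ('i%C * (dotp xi a)%:C)).
Proof.
move=> bF; rewrite -[X in bounded_symbol X](mulr1 1); apply: bounded_symbolM => //; split.
- under eq_fun do rewrite Re_cexp_i.
  by apply: measurableT_comp; [exact: measurable_cos|exact: measurable_dotp].
- under eq_fun do rewrite Im_cexp_i.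
  by apply: measurableT_comp; [exact: measurable_sin|exact: measurable_dotp].
- move=> xi; rewrite /cnorm Re_cexp_i Im_cexp_i cos2Dsin2 sqrtr1//.
Qed.

(** With [G] the characteristic function of [M] and [lam] its mass, the right side is [1 - s lam]
    times the old function plus [s] times its average over [M]: a positive operator once [s >= 0]
    and [s lam <= 1]. *)
Lemma fourier_gauss_step r c F G (lam s : R) x : 0 < r ->
  bounded_symbol 1 F -> bounded_symbol c G ->
  fourier_gauss r (fun xi => F xi * (1 + s%:C * (G xi - lam%:C))) x =
  (1 - s * lam) * fourier_gauss r F x
  + s * fourier_gauss r (fun xi => F xi * G xi) x.
Proof.
move=> r0 bF bG; have bFG := bounded_symbolM bF bG.
have iF := integrable_fkernel_gauss x r0 bF.
have iFG := integrable_fkernel_gauss x r0 bFG.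
rewrite /fourier_gauss mulrCA [X in _ + X]mulrCA -mulrDr; congr (_ * _).
rewrite -!RintegralZl// -RintegralD//; last 2 first.
- exact: integrableZl_EFin iF.
- exact: integrableZl_EFin iFG.
apply: eq_Rintegral => xi _.
by rewrite /fkernel !(ReM, ImM, ReD, ImD, ReN, ImN)/=; ring.
Qed.

(** The operations that follow change the centre [a] and the constant [C] but not the rate. The
    bound [|F| <= 1] is carried along to dominate limits. *)
Definition lower_bounded (r : R) F a (C : R) :=
  bounded_symbol 1 F /\
  forall x, C * vgauss (4 * r)^-1 (x - a) <= fourier_gauss r F x.

Lemma lower_bounded1 r : 0 < r -> lower_bounded r (fun=> 1) 0 1.
Proof.
move=> r0; split; first exact: bounded_symbol1.
by move=> x; rewrite fourier_gauss_cst1// mul1r subr0.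
Qed.

Lemma lower_bounded_shift r F a C b : lower_bounded r F a C ->
  lower_bounded r (fun xi => F xi * cexp ('i%C * (dotp xi b)%:C)) (a + b) C.
Proof.
move=> [bF h]; split; first exact: bounded_symbol_shift.
by move=> x; rewrite fourier_gauss_shift (le_trans _ (h _))// opprD addrA addrAC.
Qed.

Lemma lower_bounded_cvg r (F_ : nat -> V -> R[i]) F a C : 0 < r ->
  (forall n, lower_bounded r (F_ n) a C) ->
  (forall xi, Re (F_ n xi) @[n --> \oo] --> Re (F xi)) ->
  (forall xi, Im (F_ n xi) @[n --> \oo] --> Im (F xi)) ->
  lower_bounded r F a C.
Proof.
move=> r0 lF rF iF; have bF n := (lF n).1; split.
  exact: bounded_symbol_cvg bF rF iF.
move=> x; have h := @cvg_fourier_gauss R d r F_ F x r0 bF rF iF.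
rewrite -(cvg_lim _ h)// limr_ge//; first by apply/cvg_ex; eexists; exact: h.
by apply: nearW => n; exact: (lF n).2.
Qed.

Lemma lower_bounded_le r F a C C' : C' <= C -> lower_bounded r F a C ->
  lower_bounded r F a C'.
Proof.
move=> CC [bF h]; split => // x; rewrite (le_trans _ (h x))// ler_wpM2r//.
exact: vgauss_ge0.
Qed.

End lower_bounds.

(** * Multiplication by compound Poisson factors *)

Section compound.
Context {R : realType} {d : nat}.
Local Open Scope complex_scope.
Local Notation Re := complex.Re.
Local Notation Im := complex.Im.
Local Notation V := 'rV[R]_d.
Context (dT : measure_display) (T : measurableType dT)
  (M : {finite_measure set T -> \bar R}) (Z : T -> V).
Hypothesis mZ : measurable_fun setT Z.
Variables (r tau : R).
Hypotheses (r0 : 0 < r) (tau0 : 0 <= tau).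
Implicit Types (F G : V -> R[i]) (x a xi : V).

Let lam : R := fine (M setT).
Let lam0 : 0 <= lam. Proof. by rewrite fine_ge0. Qed.

(** The exponent at time [tau] of the compound Poisson process whose jump intensity is the image of
    [M] under [Z]. *)
Definition compound_exponent xi : R[i] := tau%:C * (char_fun M Z xi - (fine (M setT))%:C).

Let w n xi : R[i] := 1 + (n%:R^-1)%:C * compound_exponent xi.

Let wE n : w n = fun xi => 1 + (tau / n%:R)%:C * (char_fun M Z xi - lam%:C).
Proof. by apply/funext => xi; rewrite /w /compound_exponent mulrA -rmorphM/= mulrC [_^-1 * _]mulrC mulrC. Qed.

(** The Euler factor is [1 - tau lam / n] plus a number of modulus at most [tau lam / n]; the first
    term is nonnegative for such [n]. *)
Let bounded_w n : tau * lam <= n%:R -> (0 < n)%N -> bounded_symbol 1 (w n).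
Proof.
move=> tn n0; have n0' : 0 < n%:R :> R by rewrite ltr0n.
have [rM iM cM] := bounded_symbol_char_fun M mZ.
rewrite wE; split.
- under eq_fun do rewrite ReD ReZ ReD ReN.
  apply: measurable_funD => //; apply: measurable_funM => //.
  exact: measurable_funB.
- under eq_fun do rewrite ImD ImZ ImD ImN.
  apply: measurable_funD => //; apply: measurable_funM => //.
  exact: measurable_funB.
move=> xi.
have -> : 1 + (tau / n%:R)%:C * (char_fun M Z xi - lam%:C) =
    (1 - tau / n%:R * lam)%:C + (tau / n%:R)%:C * char_fun M Z xi.
  by rewrite rmorphB rmorphM/= rmorph1; ring.
have q1 : tau / n%:R * lam <= 1 by rewrite mulrAC ler_pdivrMr// mul1r.
have t0 : 0 <= tau / n%:R by rewrite divr_ge0.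
rewrite (le_trans (cnormD _ _))// cnorm_real ger0_norm ?subr_ge0//.
rewrite cnormM cnorm_real ger0_norm// -lerBrDl opprB addrCA subrr addr0.
by rewrite ler_wpM2l.
Qed.

(** The common frame of [lower_bounded_big] and [lower_bounded_small]. [L n k] is the minorant after
    [k] out of [n] Euler steps, carried through one averaging step by the fourth premise; [Loo] lies
    below every [L n n] and so survives the limit of the Euler products. *)
Lemma compound_limit (N0 : nat) F (L : nat -> nat -> V -> R) (Loo : V -> R) :
  tau * lam <= N0%:R -> bounded_symbol 1 F ->
  (forall n x, (N0 < n)%N -> L n 0%N x <= fourier_gauss r F x) ->
  (forall n k G, (N0 < n)%N -> bounded_symbol 1 G ->
    (forall x, L n k x <= fourier_gauss r G x) ->
    forall x, L n k.+1 x <= (1 - tau / n%:R * lam) * fourier_gauss r G x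
      + tau / n%:R * \int[M]_u fourier_gauss r G (x - Z u)) ->
  (forall n x, (N0 < n)%N -> Loo x <= L n n x) ->
  bounded_symbol 1 (fun xi => F xi * cexp (compound_exponent xi)) /\
  forall x, Loo x <= fourier_gauss r (fun xi => F xi * cexp (compound_exponent xi)) x.
Proof.
move=> tN bF L0 LS Ln.
have wn n : (N0 < n)%N -> bounded_symbol 1 (w n).
  move=> Nn; apply: bounded_w; last exact: leq_ltn_trans Nn.
  by rewrite (le_trans tN)// ler_nat ltnW.
pose Fk n k xi := F xi * w n xi ^+ k.
have bFk n k : (N0 < n)%N -> bounded_symbol 1 (Fk n k).
  move=> Nn; rewrite -[X in bounded_symbol X](mulr1 1).
  by apply: bounded_symbolM => //; apply: bounded_symbolX; exact: wn.
have LF n k : (N0 < n)%N -> forall x, L n k x <= fourier_gauss r (Fk n k) x.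
  move=> Nn; elim: k => [|k IH] x.
    rewrite (_ : Fk n 0%N = F); first exact: L0.
    by apply/funext => xi; rewrite /Fk expr0 mulr1.
  have -> : Fk n k.+1 = fun xi => Fk n k xi * (1 + (tau / n%:R)%:C * (char_fun M Z xi - lam%:C)).
    by apply/funext => xi; rewrite /Fk exprSr wE mulrA.
  rewrite (fourier_gauss_step lam (tau / n%:R) x r0 (bFk n k Nn) (bounded_symbol_char_fun M mZ)).
  rewrite -(Rintegral_fourier_gauss M mZ x r0 (bFk n k Nn)).
  exact: (LS n k _ Nn (bFk n k Nn) IH x).
(* The index is shifted past [N0], so that every term of the sequence is a product of admissible
   steps. *)
pose N n := (N0 + n).+1.
have NN n : (N0 < N n)%N by rewrite /N ltnS leq_addr.
have Re_le xi : Re (compound_exponent xi) <= 0.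
  rewrite /compound_exponent ReZ ReD ReN.
  rewrite mulr_ge0_le0// subr_le0 (le_trans (ler_norm _))//.
  by rewrite (le_trans (cnorm_ge_Re _))// cnorm_char_fun.
have diff n xi : cnorm (Fk (N n) (N n) xi - F xi * cexp (compound_exponent xi)) <=
    3 * cnorm (compound_exponent xi) ^+ 2 / n.+1%:R.
  rewrite /Fk -mulrBr cnormM.
  have h : cnorm (w (N n) xi ^+ N n - cexp (compound_exponent xi)) <=
      3 * cnorm (compound_exponent xi) ^+ 2 / n.+1%:R.
    rewrite (le_trans (cexp_euler _ (Re_le xi) _))//.
      by have [_ _ cw] := wn _ (NN n); exact: cw.
    rewrite ler_wpM2l//; first by rewrite mulr_ge0// sqr_ge0.
    by rewrite lef_pV2 ?posrE// ler_nat /N ltnS leq_addl.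
  apply: le_trans h; rewrite ler_piMl ?cnorm_ge0//.
  by case: bF.
have cR xi : Re (Fk (N n) (N n) xi) @[n --> \oo] --> Re (F xi * cexp (compound_exponent xi)).
  apply: (@cvg_le_inv _ _ _ (3 * cnorm (compound_exponent xi) ^+ 2)) => n.
  rewrite (le_trans _ (diff n xi))//.
  by rewrite (le_trans _ (cnorm_ge_Re _))// ReD ReN.
have cI xi : Im (Fk (N n) (N n) xi) @[n --> \oo] --> Im (F xi * cexp (compound_exponent xi)).
  apply: (@cvg_le_inv _ _ _ (3 * cnorm (compound_exponent xi) ^+ 2)) => n.
  rewrite (le_trans _ (diff n xi))//.
  by rewrite (le_trans _ (cnorm_ge_Im _))// ImD ImN.
have bFN n := bFk (N n) (N n) (NN n).
split; first exact: bounded_symbol_cvg bFN cR cI.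
move=> x; have h := @cvg_fourier_gauss R d r (fun n => Fk (N n) (N n))
  (fun xi => F xi * cexp (compound_exponent xi)) x r0 bFN cR cI.
rewrite -(cvg_lim _ h)// limr_ge//; first by apply/cvg_ex; eexists; exact: h.
by apply: nearW => n; rewrite (le_trans (Ln _ x (NN n)))// LF.
Qed.

(** Keeping only the part without a jump in each step leaves [(1 - q)^n] with [q = tau lam / n]. The
    factor 2 in the exponent gives a bound for each [n] instead of a limit: [1 - q >= exp (- 2 q)]
    for [0 <= q <= 1 / 2]. *)
Lemma lower_bounded_big F a C : 0 <= C -> lower_bounded r F a C ->
  lower_bounded r (fun xi => F xi * cexp (compound_exponent xi)) a
    (C * expR (- (2 * tau * lam))).
Proof.
move=> C0 [bF hF].
have [N0 hN] : exists N0 : nat, 2 * tau * lam <= N0%:R.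
  exists (Num.truncn (2 * tau * lam)).+1; exact: ltW (truncnS_gt _).
have tl0 : 0 <= tau * lam by rewrite mulr_ge0.
pose q n := tau / n%:R * lam.
have q2 n : (N0 < n)%N -> 0 <= q n <= 2^-1.
  move=> Nn; have n0 : 0 < n%:R :> R by rewrite ltr0n (leq_ltn_trans _ Nn).
  have : N0%:R <= n%:R :> R by rewrite ler_nat ltnW.
  rewrite /q mulrAC => h; rewrite divr_ge0//= ler_pdivrMr//; lra.
have h := @compound_limit N0 F
  (fun n k x => (1 - q n) ^+ k * (C * vgauss (4 * r)^-1 (x - a)))
  (fun x => C * expR (- (2 * tau * lam)) * vgauss (4 * r)^-1 (x - a)).
apply: h => //.
- by lra.
- by move=> n x _; rewrite expr0 mul1r.
- move=> n k G Nn bG hG x; have /andP[q0 q1] := q2 n Nn.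
  have L0 y : 0 <= (1 - q n) ^+ k * (C * vgauss (4 * r)^-1 (y - a)).
    by rewrite mulr_ge0 ?mulr_ge0 ?vgauss_ge0// exprn_ge0//; lra.
  (* The averaged term is dropped. It is nonnegative because the minorant of [fourier_gauss r G]
     is. *)
  rewrite exprS -mulrA ler_wpDr//; last by rewrite ler_wpM2l//; lra.
  rewrite mulr_ge0 ?divr_ge0//; apply: Rintegral_ge0 => u _.
  exact: le_trans (hG _).
- move=> n x Nn; have /andP[q0 q1] := q2 n Nn.
  have n0 : 0 < n%:R :> R by rewrite ltr0n (leq_ltn_trans _ Nn).
  rewrite mulrC [C * expR _]mulrC mulrCA mulrA [C * _ as X in _ <= _ * X]mulrC.
  rewrite mulrAC -mulrA [_ * C]mulrC ler_wpM2r ?mulr_ge0 ?vgauss_ge0//.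
  have -> : 2 * tau * lam = (2 * q n) * n%:R.
    by rewrite /q; field; rewrite gt_eqF.
  rewrite -mulNr expRM_natr ler_pXn2r ?nnegrE ?expR_ge0 ?(leq_ltn_trans _ Nn)//; last by lra.
  have := expR_ge1Dx (2 * q n) => h1.
  have h2 : expR (- (2 * q n)) * expR (2 * q n) = 1 by rewrite -expRD addNr expR0.
  have h3 := expR_gt0 (- (2 * q n)).
  have : expR (- (2 * q n)) * (1 + 2 * q n) <= 1 by rewrite -[leRHS]h2 ler_pM2l.
  by nra.
Qed.

Section small_jumps.
Variable B : R.
Hypothesis ZB : forall u, dotp (Z u) (Z u) <= B.

Lemma coord_le_dotp (z : V) i : `|z ord0 i| <= 1 + dotp z z.
Proof.
have h := sqr_coord_le_dotp z i.
have : `|z ord0 i| ^+ 2 <= dotp z z by rewrite real_normK ?num_real.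
by have := sqr_ge0 (`|z ord0 i| - 1); rewrite !expr2; nra.
Qed.

Let measurable_jump i : measurable_fun setT (fun u => Z u ord0 i).
Proof. exact: measurableT_comp (measurable_coord i) mZ. Qed.

Lemma integrable_jump i : M.-integrable setT (fun u => (Z u ord0 i)%:E).
Proof.
apply: (@integrable_bounded _ _ _ M _ (1 + B) (measurable_jump i)) => u.
by rewrite (le_trans (coord_le_dotp _ _))// lerD2l.
Qed.

Lemma integrable_dotp_jump : M.-integrable setT (fun u => (dotp (Z u) (Z u))%:E).
Proof.
apply: (@integrable_bounded _ _ _ M _ B); first exact: measurable_dotp.
by move=> u; rewrite ger0_norm ?dotp_ge0.
Qed.

Definition mean_jump : V := \row_i \int[M]_u Z u ord0 i.

Lemma integrable_dotp (y : V) : M.-integrable setT (fun u => (dotp y (Z u))%:E).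
Proof.
apply: integrable_sum_EFin => i; apply: integrableZl_EFin.
exact: integrable_jump.
Qed.

Lemma Rintegral_dotp (y : V) : \int[M]_u dotp y (Z u) = dotp y mean_jump.
Proof.
rewrite /dotp Rintegral_sum; last first.
  by move=> i; apply: integrableZl_EFin; exact: integrable_jump.
apply: eq_bigr => i _; rewrite RintegralZl//; last exact: integrable_jump.
by rewrite mxE.
Qed.

Lemma expR_tangent (y m : R) : expR m * (1 + (y - m)) <= expR y.
Proof.
have -> : y = m + (y - m) by ring.
by rewrite expRD ler_pM2l ?expR_gt0// addrAC subrr add0r expR_ge1Dx.
Qed.

(* Jensen: the mean of [exp (- kappa |x - b - Z|^2)] under the probability
   with mass [s] on the jumps is at least [exp] of the mean exponent. *)
Lemma jensen_step (kappa s D : R) G b x : 0 <= kappa -> 0 <= s -> s * lam <= 1 -> 0 <= D ->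
  bounded_symbol 1 G ->
  (forall x, D * vgauss kappa (x - b) <= fourier_gauss r G x) ->
  D * expR (- (kappa * (s * \int[M]_u dotp (Z u) (Z u)))) *
    vgauss kappa (x - (b + s *: mean_jump)) <=
  (1 - s * lam) * fourier_gauss r G x + s * \int[M]_u fourier_gauss r G (x - Z u).
Proof.
move=> k0 s0 sl D0 bG hG.
set v := \int[M]_u dotp (Z u) (Z u); set y := x - b; set m := mean_jump.
have yE : dotp (y - s *: m) (y - s *: m) =
    dotp y y - 2 * s * dotp y m + s ^+ 2 * dotp m m.
  by rewrite dotpBB dotpZl !dotpZr; ring.
(* [mu] exceeds the mean of [kappa |y - Z|^2] by [kappa s^2 |m|^2]; this excess returns at the end
   as a factor that is at least 1. *)
set mu := kappa * (dotp (y - s *: m) (y - s *: m) + s * v).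
have -> : D * expR (- (kappa * (s * v))) * vgauss kappa (x - (b + s *: m)) = D * expR (- mu).
  have -> : x - (b + s *: m) = y - s *: m by rewrite opprD addrA.
  by rewrite /vgauss -mulrA -expRD; congr (_ * expR _); rewrite /mu; ring.
(* The tangent to [D exp (- kappa q)] at [kappa q = mu]. Being affine in [q = |y - Z|^2], it is
   integrated exactly by the first two moments of [Z]. *)
pose l q := D * expR (- mu) * (1 + mu - kappa * q).
have tangent q : l q <= D * expR (- (kappa * q)).
  rewrite /l -mulrA ler_wpM2l//; have := expR_tangent (- (kappa * q)) (- mu).
  by rewrite opprK addrA addrAC -addrA [mu - _]addrC addrA addrAC.
have tangent_u u : l (dotp (y - Z u) (y - Z u)) <= fourier_gauss r G (x - Z u).
  rewrite (le_trans _ (hG _))// addrAC; exact: tangent.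
have lE u : l (dotp (y - Z u) (y - Z u)) =
    l (dotp y y) + (2 * D * expR (- mu) * kappa) * dotp y (Z u)
    + (- (D * expR (- mu) * kappa)) * dotp (Z u) (Z u).
  by rewrite /l dotpBB; ring.
have i1 : M.-integrable setT (fun u => (l (dotp y y))%:E).
  exact: finite_measure_integrable_cst.
have i2 : M.-integrable setT (fun u => ((2 * D * expR (- mu) * kappa) * dotp y (Z u))%:E).
  by apply: integrableZl_EFin; exact: integrable_dotp.
have i3 : M.-integrable setT (fun u => ((- (D * expR (- mu) * kappa)) * dotp (Z u) (Z u))%:E).
  by apply: integrableZl_EFin; exact: integrable_dotp_jump.
have i12 := integrableD_EFin i1 i2.
have hint : l (dotp y y) * lam + (2 * D * expR (- mu) * kappa) * dotp y m
    - (D * expR (- mu) * kappa) * v <= \int[M]_u fourier_gauss r G (x - Z u).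
  apply: (@le_trans _ _ (\int[M]_u l (dotp (y - Z u) (y - Z u)))); last first.
    apply: le_Rintegral => //.
    - by under eq_fun do rewrite lE; exact: integrableD_EFin.
    - exact: integrable_fourier_gauss bG.
  under eq_Rintegral do rewrite lE.
  rewrite RintegralD// RintegralD// Rintegral_cst_setT.
  rewrite RintegralZl//; last exact: integrable_dotp.
  rewrite RintegralZl//; last exact: integrable_dotp_jump.
  by rewrite Rintegral_dotp mulNr.
have h0 : l (dotp y y) <= fourier_gauss r G x.
  by rewrite (le_trans _ (hG _))//; exact: tangent.
have q0 : 0 <= 1 - s * lam by rewrite subr_ge0.
apply: (@le_trans _ _ ((1 - s * lam) * l (dotp y y) + s * (l (dotp y y) * lam +
  (2 * D * expR (- mu) * kappa) * dotp y m - (D * expR (- mu) * kappa) * v))); last first.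
  by rewrite lerD// ler_wpM2l.
have e : (1 - s * lam) * l (dotp y y) + s * (l (dotp y y) * lam +
  (2 * D * expR (- mu) * kappa) * dotp y m - (D * expR (- mu) * kappa) * v) =
  D * expR (- mu) * (1 + kappa * (s ^+ 2 * dotp m m)).
  have muE : mu = kappa * (dotp y y - 2 * s * dotp y m + s ^+ 2 * dotp m m + s * v).
    by rewrite /mu yE.
  by rewrite /l; set e := expR _; rewrite muE; ring.
rewrite e ler_peMr ?mulr_ge0 ?expR_ge0// lerDl !mulr_ge0 ?sqr_ge0 ?dotp_ge0//.
Qed.

(** The [n] Jensen steps of size [tau / n] move the centre by [tau *: mean_jump] in total, which the
    compensating exponential undoes, and their joint cost does not depend on [n]. The constant sees
    the second moment of the jumps, not their bound [B]. *)
Lemma lower_bounded_small F a C v : 0 <= C ->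
  \int[M]_u dotp (Z u) (Z u) <= v ->
  lower_bounded r F a C ->
  lower_bounded r (fun xi => F xi * cexp (compound_exponent xi)
      * cexp ('i%C * (dotp xi (- (tau *: mean_jump)))%:C)) a
    (C * expR (- ((4 * r)^-1 * (tau * v)))).
Proof.
move=> C0 Vv [bF hF]; set V0 := \int[M]_u _ in Vv.
have k0 : 0 <= (4 * r)^-1 by rewrite invr_ge0 mulr_ge0// ltW.
rewrite -[a in lower_bounded _ _ a](addrK (tau *: mean_jump)).
apply: lower_bounded_shift.
apply: (@lower_bounded_le _ _ _ _ _ (C * expR (- ((4 * r)^-1 * (tau * V0))))).
  by rewrite ler_wpM2l// ler_expR lerN2 ler_wpM2l// ler_wpM2l.
have [N0 hN] : exists N0 : nat, tau * lam <= N0%:R.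
  exists (Num.truncn (tau * lam)).+1; exact: ltW (truncnS_gt _).
pose K := (4 * r)^-1.
apply: (compound_limit (N0 := N0) (L := fun n k x =>
  C * expR (- (K * (tau / n%:R * V0))) ^+ k *
  vgauss K (x - (a + (k%:R * (tau / n%:R)) *: mean_jump)))) => //.
- by move=> n x _; rewrite expr0 mulr1 mul0r scale0r addr0; exact: hF.
- move=> n k G Nn bG hG x.
  have n0 : 0 < n%:R :> R by rewrite ltr0n (leq_ltn_trans _ Nn).
  have Nn' : N0%:R <= n%:R :> R by rewrite ler_nat ltnW.
  have -> : a + (k.+1%:R * (tau / n%:R)) *: mean_jump =
      a + (k%:R * (tau / n%:R)) *: mean_jump + (tau / n%:R) *: mean_jump.
    by rewrite -addrA -scalerDl -[k.+1]addn1 natrD mulrDl mul1r.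
  have s0 : 0 <= tau / n%:R by rewrite divr_ge0.
  have sl : tau / n%:R * lam <= 1 by rewrite mulrAC ler_pdivrMr// mul1r (le_trans hN).
  have D0 : 0 <= C * expR (- (K * (tau / n%:R * V0))) ^+ k.
    by rewrite mulr_ge0// exprn_ge0// expR_ge0.
  have J := jensen_step x k0 s0 sl D0 bG hG.
  apply: le_trans J; rewrite le_eqVlt; apply/orP; left; apply/eqP.
  by rewrite exprSr /V0 !mulrA.
- move=> n x Nn.
  have n0 : 0 < n%:R :> R by rewrite ltr0n (leq_ltn_trans _ Nn).
  rewrite -expRM_natr mulNr (_ : K * (tau / n%:R * V0) * n%:R = K * (tau * V0)); last first.
    by field; rewrite gt_eqF.
  by rewrite (_ : n%:R * (tau / n%:R) = tau)//; field; rewrite gt_eqF.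
Qed.

End small_jumps.

End compound.

(** * The Gaussian part of the exponent *)

Section gaussian_part.
Context {R : realType} {d : nat}.
Local Open Scope complex_scope.
Local Notation Re := complex.Re.
Local Notation Im := complex.Im.
Local Notation V := 'rV[R]_d.
Implicit Types (F : V -> R[i]) (A : 'M[R]_d) (x y a xi v z : V).

Lemma fine_dirac_setT : fine (\d_(0 : measurableTypeR R) [set: measurableTypeR R] : \bar R) = 1.
Proof. by rewrite diracT. Qed.

(** A single jump [z] is encoded as a constant map over a point mass on the real line. *)
Lemma char_fun_cst z xi :
  char_fun (\d_(0 : measurableTypeR R)) (fun=> z) xi = cexp ('i%C * (dotp xi z)%:C).
Proof.
apply: complexP.
- by rewrite Re_char_fun Re_cexp_i Rintegral_cst// fine_dirac_setT mulr1.
- by rewrite Im_char_fun Im_cexp_i Rintegral_cst// fine_dirac_setT mulr1.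
Qed.

Lemma mean_jump_cst z : mean_jump (\d_(0 : measurableTypeR R)) (fun=> z) = z.
Proof.
by apply/rowP => i; rewrite mxE Rintegral_cst// fine_dirac_setT mulr1.
Qed.

Lemma lower_bounded_dirac (r tau : R) F a C z : 0 < r -> 0 <= tau -> 0 <= C ->
  lower_bounded r F a C ->
  lower_bounded r (fun xi => F xi * cexp (tau%:C * (cexp ('i%C * (dotp xi z)%:C) - 1))
      * cexp ('i%C * (dotp xi (- (tau *: z)))%:C)) a
    (C * expR (- ((4 * r)^-1 * (tau * dotp z z)))).
Proof.
move=> r0 tau0 C0 lF.
have mz : measurable_fun [set: measurableTypeR R] (fun=> z : V) by exact: measurable_cst.
have := @lower_bounded_small R d _ _ (\d_(0 : measurableTypeR R)) (fun=> z) mz r tau r0 tau0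
  (dotp z z) (fun=> lexx _) F a C (dotp z z) C0.
rewrite Rintegral_cst// fine_dirac_setT mulr1 => /(_ (lexx _) lF).
rewrite mean_jump_cst; congr (lower_bounded _ _ _ _); apply/funext => xi.
by rewrite /compound_exponent char_fun_cst fine_dirac_setT.
Qed.

Lemma dotpNr x y : dotp x (- y) = - dotp x y.
Proof. by rewrite -scaleN1r dotpZr mulN1r. Qed.

(** Jumps [z] and [- z] at the same rate: the compensators cancel and the exponent becomes real. *)
Lemma lower_bounded_sym (r tau : R) F a C z : 0 < r -> 0 <= tau -> 0 <= C ->
  lower_bounded r F a C ->
  lower_bounded r (fun xi => F xi * (expR (- (tau * (2 * (1 - cos (dotp xi z))))))%:C) a
    (C * expR (- ((4 * r)^-1 * (2 * tau * dotp z z)))).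
Proof.
move=> r0 tau0 C0 lF.
have h1 := lower_bounded_dirac z r0 tau0 C0 lF.
have C1 : 0 <= C * expR (- ((4 * r)^-1 * (tau * dotp z z))).
  by rewrite mulr_ge0 ?expR_ge0.
have h2 := lower_bounded_dirac (- z) r0 tau0 C1 h1.
have zNN : dotp (- z) (- z) = dotp z z.
  by rewrite -scaleN1r dotpZl dotpZr; ring.
move: h2; rewrite zNN -mulrA -expRD.
rewrite (_ : - _ - _ = - ((4 * r)^-1 * (2 * tau * dotp z z))); last by ring.
congr (lower_bounded _ _ _ _); apply/funext => xi.
pose e1 := tau%:C * (cexp ('i%C * (dotp xi z)%:C) - 1).
pose e2 := 'i%C * (dotp xi (- (tau *: z)))%:C.
pose e3 := tau%:C * (cexp ('i%C * (dotp xi (- z))%:C) - 1).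
pose e4 := 'i%C * (dotp xi (- (tau *: - z)))%:C.
have E : e1 + e2 + e3 + e4 = (- (tau * (2 * (1 - cos (dotp xi z)))))%:C.
  rewrite /e1 /e2 /e3 /e4 scalerN opprK !dotpNr dotpZr.
  set q := dotp xi z; have := Re_cexp_i q; have := Im_cexp_i q.
  have := Re_cexp_i (- q); have := Im_cexp_i (- q); rewrite cosN sinN.
  (* [cexp] is generalized: [ReM] would unfold it *)
  move: (cexp _) (cexp _) => c1 c2 i1 h1' i2 h2.
  apply: complexP; rewrite !(ReD, ImD, ReZ, ImZ, ReN, ImN, ReM, ImM)/= ?i1 ?i2 ?h1' ?h2; ring.
have {}E : cexp e1 * cexp e2 * cexp e3 * cexp e4 =
    (expR (- (tau * (2 * (1 - cos (dotp xi z))))))%:C.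
  rewrite -!cexpD E; apply: complexP; rewrite ?(Re_cexp, Im_cexp)/=.
    by rewrite cos0 mulr1.
  by rewrite sin0 mulr0.
by rewrite -E !mulrA.
Qed.

Lemma cvg_sin_scaled (c : R) :
  2 * n.+1%:R * sin (c / (2 * n.+1%:R)) @[n --> \oo] --> c.
Proof.
apply: (@cvg_le_inv _ _ _ (c ^+ 2)) => n.
have n0 : 0 < 2 * n.+1%:R :> R by rewrite mulr_gt0.
rewrite -{2}[c](@mulfVK _ (2 * n.+1%:R)) ?gt_eqF// mulrC -mulrBl.
rewrite normrM (ger0_norm (ltW n0)) -ler_pdivlMr//.
rewrite (le_trans (normr_sinB_le _))// expr_div_n.
rewrite -[leRHS]mulrA -invfM ler_wpM2l ?sqr_ge0// lef_pV2 ?posrE ?mulr_gt0 ?exprn_gt0//.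
have : 0 <= (n.+1%:R : R) ^+ 2 by exact: sqr_ge0.
by rewrite !expr2; set m := n.+1%:R; nra.
Qed.

(** Jumps of size [v / n] in both directions at rate [tau n^2] have exponent
    [- tau (2 n sin (<xi, v> / (2 n)))^2], which tends to the square. Their second moment
    [2 tau |v|^2] does not depend on [n], hence neither does the constant. *)
Lemma lower_bounded_square (r tau : R) F a C v : 0 < r -> 0 <= tau -> 0 <= C ->
  lower_bounded r F a C ->
  lower_bounded r (fun xi => F xi * (expR (- (tau * dotp xi v ^+ 2)))%:C) a
    (C * expR (- ((4 * r)^-1 * (2 * tau * dotp v v)))).
Proof.
move=> r0 tau0 C0 lF.
pose s n xi := 2 * n.+1%:R * sin (dotp xi v / (2 * n.+1%:R)).
have cs xi : expR (- (tau * s n xi ^+ 2)) @[n --> \oo] --> expR (- (tau * dotp xi v ^+ 2)).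
  apply: (cvg_comp _ expR); last exact: continuous_expR.
  apply: cvgN; apply: cvgM; first exact: cvg_cst.
  by apply: cvgM; exact: cvg_sin_scaled.
apply: (@lower_bounded_cvg _ _ _ (fun n xi => F xi * (expR (- (tau * s n xi ^+ 2)))%:C)) => //.
- move=> n; have n0 : 0 < n.+1%:R :> R by [].
  have t0 : 0 <= tau * n.+1%:R ^+ 2 by rewrite mulr_ge0 ?sqr_ge0.
  have := lower_bounded_sym (n.+1%:R^-1 *: v) r0 t0 C0 lF.
  rewrite dotpZl dotpZr (_ : 2 * _ * _ = 2 * tau * dotp v v); last first.
    by field; rewrite gt_eqF.
  congr (lower_bounded _ _ _ _); apply/funext => xi; congr (_ * (expR (- _))%:C).
  rewrite dotpZr /s; set c := dotp xi v.
  have -> : n.+1%:R^-1 * c = (c / (2 * n.+1%:R)) *+ 2.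
    by rewrite mulr2n; field; rewrite gt_eqF.
  rewrite cos_double.
  by ring.
- move=> xi; under eq_fun do rewrite mulrC ReZ; rewrite mulrC ReZ.
  by apply: cvgM; [exact: cs|exact: cvg_cst].
- move=> xi; under eq_fun do rewrite mulrC ImZ; rewrite mulrC ImZ.
  by apply: cvgM; [exact: cs|exact: cvg_cst].
Qed.

Lemma dotpDl x y z : dotp (x + y) z = dotp x z + dotp y z.
Proof. by rewrite /dotp -big_split; apply: eq_bigr => i _; rewrite !mxE mulrDl. Qed.

Lemma dotpDr x y z : dotp z (x + y) = dotp z x + dotp z y.
Proof. by rewrite dotpC dotpDl !(dotpC z). Qed.

Lemma dotp_delta (k : 'I_d) x : dotp (delta_mx ord0 k) x = x ord0 k.
Proof.
rewrite /dotp (bigD1 k)//= mxE !eqxx mul1r big1 ?addr0// => i ik.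
by rewrite mxE (negbTE ik) andbF mul0r.
Qed.

Lemma dotp_row A (k : 'I_d) x : A^T = A -> dotp x (row k A) = (x *m A) ord0 k.
Proof.
move=> sA; rewrite mxE; apply: eq_bigr => i _.
by rewrite mxE -{1}sA mxE.
Qed.

Lemma quadratic_delta A (k : 'I_d) x (t : R) : A^T = A ->
  let y := x + t *: delta_mx ord0 k in
  dotp y (y *m A) = dotp x (x *m A) + 2 * t * (x *m A) ord0 k + t ^+ 2 * A k k.
Proof.
move=> sA y; rewrite /y mulmxDl -scalemxAl -rowE.
have rk : (row k A) ord0 k = A k k by rewrite mxE.
by rewrite dotpDl !dotpDr !dotpZl !dotpZr !dotp_delta rk dotp_row//; ring.
Qed.

(** Symmetric elimination, one pivot at a time: the induction is over matrices whose first [k] rows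
    vanish. A zero pivot forces its row to vanish; a positive one splits off a square and leaves the
    Schur complement. *)
Lemma psd_cholesky A : A^T = A -> psd A ->
  exists vs : seq V, forall xi, dotp xi (xi *m A) = \sum_(v <- vs) dotp xi v ^+ 2.
Proof.
suff h m : forall k (B : 'M[R]_d), (d - k <= m)%N -> (forall (i j : 'I_d), (i < k)%N -> B i j = 0) ->
    B^T = B -> psd B ->
    exists vs : seq V, forall xi, dotp xi (xi *m B) = \sum_(v <- vs) dotp xi v ^+ 2.
  by apply: (h d 0%N) => //; rewrite subn0.
elim: m => [|m IH] k B dk Bk sB pB.
  exists [::] => xi; rewrite big_nil (_ : B = 0) ?mulmx0; last first.
    apply/matrixP => i j; rewrite Bk ?mxE// (leq_trans (ltn_ord i))//.
    by rewrite -subn_eq0 -leqn0.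
  by rewrite /dotp big1// => i _; rewrite mxE mulr0.
have [kd|dk'] := ltnP k d; last first.
  by apply: (IH k) => //; move: dk'; rewrite -subn_eq0 => /eqP ->.
pose k0 := Ordinal kd.
have dk1 : (d - k.+1 <= m)%N by rewrite subnS; case: (d - k)%N dk.
have Q (x : V) (t : R) : 0 <= dotp x (x *m B) + 2 * t * (x *m B) ord0 k0 + t ^+ 2 * B k0 k0.
  by rewrite -quadratic_delta//; exact: pB.
have Bkk : 0 <= B k0 k0.
  have := Q 0 1; rewrite mul0mx [(_ : 'rV_d) _ _]mxE mulr0 addr0 expr1n mul1r.
  by rewrite /dotp big1 ?add0r// => i _; rewrite mxE mul0r.
have succ (D : 'M[R]_d) : (forall j, D k0 j = 0) -> (forall (i j : 'I_d), (i < k)%N -> D i j = 0) ->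
    forall (i j : 'I_d), (i < k.+1)%N -> D i j = 0.
  move=> D0 D1 i j; rewrite ltnS leq_eqVlt => /orP[/eqP ik|]; last exact: D1.
  by rewrite (_ : i = k0) ?D0//; exact: val_inj.
move: Bkk; rewrite le_eqVlt => /orP[/eqP B0|Bkk].
  apply: (IH k.+1) => //; apply: succ => // j.
  have e : ((delta_mx ord0 j : V) *m B) ord0 k0 = B k0 j by rewrite -rowE mxE -{1}sB mxE.
  set x : V := delta_mx ord0 j in e.
  have Qx t := Q x t; move: Qx; rewrite e -B0 => Qx.
  set q := dotp x _ in Qx.
  apply/eqP/negPn/negP => nz.
  (* With a zero pivot the polynomial in [t] is affine of slope [2 * B k0 j]; at this [t] it would
     be -1. *)
  have := Qx (- (q + 1) / (2 * B k0 j)).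
  rewrite mulr0 addr0 (_ : 2 * _ * B k0 j = - (q + 1)); last by field; rewrite nz.
  by lra.
pose v : V := (Num.sqrt (B k0 k0))^-1 *: row k0 B.
pose D : 'M[R]_d := B - v^T *m v.
have DE i j : D i j = B i j - B k0 i * B k0 j / B k0 k0.
  rewrite /D mxE [X in _ + X]mxE mxE big_ord1 !mxE.
  rewrite mulrACA -invfM -expr2 sqr_sqrtr ?ltW//.
  by rewrite mulrC.
have quadD (x : V) : dotp x (x *m D) = dotp x (x *m B) - dotp x v ^+ 2.
  rewrite /D mulmxBr dotpBr mulmxA; congr (_ - _).
  rewrite (_ : x *m v^T = (dotp x v)%:M); last first.
    by apply/matrixP => i j; rewrite !ord1 !mxE eqxx mulr1n; apply: eq_bigr => l _; rewrite mxE.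
  by rewrite mul_scalar_mx dotpZr expr2.
have vE (x : V) : dotp x v ^+ 2 = ((x *m B) ord0 k0) ^+ 2 / B k0 k0.
  by rewrite /v dotpZr dotp_row// exprMn exprVn sqr_sqrtr ?ltW// mulrC.
have [|||vs hvs] := IH k.+1 D dk1.
- apply: succ => [j|i j ik]; rewrite DE; first by field; rewrite gt_eqF.
  by rewrite Bk// -[B k0 i]/(B k0 i) -{1}sB mxE Bk// mul0r mul0r subr0.
- by apply/matrixP => i j; rewrite mxE !DE -{1}sB mxE; congr (_ - _ / _); rewrite mulrC.
- move=> x; rewrite quadD vE.
  (* This [t] minimizes the polynomial, and the minimum is the form of the Schur complement [D]. *)
  have := Q x (- ((x *m B) ord0 k0 / B k0 k0)); congr (0 <= _).
  by field; rewrite gt_eqF.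
exists (v :: vs) => x; rewrite big_cons -hvs quadD; ring.
Qed.

Lemma lower_bounded_squares (r tau : R) F a C (vs : seq V) : 0 < r -> 0 <= tau -> 0 <= C ->
  lower_bounded r F a C ->
  lower_bounded r (fun xi => F xi * (expR (- (tau * \sum_(v <- vs) dotp xi v ^+ 2)))%:C) a
    (C * expR (- ((4 * r)^-1 * (2 * tau * \sum_(v <- vs) dotp v v)))).
Proof.
move=> r0 tau0 C0 lF; elim: vs => [|v vs IH].
  have := lF; rewrite big_nil !mulr0 oppr0 expR0 mulr1.
  congr (lower_bounded _ _ _ _); apply/funext => xi.
  by rewrite big_nil mulr0 oppr0 expR0 mulr1.
have C1 : 0 <= C * expR (- ((4 * r)^-1 * (2 * tau * \sum_(v <- vs) dotp v v))).
  by rewrite mulr_ge0 ?expR_ge0.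
have := lower_bounded_square v r0 tau0 C1 IH.
rewrite big_cons -mulrA -expRD (_ : - _ - _ =
    - ((4 * r)^-1 * (2 * tau * (dotp v v + \sum_(j <- vs) dotp j j)))); last by ring.
congr (lower_bounded _ _ _ _); apply/funext => xi.
rewrite big_cons mulrDr opprD expRD rmorphM/= -mulrA; congr (_ * _).
exact: mulrC.
Qed.

End gaussian_part.

(** * The jump part of the exponent *)

Section restriction.
Context d (T : measurableType d) (R : realType) (N : {measure set T -> \bar R}).

(** Restrictions of [N] are bundled as finite measures, to which the averaging results apply; this
    brings their integrals back to [N]. *)
Lemma Rintegral_mfrestr (D : set T) (mD : measurable D) (foo : (N D < +oo)%E)
    (f : T -> R) (c : R) :
  measurable_fun setT f -> (forall z, `|f z| <= c) ->
  \int[mfrestr mD foo]_z f z = \int[N]_z (f \_ D) z.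
Proof.
move=> mf fc; rewrite -Rintegral_mkcond /Rintegral; congr fine.
have fi : (mfrestr mD foo).-integrable setT (EFin \o f) by exact: integrable_bounded fc.
have mCD : measurable (~` D) by exact: measurableC.
rewrite (negligible_integral mCD _ fi)//; last first.
  by rewrite -[LHS]/(N (~` D `&` D)) setICl measure0.
rewrite setTD setCK; apply: eq_measure_integral => A mA AD.
by rewrite -[LHS]/(N (A `&` D)) setIidl.
Qed.

End restriction.

Section levy_part.
Context {R : realType} {d : nat}.
Local Open Scope complex_scope.
Local Notation Re := complex.Re.
Local Notation Im := complex.Im.
Local Notation V := 'rV[R]_d.
Variable N : {measure set V -> \bar R}.
Hypothesis levyN : levy_measure N.
Implicit Types (F : V -> R[i]) (x y a xi z : V).

Lemma enorm2 z : enorm z ^+ 2 = dotp z z.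
Proof. by rewrite /enorm sqr_sqrtr// dotp_ge0. Qed.

Lemma enorm_ge0 z : 0 <= enorm z. Proof. exact: sqrtr_ge0. Qed.

Lemma normr_coord_le_enorm z i : `|z ord0 i| <= enorm z.
Proof. by rewrite -sqrtr_sqr /enorm ler_wsqrtr// sqr_coord_le_dotp. Qed.

Lemma measurable_enorm : measurable_fun setT (@enorm R d).
Proof.
apply: measurableT_comp; last exact: measurable_dotp.
exact: continuous_measurable_fun (@sqrt_continuous R).
Qed.

Lemma dotp_eq0 z : dotp z z = 0 -> z = 0.
Proof.
move=> z0; apply/rowP => i; rewrite mxE; apply/eqP.
by rewrite -sqrf_eq0 eq_le sqr_ge0 -{1}z0 sqr_coord_le_dotp.
Qed.

Lemma dotp_cauchy x y : dotp x y ^+ 2 <= dotp x x * dotp y y.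
Proof.
have := dotp_ge0 y; rewrite le_eqVlt => /orP[/eqP/esym y0|y0].
  rewrite (dotp_eq0 y0) (_ : dotp x 0 = 0) ?expr0n ?mulr_ge0 ?dotp_ge0//.
  by rewrite /dotp big1// => i _; rewrite mxE mulr0.
have := dotp_ge0 (dotp y y *: x - dotp x y *: y).
rewrite dotpBB !dotpZl !dotpZr.
set s := dotp y y in y0 *; set t := dotp x y; set u := dotp x x => h.
have : 0 <= s * (s * u - t ^+ 2) by move: h; rewrite !expr2; nra.
by rewrite pmulr_rge0// subr_ge0 mulrC.
Qed.

Definition levy_weight z : R := Num.min 1 (enorm z ^+ 2).

Lemma levy_weight_ge0 z : 0 <= levy_weight z.
Proof. by rewrite /levy_weight le_min ler01 sqr_ge0. Qed.

Lemma measurable_levy_weight : measurable_fun setT levy_weight.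
Proof. by apply: measurable_minr => //; apply: measurable_funX; exact: measurable_enorm. Qed.

Lemma integrable_levy_weight : N.-integrable setT (EFin \o levy_weight).
Proof.
apply/integrableP; split; first by apply/measurable_EFinP; exact: measurable_levy_weight.
case: levyN => _; apply: le_lt_trans; rewrite le_eqVlt; apply/orP; left; apply/eqP.
by apply: eq_integral => z _; rewrite /= ger0_norm ?levy_weight_ge0.
Qed.

Lemma integrable_levy (g : V -> R) (K : R) : measurable_fun setT g ->
  (forall z, `|g z| <= K * levy_weight z) -> N.-integrable setT (EFin \o g).
Proof.
move=> mg gK; apply: le_integrable (integrableZl_EFin K integrable_levy_weight) => //.
  exact/measurable_EFinP.
by move=> z _ /=; rewrite lee_fin (le_trans (gK z))// ler_norm.
Qed.

(** Markov's inequality: [levy_weight] is at least [min (1, e^2)] on [D]. *)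
Lemma levy_far_lty (e : R) (D : set V) : 0 < e -> measurable D ->
  (forall z, D z -> e <= enorm z) -> (N D < +oo)%E.
Proof.
move=> e0 mD De.
have e1 : 0 < Num.min 1 (e ^+ 2) by rewrite lt_min ltr01 exprn_gt0.
have : (\int[N]_(z in D) (Num.min 1 (e ^+ 2))%:E < +oo)%E.
  case: levyN => _; apply: le_lt_trans.
  apply: (@le_trans _ _ (\int[N]_(z in D) (levy_weight z)%:E)%E).
    apply: ge0_le_integral => //.
    - by move=> z _; rewrite lee_fin ltW.
    - by apply/measurable_EFinP; apply: measurable_funTS; exact: measurable_levy_weight.
    - move=> z Dz; rewrite lee_fin /levy_weight le_min ge_min lexx/= ge_min.
      by apply/orP; right; rewrite ler_sqr ?nnegrE ?enorm_ge0 ?De// ltW.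
  apply: ge0_subset_integral => //.
    by apply/measurable_EFinP; exact: measurable_levy_weight.
  by move=> z _; rewrite lee_fin levy_weight_ge0.
rewrite integral_cst//.
have [->|] := eqVneq (N D) +oo%E; last by move=> h _; rewrite ltey.
by rewrite gt0_muley ?lte_fin.
Qed.

(** With [levy_im], the real and imaginary parts of [exp (i <xi, z>) - 1 - i <xi, z>], the
    compensator being cut at a radius [rho] that will be [sqrt t] instead of 1. *)
Definition levy_re xi z : R := cos (dotp xi z) - 1.

Definition levy_im (rho : R) xi z : R :=
  sin (dotp xi z) - dotp xi z * (enorm z < rho)%R%:R.

Definition levy_exponent (rho : R) xi : R[i] :=
  (\int[N]_z levy_re xi z) +i* (\int[N]_z levy_im rho xi z).

Lemma measurable_lt_enorm (rho : R) : measurable [set z : V | enorm z < rho].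
Proof.
rewrite -[X in measurable X]setTI; have := measurable_enorm measurableT (measurable_itv `]-oo, rho[).
by congr (measurable (_ `&` _)); apply/seteqP; split => z /=; rewrite in_itv.
Qed.

Lemma measurable_ge_enorm (rho : R) : measurable [set z : V | rho <= enorm z].
Proof.
rewrite (_ : [set z | _] = ~` [set z : V | enorm z < rho]); last first.
  by apply/seteqP; split => z /=; rewrite leNgt => /negP.
exact: measurableC (measurable_lt_enorm rho).
Qed.

Lemma measurable_truncation (rho : R) :
  measurable_fun setT (fun z : V => (enorm z < rho)%R%:R : R).
Proof.
rewrite (_ : (fun z => _) = \1_[set z : V | enorm z < rho]).
  by apply: measurable_indic; exact: measurable_lt_enorm.
apply/funext => z; rewrite indicE; congr (_%:R); congr nat_of_bool.
by apply/idP/idP => h; [rewrite inE|rewrite inE in h].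
Qed.

Lemma measurable_levy_re xi : measurable_fun setT (levy_re xi).
Proof.
apply: measurable_funB => //; apply: measurableT_comp; first exact: measurable_cos.
exact: measurable_dotp.
Qed.

Lemma measurable_levy_im rho xi : measurable_fun setT (levy_im rho xi).
Proof.
apply: measurable_funB.
  by apply: measurableT_comp; [exact: measurable_sin|exact: measurable_dotp].
by apply: measurable_funM; [exact: measurable_dotp|exact: measurable_truncation].
Qed.

Lemma levy_re_le xi z : `|levy_re xi z| <= (2 + dotp xi xi) * levy_weight z.
Proof.
rewrite /levy_re distrC ger0_norm ?subr_ge0 ?cos_le1//.
have h1 := cos_ge1Bx2 (dotp xi z); have h2 := dotp_cauchy xi z.
have h3 := cos_geN1 (dotp xi z); have h4 := dotp_ge0 xi.
rewrite /levy_weight enorm2; have h5 := dotp_ge0 z.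
by case: (leP 1 (dotp z z)) => _; [lra|nra].
Qed.

(** Below [rho] the integrand is at most [|xi|^2 |z|^2], with [|z|^2 <= (1 + rho^2) levy_weight z];
    above it is at most 1, with [1 <= (1 + rho^-2) levy_weight z]. *)
Lemma levy_im_le (rho : R) xi z : 0 < rho ->
  `|levy_im rho xi z| <= ((1 + rho ^- 2) + dotp xi xi * (1 + rho ^+ 2)) * levy_weight z.
Proof.
move=> rho0; rewrite /levy_im /levy_weight.
have r1 : 0 < rho ^- 2 by rewrite invr_gt0 exprn_gt0.
have r2 : 0 < rho ^+ 2 by rewrite exprn_gt0.
have r3 : rho ^- 2 * rho ^+ 2 = 1 by rewrite mulVf// gt_eqF.
have h4 := dotp_ge0 xi; have h2 := dotp_cauchy xi z; have h5 := dotp_ge0 z.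
have h7 : 0 <= dotp xi xi * rho ^+ 2 by rewrite mulr_ge0// ltW.
case: (ltP (enorm z) rho) => zr /=.
  rewrite mulr1 (le_trans (normr_sinB_le _))// (le_trans h2)//.
  have : dotp z z <= rho ^+ 2.
    by rewrite -enorm2 ler_sqr ?nnegrE ?enorm_ge0// ltW.
  rewrite enorm2; case: (leP 1 (dotp z z)) => z1 zr2.
    rewrite mulr1 -[leLHS]add0r lerD ?ler_wpM2l//; first by lra.
    by lra.
  have : 0 <= (1 + rho ^- 2) * dotp z z by rewrite mulr_ge0//; lra.
  have : 0 <= dotp xi xi * rho ^+ 2 * dotp z z by rewrite mulr_ge0.
  by lra.
rewrite mulr0 subr0 (le_trans (normr_sin_le1 _))//.
have : rho ^+ 2 <= dotp z z by rewrite -enorm2 ler_sqr ?nnegrE ?enorm_ge0// ltW.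
rewrite enorm2; case: (leP 1 (dotp z z)) => z1 zr2; first by nra.
have : 1 <= rho ^- 2 * dotp z z by rewrite -r3 ler_pM2l.
have : 0 <= dotp xi xi * (1 + rho ^+ 2) * dotp z z by rewrite mulr_ge0// mulr_ge0//; lra.
by lra.
Qed.

Lemma integrable_levy_re xi : N.-integrable setT (EFin \o levy_re xi).
Proof. by apply: integrable_levy (levy_re_le xi); exact: measurable_levy_re. Qed.

Lemma integrable_levy_im rho xi : 0 < rho -> N.-integrable setT (EFin \o levy_im rho xi).
Proof.
move=> rho0; apply: integrable_levy (fun z => levy_im_le xi z rho0).
exact: measurable_levy_im.
Qed.

Lemma normr_patch_le (g : V -> R) (D : set V) z : `|(g \_ D) z| <= `|g z|.
Proof. by rewrite patchE; case: ifP => // _; rewrite normr0. Qed.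

Lemma measurable_patch (g : V -> R) (D : set V) : measurable D -> measurable_fun setT g ->
  measurable_fun setT (g \_ D).
Proof. by move=> mD mg; apply: (measurable_restrictT _ mD).1; exact: measurable_funTS. Qed.

Lemma integrable_patch (g : V -> R) (D : set V) : measurable D ->
  N.-integrable setT (EFin \o g) -> N.-integrable setT (EFin \o (g \_ D)).
Proof.
move=> mD gi; have mg : measurable_fun setT g.
  by apply/measurable_EFinP; exact: measurable_int gi.
apply: le_integrable gi => //.
  by apply/measurable_EFinP; exact: measurable_patch.
by move=> z _; rewrite lee_fin normr_patch_le.
Qed.

(** * Jumps below and above the radius [sqrt t] *)

Section decomposition.
Variables (r t K : R).
Hypotheses (r0 : 0 < r) (t0 : 0 < t)
  (NK : (\int[N]_z (Num.min t (enorm z ^+ 2))%:E <= K%:E)%E).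

Let rho := Num.sqrt t.
Let rho0 : 0 < rho. Proof. by rewrite sqrtr_gt0. Qed.
Let rho2 : rho ^+ 2 = t. Proof. by rewrite sqr_sqrtr// ltW. Qed.

(** [N] may be infinite near 0 but is finite on these annuli, which increase to the punctured ball
    of radius [rho]. *)
Let D1 n : set V := [set z | n.+1%:R^-1 <= enorm z] `&` [set z | enorm z < rho].
Let D2 : set V := [set z | rho <= enorm z].

Let mD1 n : measurable (D1 n).
Proof. by apply: measurableI; [exact: measurable_ge_enorm|exact: measurable_lt_enorm]. Qed.

Let mD2 : measurable D2. Proof. exact: measurable_ge_enorm. Qed.

Let fooD1 n : (N (D1 n) < +oo)%E.
Proof. by apply: (@levy_far_lty n.+1%:R^-1) => // z []. Qed.

Let fooD2 : (N D2 < +oo)%E.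
Proof. exact: (levy_far_lty rho0). Qed.

Let weight z : R := Num.min t (enorm z ^+ 2).

Let integrable_weight : N.-integrable setT (EFin \o weight).
Proof.
apply/integrableP; split.
  apply/measurable_EFinP; apply: measurable_minr => //.
  by apply: measurable_funX; exact: measurable_enorm.
apply: le_lt_trans (ltry K); apply: le_trans NK; rewrite le_eqVlt; apply/orP; left.
apply/eqP; apply: eq_integral => z _; rewrite /= ger0_norm//.
by rewrite /weight le_min (ltW t0) sqr_ge0.
Qed.

Let Rintegral_weight : \int[N]_z weight z <= K.
Proof.
rewrite -lee_fin /Rintegral fineK//; exact: integrable_fin_num.
Qed.

(** The identity on every [D1 n], cut off so as to be bounded everywhere. *)
Let Z z : V := (enorm z < rho)%R%:R *: z.

Let mZ : measurable_fun setT Z.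
Proof.
apply: measurable_rV => i; under eq_fun do rewrite mxE.
by apply: measurable_funM; [exact: measurable_truncation|exact: measurable_coord].
Qed.

Let dotpZ z : dotp (Z z) (Z z) <= t.
Proof.
rewrite /Z dotpZl dotpZr; case: (ltP (enorm z) rho) => zr /=; last by rewrite !mul0r ltW.
by rewrite !mul1r -enorm2 -rho2 ler_sqr ?nnegrE ?enorm_ge0 ?ltW.
Qed.

Let M1 n : {finite_measure set V -> \bar R} := mfrestr (mD1 n) (fooD1 n).
Let M2 : {finite_measure set V -> \bar R} := mfrestr mD2 fooD2.

(** On [D1 n] the weight [min (t, |z|^2)] is [|z|^2], on [D2] it is [t]; hence the same [K] here and
    in [big_mass]. *)
Let variance n : \int[M1 n]_z dotp (Z z) (Z z) <= K.
Proof.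
apply: le_trans Rintegral_weight.
have mdZ : measurable_fun setT (fun z => dotp (Z z) (Z z)) by exact: measurable_dotp.
rewrite (@Rintegral_mfrestr _ _ _ _ _ _ _ _ t)//; last first.
  by move=> z; rewrite ger0_norm ?dotp_ge0.
have le_w z : `|((fun z => dotp (Z z) (Z z)) \_ (D1 n)) z| <= weight z.
  rewrite patchE /weight; case: ifPn => zD; last first.
    by rewrite normr0 le_min (ltW t0) sqr_ge0.
  rewrite ger0_norm ?dotp_ge0// le_min dotpZ/= enorm2.
  by move: zD; rewrite inE => -[_ zr]; rewrite /Z zr scale1r.
apply: le_Rintegral => //.
  apply: le_integrable integrable_weight => //.
    by apply/measurable_EFinP; exact: measurable_patch.
  by move=> z _; rewrite lee_fin (le_trans (le_w z))// ler_norm.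
by move=> z _; rewrite (le_trans (ler_norm _)).
Qed.

Let big_mass : t * fine (M2 setT) <= K.
Proof.
apply: le_trans Rintegral_weight; rewrite -Rintegral_cst_setT.
rewrite (@Rintegral_mfrestr _ _ _ _ _ _ _ _ t)//; last first.
  by move=> z; rewrite ger0_norm// ltW.
have le_w z : `|((fun=> t) \_ D2) z| <= weight z.
  rewrite patchE /weight; case: ifPn => zD; last first.
    by rewrite normr0 le_min (ltW t0) sqr_ge0.
  rewrite ger0_norm ?(ltW t0)// le_min lexx/= -rho2.
  by move: zD; rewrite inE => zr; rewrite ler_sqr ?nnegrE ?enorm_ge0 ?(ltW rho0).
apply: le_Rintegral => //.
  apply: le_integrable integrable_weight => //.
    by apply/measurable_EFinP; exact: measurable_patch.
  by move=> z _; rewrite lee_fin (le_trans (le_w z))// ler_norm.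
by move=> z _; rewrite (le_trans (ler_norm _)).
Qed.

Let hre n xi z := (levy_re xi \_ (D1 n)) z + (levy_re xi \_ D2) z.
Let him n xi z := (levy_im rho xi \_ (D1 n)) z + (levy_im rho xi \_ D2) z.

Let disjoint_D n z : z \in D1 n -> z \in D2 -> False.
Proof. by move=> /set_mem[_ /= zr] /set_mem /= zr2; move: zr; rewrite ltNge zr2. Qed.

Let h_le (g : V -> R) n z : `|(g \_ (D1 n)) z + (g \_ D2) z| <= `|g z|.
Proof.
rewrite !patchE; case: ifPn => z1; case: ifPn => z2; rewrite ?addr0 ?add0r ?normr0//.
by have := disjoint_D z1 z2.
Qed.

(** A point other than 0 eventually lies in exactly one of the two sets; the origin lies in neither,
    whence the condition on [g 0]. *)
Let h_cvg (g : V -> R) z : g 0 = 0 ->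
  (g \_ (D1 n)) z + (g \_ D2) z @[n --> \oo] --> g z.
Proof.
move=> g0; apply/cvgrPdist_le => e e0.
have [->|z0] := eqVneq z 0.
  apply: nearW => n; rewrite g0 sub0r normrN (le_trans (h_le g n 0))// g0 normr0 ltW//.
have nz : 0 < enorm z.
  rewrite sqrtr_gt0 lt_def dotp_ge0 andbT; apply/eqP => /dotp_eq0 zz.
  by rewrite zz eqxx in z0.
near=> n; rewrite (_ : _ + _ = g z) ?subrr ?normr0 ?ltW//.
have zn : n.+1%:R^-1 <= enorm z.
  rewrite -[leRHS]invrK lef_pV2 ?posrE ?invr_gt0//.
  near: n; exists (Num.truncn (enorm z)^-1) => // n/= xn.
  by rewrite (le_trans (ltW (truncnS_gt _)))// ler_nat.
rewrite !patchE; have [zr|zr] := ltP (enorm z) rho.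
  rewrite ifT ?inE//= ifF ?addr0//.
  by apply/negbTE/negP => /set_mem /= zr2; move: zr; rewrite ltNge zr2.
rewrite ifF ?add0r; last by apply/negbTE/negP => /set_mem[_ /=]; rewrite ltNge zr.
by rewrite ifT// inE.
Unshelve. all: by end_near. Qed.

Let exponent1 n xi :
  compound_exponent (M1 n) Z t xi + 'i%C * (dotp xi (- (t *: mean_jump (M1 n) Z)))%:C
  = t%:C * ((\int[N]_z (levy_re xi \_ (D1 n)) z) +i* (\int[N]_z (levy_im rho xi \_ (D1 n)) z)).
Proof.
have iZ := integrable_dotp (M1 n) mZ dotpZ xi.
have mdZ : measurable_fun setT (fun z => dotp xi (Z z)) by exact: measurable_dotp.
rewrite /compound_exponent dotpNr dotpZr -(Rintegral_dotp (M1 n) mZ dotpZ).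
have lamE : fine (M1 n setT) = \int[M1 n]_z 1 by rewrite Rintegral_cst_setT mul1r.
have reE : \int[N]_z (levy_re xi \_ (D1 n)) z = Re (char_fun (M1 n) Z xi) - fine (M1 n setT).
  rewrite Re_char_fun lamE -RintegralB//; last 2 first.
  - exact: integrable_cos_dotp.
  - exact: finite_measure_integrable_cst.
  rewrite (@Rintegral_mfrestr _ _ _ _ _ _ _ _ 2)//.
  - apply: eq_Rintegral => z _; rewrite !patchE; case: ifPn => // zD.
    by move: zD; rewrite inE => -[_ zr]; rewrite /Z zr scale1r.
  - by apply: measurable_funB => //; exact: measurable_cos_dotp.
  - move=> z; rewrite (le_trans (ler_normB _ _))// normr1.
    by have := normr_cos_le1 (dotp xi (Z z)); lra.
have imE : \int[N]_z (levy_im rho xi \_ (D1 n)) z =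
    Im (char_fun (M1 n) Z xi) - \int[M1 n]_z dotp xi (Z z).
  rewrite Im_char_fun -RintegralB//; last exact: integrable_sin_dotp.
  rewrite (@Rintegral_mfrestr _ _ _ _ _ _ _ _ (dotp xi xi * t))//.
  - apply: eq_Rintegral => z _; rewrite !patchE; case: ifPn => // zD.
    by move: zD; rewrite inE => -[_ zr]; rewrite /Z /levy_im zr scale1r mulr1.
  - by apply: measurable_funB => //; exact: measurable_sin_dotp.
  - move=> z; rewrite (le_trans (normr_sinB_le _))// (le_trans (dotp_cauchy _ _))//.
    by rewrite ler_wpM2l ?dotp_ge0.
rewrite reE imE; move: (char_fun _ _ _) (fine _) (\int[_]_u _) => c l i.
by apply: complexP; rewrite !(ReD, ImD, ReZ, ImZ, ReN, ImN, ReM, ImM)/=; ring.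
Qed.

Let exponent2 xi :
  compound_exponent M2 id t xi
  = t%:C * ((\int[N]_z (levy_re xi \_ D2) z) +i* (\int[N]_z (levy_im rho xi \_ D2) z)).
Proof.
have mid : measurable_fun setT (@id V) by [].
rewrite /compound_exponent.
have lamE : fine (M2 setT) = \int[M2]_z 1 by rewrite Rintegral_cst_setT mul1r.
have reE : \int[N]_z (levy_re xi \_ D2) z = Re (char_fun M2 id xi) - fine (M2 setT).
  rewrite Re_char_fun lamE -RintegralB//; last 2 first.
  - exact: integrable_cos_dotp.
  - exact: finite_measure_integrable_cst.
  rewrite (@Rintegral_mfrestr _ _ _ _ _ _ _ _ 2)//.
  - by apply: measurable_funB => //; exact: measurable_cos_dotp.
  - move=> z; rewrite (le_trans (ler_normB _ _))// normr1.
    by have := normr_cos_le1 (dotp xi z); lra.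
have imE : \int[N]_z (levy_im rho xi \_ D2) z = Im (char_fun M2 id xi).
  rewrite Im_char_fun (@Rintegral_mfrestr _ _ _ _ _ _ _ _ 1)//.
  - apply: eq_Rintegral => z _; rewrite !patchE; case: ifPn => // zD.
    by move: zD; rewrite inE /levy_im/= => zr; rewrite ltNge zr mulr0 subr0.
  - exact: measurable_sin_dotp.
  - by move=> z; exact: normr_sin_le1.
rewrite reE imE; move: (char_fun _ _ _) (fine _) => c l.
by apply: complexP; rewrite !(ReD, ImD, ReZ, ImZ, ReN, ImN, ReM, ImM)/=; ring.
Qed.

(** Jensen's inequality treats [D1 n], discarding treats [D2], and [K] bounds both costs uniformly
    in [n]. The annuli then exhaust the small jumps, by dominated convergence in the exponent. *)
Lemma lower_bounded_levy F a C : 0 <= C -> lower_bounded r F a C ->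
  lower_bounded r (fun xi => F xi * cexp (t%:C * levy_exponent (Num.sqrt t) xi)) a
    (C * expR (- ((4 * r)^-1 * (t * K))) * expR (- (2 * K))).
Proof.
move=> C0 lF.
pose E n xi : R[i] := (\int[N]_z hre n xi z) +i* (\int[N]_z him n xi z).
have cre xi : \int[N]_z hre n xi z @[n --> \oo] --> \int[N]_z levy_re xi z.
  apply: (@cvg_Rintegral_dominated _ _ _ _ _ _ (fun z => `|levy_re xi z|)).
  - by move=> n; apply: measurable_funD; apply: measurable_patch => //; exact: measurable_levy_re.
  - by move=> z; apply: h_cvg; rewrite /levy_re (_ : dotp xi 0 = 0) ?cos0 ?subrr// -(scale0r xi) dotpZr mul0r.
  - exact: integrable_norm (integrable_levy_re xi).
  - by move=> n z; exact: h_le.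
have cim xi : \int[N]_z him n xi z @[n --> \oo] --> \int[N]_z levy_im rho xi z.
  apply: (@cvg_Rintegral_dominated _ _ _ _ _ _ (fun z => `|levy_im rho xi z|)).
  - by move=> n; apply: measurable_funD; apply: measurable_patch => //; exact: measurable_levy_im.
  - by move=> z; apply: h_cvg; rewrite /levy_im (_ : dotp xi 0 = 0) ?sin0 ?mul0r ?subrr// -(scale0r xi) dotpZr mul0r.
  - exact: integrable_norm (integrable_levy_im xi rho0).
  - by move=> n z; exact: h_le.
have lE n : lower_bounded r (fun xi => F xi * cexp (t%:C * E n xi)) a
    (C * expR (- ((4 * r)^-1 * (t * K))) * expR (- (2 * K))).
  have l1 := lower_bounded_small (M := M1 n) mZ r0 (ltW t0) dotpZ C0 (variance n) lF.
  have C1 : 0 <= C * expR (- ((4 * r)^-1 * (t * K))) by rewrite mulr_ge0 ?expR_ge0.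
  have mid : measurable_fun setT (@id V) by [].
  have l2 := lower_bounded_big M2 mid r0 (ltW t0) C1 l1.
  have : C * expR (- ((4 * r)^-1 * (t * K))) * expR (- (2 * K)) <=
      C * expR (- ((4 * r)^-1 * (t * K))) * expR (- (2 * t * fine (M2 setT))).
    by rewrite ler_wpM2l// ler_expR lerN2 -mulrA ler_wpM2l.
  move=> /lower_bounded_le/(_ l2); congr (lower_bounded _ _ _ _); apply/funext => xi.
  rewrite -(mulrA (F xi)) -(mulrA (F xi)); congr (_ * _).
  rewrite -!cexpD exponent1 exponent2 -mulrDr; congr (cexp (_ * _)).
  rewrite /E /hre /him !RintegralD//; apply: integrable_patch => //.
  - exact: integrable_levy_im.
  - exact: integrable_levy_im.
  - exact: integrable_levy_re.
  - exact: integrable_levy_re.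
have cE xi : expR (t * Re (E n xi)) @[n --> \oo] --> expR (t * Re (levy_exponent rho xi)).
  apply: (cvg_comp _ expR); last exact: continuous_expR.
  by apply: cvgM; [exact: cvg_cst|exact: cre].
have ct xi : t * Im (E n xi) @[n --> \oo] --> t * Im (levy_exponent rho xi).
  by apply: cvgM; [exact: cvg_cst|exact: cim].
have cc xi : Re (cexp (t%:C * E n xi)) @[n --> \oo] --> Re (cexp (t%:C * levy_exponent rho xi)).
  under eq_fun do rewrite Re_cexp ReZ ImZ; rewrite Re_cexp ReZ ImZ.
  apply: cvgM; first exact: cE.
  by apply: (cvg_comp _ cos); [exact: ct|exact: continuous_cos].
have cs xi : Im (cexp (t%:C * E n xi)) @[n --> \oo] --> Im (cexp (t%:C * levy_exponent rho xi)).
  under eq_fun do rewrite Im_cexp ReZ ImZ; rewrite Im_cexp ReZ ImZ.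
  apply: cvgM; first exact: cE.
  by apply: (cvg_comp _ sin); [exact: ct|exact: continuous_sin].
apply: lower_bounded_cvg r0 lE _ _ => xi.
- under eq_fun do rewrite (ReM (F xi)); rewrite (ReM (F xi)).
  by apply: cvgB; apply: cvgM; [exact: cvg_cst|exact: cc|exact: cvg_cst|exact: cs].
- under eq_fun do rewrite (ImM (F xi)); rewrite (ImM (F xi)).
  by apply: cvgD; apply: cvgM; [exact: cvg_cst|exact: cs|exact: cvg_cst|exact: cc].
Qed.

End decomposition.

End levy_part.

(** * Recovering the continuous density *)

Section continuous_density_point.
Context {R : realType} {d : nat}.
Local Notation V := 'rV[R]_d.
Context (dO : measure_display) (Omega : measurableType dO) (P : probability Omega R)
  (X : Omega -> V) (q : V -> R).
Hypotheses (mX : measurable_fun setT X) (cq : continuous q) (q0 : forall x, 0 <= q x)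
  (Xq : forall B, measurable B ->
    P (X @^-1` B) = (\int[lebesgue_rV d]_(x in B) (q x)%:E)%E).

(** On [B] the law of [X] is at most [m] times Lebesgue measure, and the Gaussian has total mass
    [(pi / r)^(d / 2)]. *)
Let integral_near (r m : R) (x : V) (B : set V) : 0 < r -> 0 <= m -> measurable B ->
  (forall y, B y -> q y <= m) ->
  (\int[pushforward P X]_(y in B) (vgauss r (y - x))%:E <=
   (m * Num.sqrt (pi / r) ^+ d)%:E)%E.
Proof.
move=> r0 m0 mB qm.
have mg : measurable_fun setT (fun y : V => (vgauss r (y - x))%:E).
  apply/measurable_EFinP; apply: measurableT_comp; first exact: measurable_vgauss.
  exact: measurable_vB.
have mq : measurable_fun setT (fun y : V => (q y)%:E).
  apply/measurable_EFinP; apply: (measurability _ (RGenOpens.measurableE R)).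
  move=> _ [_ [a [b ->]] <-]; rewrite setTI; apply: open_measurable_mx.
  by apply: open_comp; [move=> + _; exact: cq | exact: interval_open].
pose law : {measure set V -> \bar R} := pushforward P X; pose PX := law mX.
pose m1 : {measure set V -> \bar R} := mrestr PX mB.
pose m2 : {measure set V -> \bar R} := mscale (NngNum m0) (@vlebesgue R d).
have m12 S : measurable S -> (m1 S <= m2 S)%E.
  move=> mS; rewrite /m1 /m2 /= /mrestr /mscale /=.
  have mSB : measurable (S `&` B) by exact: measurableI.
  rewrite [X in (X <= _)%E](Xq mSB).
  apply: (@le_trans _ _ (\int[@vlebesgue R d]_(y in S `&` B) m%:E)%E).
    apply: ge0_le_integral => //.
    - by move=> y _; rewrite lee_fin.
    - exact: measurable_funTS.
    - by move=> y [_ By]; rewrite lee_fin qm.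
  rewrite integral_cst// lee_wpmul2l ?lee_fin// le_measure ?inE//.
apply: (@le_trans _ _ (\int[m1]_(y in B) (vgauss r (y - x))%:E)%E).
  rewrite le_eqVlt; apply/orP; left; apply/eqP; apply: eq_measure_integral => S mS SB.
  by rewrite /m1 /= /mrestr setIidl.
apply: (le_trans (ge0_le_measure_integral m12 mB _ mg)).
  by move=> y; rewrite lee_fin vgauss_ge0.
rewrite ge0_integral_mscale//; last 2 first.
- exact: measurable_funTS.
- by move=> y _; rewrite lee_fin vgauss_ge0.
rewrite EFinM lee_wpmul2l ?lee_fin// -(integral_vgauss x r0).
by apply: ge0_subset_integral => // y _; rewrite lee_fin vgauss_ge0.
Qed.

Let integral_far (r e : R) (x : V) : 0 < r -> 0 < e ->
  (\int[pushforward P X]_(y in ~` ball x e) (vgauss r (y - x))%:E <=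
   (expR (- (r * e ^+ 2)))%:E)%E.
Proof.
move=> r0 e0.
have mB : measurable (ball x e) by apply: open_measurable_mx; exact: ball_open.
have mB' : measurable (~` ball x e) by exact: measurableC.
pose law : {measure set V -> \bar R} := pushforward P X; pose PX := law mX.
have mg : measurable_fun setT (fun y : V => (vgauss r (y - x))%:E).
  apply/measurable_EFinP; apply: measurableT_comp; first exact: measurable_vgauss.
  exact: measurable_vB.
apply: (@le_trans _ _ (\int[PX]_(y in ~` ball x e) (expR (- (r * e ^+ 2)))%:E)%E).
  apply: ge0_le_integral => //.
  - by move=> y _; rewrite lee_fin vgauss_ge0.
  - exact: measurable_funTS.
  - move=> y yB; rewrite lee_fin /vgauss ler_expR lerN2 ler_pM2l// leNgt.
    (* The ball is that of the max norm, so it contains the Euclidean ball of the same radius. *)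
    apply/negP => h; apply: yB; split => // i j; rewrite (ord1 i) /ball/=.
    rewrite -(@ltr_pXn2r _ 2)// ?nnegrE// ?ltW//.
    apply: le_lt_trans h; rewrite real_normK ?num_real//.
    by apply: le_trans (sqr_coord_le_dotp _ j); rewrite !mxE -sqrrN opprB.
rewrite integral_cst//; apply: (@le_trans _ _ ((expR (- (r * e ^+ 2)))%:E * 1)%E).
  rewrite lee_wpmul2l ?lee_fin ?expR_ge0//.
  apply: (@probability_le1 _ _ _ P (X @^-1` (~` ball x e))).
  by rewrite -[X in measurable X]setTI; exact: mX.
by rewrite mule1.
Qed.

(** From [exp m >= (m / (k + 1))^(k + 1)], one power more than needed, and [m <= m^2]. *)
Lemma exp_small (k : nat) (eta : R) : 0 < eta -> exists n0 : nat, forall n, (n0 <= n)%N ->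
  n.+1%:R ^+ k * expR (- n.+1%:R ^+ 2) < eta.
Proof.
move=> eta0; pose K : R := k.+1%:R ^+ k.+1.
exists (Num.truncn (K / eta)) => n Kn.
have n0 : 0 < n.+1%:R :> R by [].
have h1 : K / eta < n.+1%:R.
  by rewrite (lt_le_trans (truncnS_gt _))// ler_nat.
have h2 : (n.+1%:R / k.+1%:R) ^+ k.+1 <= expR (n.+1%:R : R).
  have -> : n.+1%:R = (n.+1%:R / k.+1%:R) * k.+1%:R :> R by rewrite divfK.
  rewrite expRM_natr ler_pXn2r ?nnegrE ?expR_ge0 ?divr_ge0//.
  by rewrite divfK// (le_trans _ (expR_ge1Dx _))// lerDr.
have h3 : n.+1%:R ^+ k * n.+1%:R <= K * expR (n.+1%:R : R).
  rewrite -exprSr; have := ler_wpM2l (exprn_ge0 k.+1 (ler0n R k.+1)) h2.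
  by rewrite -exprMn mulrC divfK.
have h4 : expR (- n.+1%:R ^+ 2) <= expR (- n.+1%:R : R).
  by rewrite ler_expR lerN2 ler_eXnr// ler1n.
apply: (@le_lt_trans _ _ (n.+1%:R ^+ k * expR (- n.+1%:R))).
  by rewrite ler_wpM2l// exprn_ge0.
rewrite expRN ltr_pdivrMr ?expR_gt0//.
rewrite -(ltr_pM2r n0); apply: (le_lt_trans h3).
rewrite mulrAC ltr_pM2r ?expR_gt0// mulrC -ltr_pdivrMr//.
Qed.

(** If [q x < c], take [m] halfway and a ball where [q <= m]. The inside contributes at most
    [m (pi / r)^(d / 2)], so the outside would be at least [(c - m) (pi / r)^(d / 2)]; yet it is at
    most [exp (- r e^2)]. *)
Lemma density_lower_bound (x : V) (c r1 : R) :
  (forall r, 0 < r -> r1 <= r ->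
    c * Num.sqrt (pi / r) ^+ d <= \int[P]_w vgauss r (X w - x)) ->
  c <= q x.
Proof.
move=> h; rewrite leNgt; apply/negP => qc.
pose m := (c + q x) / 2.
have qm : q x < m by rewrite /m ltr_pdivlMr// mulr2n mulrDr !mulr1; lra.
have mc : m < c by rewrite /m ltr_pdivrMr//; lra.
have m0 : 0 <= m by rewrite (le_trans (q0 x))// ltW.
have [e /= e0 eB] : exists2 e : R, 0 < e & forall y, ball x e y -> q y <= m.
  have mq : 0 < m - q x by rewrite subr_gt0.
  have /cvgrPdist_lt/(_ _ mq)/nbhs_ballP[e /= e0 eB] := @cq x.
  exists e => // y /eB /=; rewrite distrC => h'.
  by have := le_lt_trans (ler_norm _) h'; lra.
have mB : measurable (ball x e) by apply: open_measurable_mx; exact: ball_open.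
have main r : 0 < r -> r1 <= r -> (c - m) * Num.sqrt (pi / r) ^+ d <= expR (- (r * e ^+ 2)).
  move=> r0 rr; have := h r r0 rr.
  rewrite -lee_fin => hr; rewrite mulrBl lerBlDr -lee_fin.
  apply: (le_trans hr).
  have mg : measurable_fun setT (fun y : V => vgauss r (y - x)).
    apply: measurableT_comp; first exact: measurable_vgauss.
    exact: measurable_vB.
  have -> : (\int[P]_w vgauss r (X w - x))%:E =
      (\int[pushforward P X]_y (vgauss r (y - x))%:E)%E.
    rewrite ge0_integral_pushforward//; last 2 first.
    - exact/measurable_EFinP.
    - by move=> y _; rewrite lee_fin vgauss_ge0.
    rewrite /Rintegral fineK//; apply: integrable_fin_num => //.
    apply: (@integrable_bounded _ _ _ P (fun w => vgauss r (X w - x)) 1).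
      exact: measurableT_comp mg mX.
    move=> w; rewrite ger0_norm ?vgauss_ge0// -[leRHS]expR0 ler_expR oppr_le0.
    by rewrite mulr_ge0 ?dotp_ge0// ltW.
  pose law : {measure set V -> \bar R} := pushforward P X; pose PX := law mX.
  rewrite -(setUv (ball x e)) -/PX ge0_integral_setU//; last 4 first.
  - exact: measurableC.
  - by apply/measurable_EFinP; exact: measurable_funTS.
  - by move=> y _; rewrite lee_fin vgauss_ge0.
  - by apply/disj_setPS; rewrite setICr.
  by rewrite addrC EFinD leeD// ?integral_near ?integral_far.
pose eta := (c - m) * (Num.sqrt pi * e) ^+ d.
have eta0 : 0 < eta by rewrite mulr_gt0 ?subr_gt0// exprn_gt0// mulr_gt0// sqrtr_gt0 pi_gt0.
have [n0 hn0] := @exp_small d _ eta0.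
(* With [r = ((n + 1) / e)^2] the two sides of [main] are [eta / (n + 1)^d] and [exp (- (n + 1)^2)];
   the second argument of the maximum ensures [r1 <= r]. *)
pose n := maxn n0 (Num.truncn (`|r1| * e ^+ 2)).
have nn : 0 < n.+1%:R :> R by [].
have nr : r1 <= (n.+1%:R / e) ^+ 2.
  rewrite (le_trans (ler_norm _))// expr_div_n ler_pdivlMr ?exprn_gt0//.
  rewrite (@le_trans _ _ n.+1%:R)//; last by rewrite ler_eXnr// ler1n.
  by rewrite (le_trans (ltW (truncnS_gt _)))// ler_nat ltnS leq_maxr.
have r0 : 0 < (n.+1%:R / e) ^+ 2 by rewrite exprn_gt0// divr_gt0.
have := main _ r0 nr.
have -> : (n.+1%:R / e) ^+ 2 * e ^+ 2 = n.+1%:R ^+ 2.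
  by rewrite -exprMn divfK// gt_eqF.
have -> : Num.sqrt (pi / (n.+1%:R / e) ^+ 2) = Num.sqrt pi * e / n.+1%:R.
  rewrite -exprVn sqrtrM ?pi_ge0// sqrtr_sqr ger0_norm ?invr_ge0 ?divr_ge0 ?ltW//.
  by rewrite invf_div mulrA.
rewrite expr_div_n mulrA -/eta ler_pdivrMr ?exprn_gt0// mulrC leNgt.
by rewrite hn0// leq_maxl.
Qed.

End continuous_density_point.

(** * The characteristic exponent and the scaling condition *)

Section exponent.
Context {R : realType} {d : nat}.
Local Open Scope complex_scope.
Local Notation Re := complex.Re.
Local Notation Im := complex.Im.
Local Notation V := 'rV[R]_d.
Variables (A : 'M[R]_d) (N : {measure set V -> \bar R}) (b : V).
Hypothesis levyN : levy_measure N.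
Implicit Types (x y u xi z : V).

Lemma Re_char_exponent xi :
  Re (char_exponent A N b xi) = dotp xi (xi *m A) - \int[N]_z levy_re xi z.
Proof.
rewrite /char_exponent !ReD !ReN Re_iZ oppr0 addr0; congr (_ - _).
apply: eq_Rintegral => z _.
by rewrite !ReD !ReN Re_cexp_i Re_iZ oppr0 addr0.
Qed.

Lemma Im_char_exponent xi :
  Im (char_exponent A N b xi) = - dotp xi b - \int[N]_z levy_im 1 xi z.
Proof.
rewrite /char_exponent !ImD !ImN Im_iZ (_ : Im (dotp xi (xi *m A))%:C = 0)// add0r; congr (_ - _).
apply: eq_Rintegral => z _.
by rewrite !ImD !ImN Im_cexp_i Im_iZ (_ : Im 1 = 0)// oppr0 addr0.
Qed.

(** The integral in [drift] is the difference of the compensators cut at [rho] and at 1. Its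
    integrand lives between these two radii, so [levy_weight] dominates it. *)
Lemma dotp_drift (rho : R) xi : 0 < rho ->
  dotp xi (drift N b rho) = dotp xi b + \int[N]_z levy_im 1 xi z - \int[N]_z levy_im rho xi z.
Proof.
move=> rho0.
pose g i z : R := z ord0 i * ((enorm z < rho)%R%:R - (enorm z < 1)%R%:R).
have gi i : N.-integrable setT (EFin \o g i).
  apply: (@integrable_levy _ _ _ levyN _ ((1 + rho) * (1 + rho ^- 2))).
    apply: measurable_funM; first exact: measurable_coord.
    by apply: measurable_funB; exact: measurable_truncation.
  move=> z; rewrite /g normrM.
  have zi := normr_coord_le_enorm z i.
  have r1 : 0 < rho ^- 2 by rewrite invr_gt0 exprn_gt0.
  have r3 : rho ^- 2 * rho ^+ 2 = 1 by rewrite mulVf// gt_eqF// exprn_gt0.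
  have C0 : 0 <= (1 + rho) * (1 + rho ^- 2) by rewrite mulr_ge0//; lra.
  have w0 := levy_weight_ge0 z.
  have rr : 0 < rho * rho ^- 2 by rewrite mulr_gt0.
  case: (ltP (enorm z) rho) => zr; case: (ltP (enorm z) 1) => z1 /=;
    rewrite ?subrr ?normr0 ?mulr0 ?(mulr_ge0 C0 w0)//.
  - rewrite subr0 normr1 mulr1 (le_trans zi)// (le_trans (ltW zr))//.
    have -> : levy_weight z = 1.
      by apply/min_idPl; rewrite -[leLHS](expr1n _ 2) ler_sqr ?nnegrE ?enorm_ge0.
    by rewrite mulr1; lra.
  - rewrite sub0r normrN normr1 mulr1 (le_trans zi)// (le_trans (ltW z1))//.
    have zz : rho ^+ 2 <= levy_weight z.
      rewrite /levy_weight le_min; apply/andP; split.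
        by rewrite -[leRHS](expr1n _ 2) ler_sqr ?nnegrE//; lra.
      by rewrite ler_sqr ?nnegrE ?enorm_ge0//; lra.
    have e1 : 1 <= rho ^- 2 * levy_weight z by rewrite -r3 ler_pM2l.
    rewrite (le_trans e1)// ler_wpM2r//; lra.
rewrite /drift dotpDr -addrA; congr (_ + _).
rewrite -RintegralB//; last 2 first.
- exact: integrable_levy_im.
- exact: integrable_levy_im.
transitivity (\int[N]_z (\sum_(i < d) xi ord0 i * g i z)).
  rewrite Rintegral_sum; last by move=> i; exact: integrableZl_EFin.
  by rewrite /dotp; apply: eq_bigr => i _; rewrite mxE RintegralZl.
apply: eq_Rintegral => z _; rewrite /levy_im /g.
transitivity (dotp xi z * ((enorm z < rho)%R%:R - (enorm z < 1)%R%:R)); last by ring.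
by rewrite /dotp mulr_suml; apply: eq_bigr => i _; rewrite mulrA.
Qed.

(** With the compensator cut at [sqrt t], what is left of the drift is the translation that appears
    in the theorem. *)
Lemma cexp_char_exponent (t : R) xi : 0 < t ->
  cexp (- (t%:C * char_exponent A N b xi)) =
  (expR (- (t * dotp xi (xi *m A))))%:C * cexp (t%:C * levy_exponent N (Num.sqrt t) xi)
    * cexp ('i%C * (dotp xi (t *: drift N b (Num.sqrt t)))%:C).
Proof.
move=> t0.
have -> : (expR (- (t * dotp xi (xi *m A))))%:C = cexp (- (t * dotp xi (xi *m A)))%:C.
  by apply: complexP; rewrite ?Re_cexp ?Im_cexp/= ?cos0 ?sin0 ?mulr1 ?mulr0.
rewrite -!cexpD; congr cexp; rewrite dotpZr dotp_drift ?sqrtr_gt0//.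
apply: complexP.
  rewrite ReN ReZ Re_char_exponent !ReD ReZ Re_iZ.
  rewrite (_ : Re (- (t * dotp xi (xi *m A)))%:C = - (t * dotp xi (xi *m A)))//.
  rewrite (_ : Re (levy_exponent N (Num.sqrt t) xi) = \int[N]_z levy_re xi z)//.
  by ring.
rewrite ImN ImZ Im_char_exponent !ImD ImZ Im_iZ.
rewrite (_ : Im (- (t * dotp xi (xi *m A)))%:C = 0)//.
rewrite (_ : Im (levy_exponent N (Num.sqrt t) xi) = \int[N]_z levy_im (Num.sqrt t) xi z)//.
by ring.
Qed.

Lemma ler_quadratic x : dotp x (x *m A) <= dotp x x * \sum_(i < d) \sum_(j < d) `|A j i|.
Proof.
rewrite {1}/dotp mulr_sumr; apply: ler_sum => i _.
rewrite mxE mulr_sumr mulr_sumr; apply: ler_sum => j _.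
rewrite (le_trans (ler_norm _))// mulrA !normrM ler_wpM2r//.
by rewrite -enorm2 expr2 ler_pM// normr_coord_le_enorm.
Qed.

(** [sup] bounds the members of a set only when the set is bounded above; the explicit bound on the
    ball supplies this. *)
Lemma Re_char_exponent_le_sup x y : enorm y <= enorm x ->
  Re (char_exponent A N b y) <= char_exponent_sup A N b (enorm x).
Proof.
move=> yx; apply: ub_le_sup; last by exists y.
exists (enorm x ^+ 2 * \sum_(i < d) \sum_(j < d) `|A j i|
  + (2 + enorm x ^+ 2) * \int[N]_z levy_weight z) => _ [z zx <-].
rewrite /= in zx; rewrite Re_char_exponent.
have zz : dotp z z <= enorm x ^+ 2 by rewrite -enorm2 ler_sqr ?nnegrE ?enorm_ge0.
have S0 : 0 <= \sum_(i < d) \sum_(j < d) `|A j i|.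
  by apply: sumr_ge0 => i _; apply: sumr_ge0.
rewrite lerD//; first by rewrite (le_trans (ler_quadratic _))// ler_wpM2r.
rewrite (le_trans (ler_norm _))// normrN.
have il := integrable_levy_re levyN z.
rewrite (le_trans (le_normr_Rintegral measurableT il))//.
rewrite -RintegralZl//; last exact: integrable_levy_weight.
apply: le_Rintegral => //.
- exact: integrable_norm il.
- by apply: integrableZl_EFin; exact: integrable_levy_weight.
- move=> w _; rewrite (le_trans (levy_re_le _ _))// ler_wpM2r ?levy_weight_ge0//.
  by rewrite lerD2l.
Qed.

(** The rescaled jump integrand is at most [2 / n^2], so it tends to 0 pointwise, and
    [(2 + |u|^2) levy_weight] dominates it. *)
Lemma cvg_Re_char_exponent u :
  Re (char_exponent A N b (n.+1%:R *: u)) / n.+1%:R ^+ 2 @[n --> \oo] --> dotp u (u *m A).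
Proof.
have e n : Re (char_exponent A N b (n.+1%:R *: u)) / n.+1%:R ^+ 2 =
    dotp u (u *m A) - \int[N]_z (n.+1%:R ^- 2 * levy_re (n.+1%:R *: u) z).
  rewrite Re_char_exponent RintegralZl//; last exact: integrable_levy_re.
  by rewrite -scalemxAl dotpZl dotpZr; field.
under eq_fun do rewrite e.
suff h0 : \int[N]_z (n.+1%:R ^- 2 * levy_re (n.+1%:R *: u) z) @[n --> \oo] --> (0 : R).
  have h1 : dotp u (u *m A) - \int[N]_z (n.+1%:R ^- 2 * levy_re (n.+1%:R *: u) z) @[n --> \oo]
      --> dotp u (u *m A) - 0 by apply: cvgB; [exact: cvg_cst|exact: h0].
  by rewrite subr0 in h1.
have -> : 0 = \int[N]_z (0 : R) by rewrite Rintegral_cst// mul0r.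
apply: (@cvg_Rintegral_dominated _ _ _ _ _ _ (fun z => (2 + dotp u u) * levy_weight z)).
- by move=> n; apply: measurable_funM => //; exact: measurable_levy_re.
- move=> z; apply: (@cvg_le_inv _ _ _ 2) => n; rewrite subr0 normrM.
  have n0 : 0 < n.+1%:R :> R by [].
  rewrite ger0_norm ?invr_ge0 ?exprn_ge0// mulrC.
  have l2 : `|levy_re (n.+1%:R *: u) z| <= 2.
    rewrite (le_trans (ler_normB _ _))// normr1.
    by have := normr_cos_le1 (dotp (n.+1%:R *: u) z); lra.
  rewrite ler_pM// ?invr_ge0 ?exprn_ge0// lef_pV2 ?posrE ?exprn_gt0//.
  by rewrite ler_eXnr// ler1n.
- by apply: integrableZl_EFin; exact: integrable_levy_weight.
- move=> n z; have n0 : 0 < n.+1%:R :> R by [].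
  rewrite normrM ger0_norm ?invr_ge0 ?exprn_ge0//.
  rewrite mulrC ler_pdivrMr ?exprn_gt0// (le_trans (levy_re_le _ _))//.
  rewrite [leRHS]mulrAC ler_wpM2r ?levy_weight_ge0// dotpZl dotpZr.
  have : 1 <= n.+1%:R ^+ 2 :> R by rewrite exprn_ege1// ler1n.
  by have := dotp_ge0 u; rewrite expr2; nra.
Qed.

Lemma enormZ (a : R) u : 0 <= a -> enorm (a *: u) = a * enorm u.
Proof.
move=> a0; rewrite /enorm dotpZl dotpZr mulrA -expr2 sqrtrM ?sqr_ge0//.
by rewrite sqrtr_sqr ger0_norm.
Qed.

Lemma quadraticZ (a : R) u : dotp (a *: u) ((a *: u) *m A) = a ^+ 2 * dotp u (u *m A).
Proof. by rewrite -scalemxAl dotpZl dotpZr mulrA. Qed.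

(** At radius [n] the condition bounds [Re Psi (n u)] from below by [c3] times a supremum over the
    ball, hence by [c3 Re Psi (n y)]; division by [n^2] leaves the Gaussian forms in the limit. *)
Lemma scaling_quadratic (T3 : \bar R) (c3 alpha3 : R) y u : (0 < T3)%E -> 0 < c3 ->
  scaling_condition A N b T3 c3 alpha3 -> enorm y = 1 -> enorm u = 1 ->
  c3 * dotp y (y *m A) <= dotp u (u *m A).
Proof.
move=> T30 c30 [sc _] y1 u1.
have [M hM] : exists M : R, (T3^-1 <= M%:E)%E.
  case: T3 T30 {sc} => [T3| |]// T30.
    exists T3^-1; rewrite inver gt_eqF//.
  by exists 0; rewrite invey.
have cy : c3 * (Re (char_exponent A N b (n.+1%:R *: y)) / n.+1%:R ^+ 2) @[n --> \oo]
    --> c3 * dotp y (y *m A).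
  by apply: cvgM; [exact: cvg_cst|exact: cvg_Re_char_exponent].
have cu := @cvg_Re_char_exponent u.
apply: (ler_cvg_to cy cu); near=> n.
have n0 : 0 < n.+1%:R :> R by [].
rewrite mulrA ler_pM2r ?invr_gt0 ?exprn_gt0//.
have eu : enorm (n.+1%:R *: u) = n.+1%:R by rewrite enormZ// u1 mulr1.
have ey : enorm (n.+1%:R *: y) = n.+1%:R by rewrite enormZ// y1 mulr1.
apply: le_trans (sc _ _); last first.
  rewrite eu (le_lt_trans hM)// lte_fin.
  near: n; exists (Num.truncn `|M|) => // n/= Mn.
  by rewrite (le_lt_trans (ler_norm _))// (lt_le_trans (truncnS_gt _))// ler_nat.
rewrite ler_pM2l//; apply: Re_char_exponent_le_sup.
by rewrite eu ey.
Unshelve. all: by end_near. Qed.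

(** By polarization a nonzero symmetric form is nonzero in some direction; [scaling_quadratic]
    carries its positive value there to all others. *)
Lemma scaling_posdef (T3 : \bar R) (c3 alpha3 : R) : A^T = A -> psd A -> A != 0 ->
  (0 < T3)%E -> 0 < c3 -> scaling_condition A N b T3 c3 alpha3 ->
  exists2 l : R, 0 < l & forall u, l * dotp u u <= dotp u (u *m A).
Proof.
move=> sA pA A0 T30 c30 sc.
have [y yA] : exists y, 0 < dotp y (y *m A).
  apply: contrapT => h; move/eqP: A0; apply.
  have q0 y : dotp y (y *m A) = 0.
    apply/eqP; rewrite eq_le pA andbT leNgt; apply/negP => yA; apply: h.
    by exists y.
  apply/matrixP => i j; rewrite mxE.
  have := quadratic_delta j (delta_mx ord0 i) 1 sA; rewrite /= !q0.
  have Ajj : A j j = 0.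
    by have := q0 (delta_mx ord0 j); rewrite dotp_delta -rowE mxE.
  rewrite Ajj -rowE mxE; lra.
have normalize x : x != 0 -> 0 < enorm x /\ enorm ((enorm x)^-1 *: x) = 1.
  move=> x0; have ex : 0 < enorm x.
    rewrite sqrtr_gt0 lt_def dotp_ge0 andbT; apply/eqP => /dotp_eq0 xx.
    by rewrite xx eqxx in x0.
  by rewrite enormZ ?invr_ge0 ?ltW// mulVf// gt_eqF.
have y0 : y != 0.
  apply/eqP => yy; move: yA; rewrite yy /dotp big1 ?ltxx// => i _.
  by rewrite mxE mul0r.
have [ey y1] := normalize y y0.
set y' := (enorm y)^-1 *: y in y1.
have y'A : 0 < dotp y' (y' *m A).
  by rewrite /y' -scalemxAl dotpZl dotpZr !mulr_gt0 ?invr_gt0.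
exists (c3 * dotp y' (y' *m A)) => [|u]; first by rewrite mulr_gt0.
have [->|u0] := eqVneq u 0.
  rewrite mul0mx (_ : dotp 0 0 = 0) ?mulr0// /dotp big1// => i _.
  by rewrite mxE mul0r.
have [eu u1] := normalize u u0.
have := scaling_quadratic T30 c30 sc y1 u1.
rewrite (quadraticZ (enorm u)^-1) -enorm2 => h.
have eu2 : 0 < enorm u ^+ 2 by rewrite exprn_gt0.
rewrite -ler_pdivlMr// (le_trans h)// le_eqVlt; apply/orP; left; apply/eqP.
by field; rewrite gt_eqF.
Qed.

End exponent.

(** * The lower bound *)

Section assembly.
Context {R : realType} {d : nat}.
Local Open Scope complex_scope.
Local Notation V := 'rV[R]_d.

(** A Gaussian factor of the symbol moves into the weight; the constant is the quotient of the two
    normalizations. *)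
Lemma fourier_gauss_split (r s : R) (F : V -> R[i]) x : 0 < r -> 0 <= s ->
  fourier_gauss r (fun xi => (expR (- (s * dotp xi xi)))%:C * F xi) x =
  Num.sqrt (r / (r + s)) ^+ d * fourier_gauss (r + s) F x.
Proof.
move=> r0 s0; have rs : 0 < r + s by rewrite ltr_wpDr.
rewrite /fourier_gauss mulrA -exprMn -sqrtrM; last by rewrite divr_ge0// ltW.
rewrite (_ : r / (r + s) * ((r + s) / pi) = r / pi); last first.
  by rewrite mulrA divfK// gt_eqF.
congr (_ * _); apply: eq_Rintegral => xi _.
have -> : vgauss (r + s) xi = expR (- (s * dotp xi xi)) * vgauss r xi.
  by rewrite /vgauss -expRD; congr expR; ring.
by rewrite /fkernel ReZ ImZ; ring.
Qed.

(** For finite [T], [min (t, |z|^2) <= (1 + T) min (1, |z|^2)]; for infinite [T] the second moment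
    of [N] is the bound. *)
Lemma levy_small_time_le (N : {measure set V -> \bar R}) (T : \bar R) :
  levy_measure N -> (0 < T)%E ->
  (T = +oo%E -> (\int[N]_x (enorm x ^+ 2)%:E < +oo)%E) ->
  exists2 K : R, 0 <= K & forall t, 0 < t -> (t%:E < T)%E ->
    (\int[N]_z (Num.min t (enorm z ^+ 2))%:E <= K%:E)%E.
Proof.
move=> levyN T0 NT.
have m2 : measurable_fun setT (fun z : V => (enorm z ^+ 2)%:E).
  by apply/measurable_EFinP; apply: measurable_funX; exact: measurable_enorm.
have mt t : measurable_fun setT (fun z : V => (Num.min t (enorm z ^+ 2))%:E).
  apply/measurable_EFinP; apply: measurable_minr => //.
  by apply: measurable_funX; exact: measurable_enorm.
have min0 t (z : V) : 0 < t -> 0 <= Num.min t (enorm z ^+ 2).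
  by move=> t0; rewrite le_min ltW//= sqr_ge0.
case: T T0 NT => [T| |]// T0 NT; last first.
  have fin : (\int[N]_x (enorm x ^+ 2)%:E \is a fin_num)%E.
    rewrite ge0_fin_numE; first exact: NT.
    by apply: integral_ge0 => z _; rewrite lee_fin sqr_ge0.
  exists (fine (\int[N]_x (enorm x ^+ 2)%:E)%E).
    by rewrite fine_ge0// integral_ge0// => z _; rewrite lee_fin sqr_ge0.
  move=> t t0 _; rewrite fineK//; apply: ge0_le_integral => //.
  - by move=> z _; rewrite lee_fin min0.
  - by move=> z _; rewrite lee_fin ge_min lexx orbT.
have W0 : 0 <= \int[N]_z levy_weight z.
  by apply: Rintegral_ge0 => z _; exact: levy_weight_ge0.
have T0' : 0 < T by rewrite -lte_fin.
exists ((1 + T) * \int[N]_z levy_weight z); first by rewrite mulr_ge0//; lra.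
move=> t t0; rewrite lte_fin => tT.
have iW := integrableZl_EFin (1 + T) (integrable_levy_weight levyN).
have il := integrable_levy_weight levyN.
rewrite -RintegralZl// /Rintegral fineK; last exact: integrable_fin_num.
apply: ge0_le_integral => //.
- by move=> z _; rewrite lee_fin min0.
- exact: measurable_int iW.
- move=> z _; rewrite lee_fin /levy_weight; have z2 := sqr_ge0 (enorm z).
  case: (leP 1 (enorm z ^+ 2)) => z1; first by rewrite mulr1 ge_min; apply/orP; left; lra.
  rewrite ge_min; apply/orP; right.
  by rewrite ler_peMl//; lra.
Qed.

Lemma powR_sqrt (t : R) : 0 < t -> t `^ (- (d%:R / 2)) = (Num.sqrt t)^-1 ^+ d.
Proof.
move=> t0; rewrite powRN exprVn; congr (_^-1).
by rewrite mulrC powRrM powR12_sqrt ?ltW// powR_mulrn// sqrtr_ge0.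
Qed.

End assembly.

Theorem proposition5p2 (R : realType) (d : nat) (A : 'M[R]_d)
    (N : {measure set 'rV[R]_d -> \bar R}) :
  (0 < d)%N ->
  generating_triplet A N ->
  concentration A N r @[r --> 0^'+] --> +oo%E ->
  A != 0 ->
  forall (T : \bar R) (theta : R), (0 < T)%E -> 0 < theta ->
  (T = +oo%E -> (\int[N]_x (enorm x ^+ 2)%:E < +oo)%E) ->
  exists2 c : R, 0 < c &
    forall (b : 'rV[R]_d) (T3 : \bar R) (c3 alpha3 : R),
      (0 < T3)%E -> 0 < c3 <= 1 -> 0 < alpha3 <= 2 ->
      scaling_condition A N b T3 c3 alpha3 ->
    forall (dO : measure_display) (Omega : measurableType dO)
      (P : probability Omega R) (Y : R -> Omega -> 'rV[R]_d)
      (p : R -> 'rV[R]_d -> R),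
      levy_process P Y -> has_triplet P Y A N b -> continuous_density P Y p ->
    forall (t : R) (x : 'rV[R]_d),
      0 < t -> (t%:E < T)%E -> enorm x <= theta * Num.sqrt t ->
      c * t `^ (- (d%:R / 2)) <= p t (x + t *: drift N b (Num.sqrt t)).
Proof.
move=> _ [sA pA levyN] _ A0 T theta T0 theta0 NT.
(* [l] is fixed before [b], [T3], [c3] and [alpha3], so that the constant depends on none of them.
   Without such an [l] no scaling condition can hold, and any constant will do. *)
have [[l l0 lA]|noA] := pselect (exists2 l : R, 0 < l &
    forall u, l * dotp u u <= dotp u (u *m A)); last first.
  exists 1 => // b T3 c3 alpha3 T30 /andP[c30 _] _ sc.
  by exfalso; apply: noA; exact: (scaling_posdef levyN sA pA A0 T30 c30 sc).
pose A' := A - l%:M.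
have quadA' u : dotp u (u *m A') = dotp u (u *m A) - l * dotp u u.
  by rewrite /A' mulmxBr mul_mx_scalar dotpBr dotpZr.
have sA' : A'^T = A' by rewrite /A' linearB/= sA tr_scalar_mx.
have pA' : psd A' by move=> u; rewrite quadA' subr_ge0.
have [vs vsE] := psd_cholesky sA' pA'.
(* The trace of [A']. *)
pose S := \sum_(v <- vs) dotp v v.
have S0 : 0 <= S by apply: sumr_ge0 => v _; exact: dotp_ge0.
have [K K0 NK] := levy_small_time_le levyN T0 NT.
(* As [r >= t l], the Jensen costs [(2 t S + t K) / (4 r)] are at most the first exponent; the
   second factor pays for the discarded jumps. *)
pose C0 := expR (- ((2 * S + K) / (4 * l))) * expR (- (2 * K)).
have C00 : 0 < C0 by rewrite mulr_gt0 ?expR_gt0.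
pose c1 := C0 * expR (- (theta ^+ 2 / (4 * l))).
have c10 : 0 < c1 by rewrite mulr_gt0 ?expR_gt0.
(* The 8 combines [pi / R' = 4 pi s] with [r <= 2 t l], for the [R'], [s] and [r] introduced
   below. *)
exists (Num.sqrt (8 * pi * l)^-1 ^+ d * c1).
  by rewrite mulr_gt0// exprn_gt0// sqrtr_gt0 invr_gt0 !mulr_gt0// pi_gt0.
move=> b T3 c3 alpha3 T30 _ _ _ dO Omega P Y p [mY _ _ _ _ _] tripY densY t x t0 tT xt.
have [cp p0 pE] := densY t t0.
have mYt := mY t (ltW t0).
set m := t *: drift N b (Num.sqrt t).
(* The threshold [R' >= 1 / (4 t l)] means [s <= t l], whence [r <= 2 t l]. *)
apply: (@density_lower_bound _ _ _ _ P (Y t) (p t) mYt cp p0 pE _ _ (4 * (t * l))^-1).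
move=> R' R'0 hR'.
have tl0 : 0 < t * l by rewrite mulr_gt0.
pose s := (4 * R')^-1.
have s0 : 0 < s by rewrite invr_gt0 mulr_gt0.
have stl : s <= t * l.
  rewrite /s invf_ple ?posrE ?mulr_gt0//.
  have -> : (t * l)^-1 = 4 * (4 * (t * l))^-1 by field; rewrite !gt_eqF.
  by rewrite ler_pM2l.
have R'E : R' = (4 * s)^-1 by rewrite /s; field; rewrite gt_eqF.
pose r := s + t * l.
have r0 : 0 < r by rewrite addr_gt0.
have kr : (4 * r)^-1 <= (4 * (t * l))^-1.
  by rewrite lef_pV2 ?posrE ?mulr_gt0// ler_pM2l// lerDr ltW.
have kr0 : 0 <= (4 * r)^-1 by rewrite invr_ge0 mulr_ge0// ltW.
pose chi xi : R[i] := ((expR (- (t * dotp xi (xi *m A'))))%:C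
  * cexp (t%:C * levy_exponent N (Num.sqrt t) xi) * cexp ('i%C * (dotp xi m)%:C))%C.
have chi_low : lower_bounded r chi m C0.
  have l1 := lower_bounded_squares vs r0 (ltW t0) ler01 (lower_bounded1 r0).
  have C1 : 0 <= 1 * expR (- ((4 * r)^-1 * (2 * t * \sum_(v <- vs) dotp v v))).
    by rewrite mul1r expR_ge0.
  have l4 := lower_bounded_shift m (lower_bounded_levy levyN r0 t0 (NK t t0 tT) C1 l1).
  have chiE : (fun xi => 1 * (expR (- (t * \sum_(v <- vs) dotp xi v ^+ 2)))%:C *
       cexp (t%:C * levy_exponent N (Num.sqrt t) xi) * cexp ('i%C * (dotp xi m)%:C))%C = chi.
    by apply/funext => xi; rewrite /chi vsE mul1r.
  rewrite chiE add0r in l4.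
  apply: lower_bounded_le l4.
  rewrite mul1r -expRD /C0 ler_wpM2r ?expR_ge0// ler_expR -opprD lerN2.
  apply: (@le_trans _ _ ((4 * (t * l))^-1 * (2 * t * S + t * K))).
    by rewrite -mulrDr ler_wpM2r// addr_ge0 ?mulr_ge0// ltW.
  by rewrite le_eqVlt; apply/orP; left; apply/eqP; field; rewrite !gt_eqF.
have charY : char_fun P (Y t) = fun xi => ((expR (- (t * l * dotp xi xi)))%:C * chi xi)%C.
  apply/funext => xi; rewrite /char_fun tripY ?ltW// cexp_char_exponent//.
  have -> : expR (- (t * dotp xi (xi *m A))) =
      expR (- (t * l * dotp xi xi)) * expR (- (t * dotp xi (xi *m A'))).
    by rewrite -expRD quadA'; congr expR; ring.
  rewrite /chi rmorphM/= -mulrA.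
  by move: (cexp _) (cexp _) => e1 e2; rewrite -!mulrA.
(* The test Gaussian is [fourier_gauss s] of the symbol 1. Averaging it over the law of [Y t]
   multiplies the symbol by [char_fun P (Y t)], whose isotropic factor then moves into the
   weight. *)
have key : \int[P]_w vgauss R' (Y t w - (x + m)) =
    Num.sqrt (s / r) ^+ d * fourier_gauss r chi (x + m).
  rewrite -(fourier_gauss_split chi (x + m) s0 (ltW tl0)) -charY.
  rewrite -[char_fun P (Y t)]/(fun xi => char_fun P (Y t) xi).
  under [in RHS]eq_fun do rewrite -[char_fun _ _ _]mul1r.
  rewrite -(Rintegral_fourier_gauss P mYt (x + m) s0 (@bounded_symbol1 R d)).
  apply: eq_Rintegral => w _; rewrite fourier_gauss_cst1// -R'E /vgauss.
  by rewrite dotpBB (dotpBB (x + m)) (dotpC (Y t w)); congr expR; ring.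
rewrite key powR_sqrt//.
apply: (@le_trans _ _ (Num.sqrt (s / r) ^+ d * c1)); last first.
  rewrite ler_wpM2l ?exprn_ge0 ?sqrtr_ge0//.
  apply: le_trans (chi_low.2 (x + m)); rewrite addrK /c1 ler_wpM2l ?(ltW C00)//.
  rewrite /vgauss ler_expR lerN2 -enorm2.
  apply: (@le_trans _ _ ((4 * (t * l))^-1 * (theta * Num.sqrt t) ^+ 2)).
    rewrite ler_pM ?sqr_ge0// ler_sqr ?nnegrE ?enorm_ge0//.
    by rewrite mulr_ge0 ?sqrtr_ge0// ltW.
  rewrite exprMn sqr_sqrtr; last exact: ltW.
  rewrite le_eqVlt; apply/orP; left; apply/eqP; field.
  by rewrite !gt_eqF.
have rt : r <= 2 * (t * l) by rewrite /r; lra.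
have h : Num.sqrt (8 * pi * l)^-1 * (Num.sqrt t)^-1 * Num.sqrt (pi / R') <= Num.sqrt (s / r).
  have pi0 := pi_gt0 R.
  have a0 : 0 <= (8 * pi * l)^-1 by rewrite invr_ge0 !mulr_ge0// ltW.
  have a1 : 0 <= (8 * pi * l)^-1 * t^-1 by rewrite mulr_ge0// invr_ge0 ltW.
  rewrite -sqrtrV; last exact: ltW.
  rewrite -sqrtrM// -sqrtrM// ler_wsqrtr//.
  have -> : (8 * pi * l)^-1 * t^-1 * (pi / R') = s / (2 * (t * l)).
    rewrite R'E; move: pi0; move: (pi : R) => q q0; field.
    by rewrite !gt_eqF.
  by rewrite ler_wpM2l ?(ltW s0)// lef_pV2 ?posrE// mulr_gt0.
have -> : Num.sqrt (8 * pi * l)^-1 ^+ d * c1 * (Num.sqrt t)^-1 ^+ d * Num.sqrt (pi / R') ^+ d =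
    (Num.sqrt (8 * pi * l)^-1 * (Num.sqrt t)^-1 * Num.sqrt (pi / R')) ^+ d * c1.
  rewrite !exprMn; move: (c1) (Num.sqrt _ ^+ d) (_^-1 ^+ d) (Num.sqrt _ ^+ d) => k u v w.
  by ring.
rewrite ler_wpM2r ?(ltW c10)// lerXn2r ?nnegrE ?mulr_ge0 ?invr_ge0 ?sqrtr_ge0//.
Qed.
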